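(* There are positive constants $c_3$ and $c_4$ depending only on $\alpha$, $M$ and $q$ such that the following holds. Let $u\in\mathcal{X}$ be the solution of the weak parabolic problem (P) and $u_\tau\in\mathcal{S}_\tau$ the solution of the discontinuous Galerkin problem (DG), both stated in the context. If $q\ge0$ and $u^{(q)}\in\mathcal{X}=L^2(J;V)\cap H^1(J;V')$, then $$\left(\sum_{n=0}^{N-1}\|u'-u_\tau'\|_{L^2(J_n;V')}^2\right)^{1/2}+\|u-u_\tau\|_{L^2(J;V)}\le c_3\,\tau^q\,\|u^{(q)}\|_{\mathcal{X}}.$$ Moreover, if $q\ge1$ and $u^{(q+1)}\in L^2(J;V)$, then $$\sup_{1\le n\le N}\|u(t_n)-u_\tau(t_n)\|+\|u-u_\tau\|_{L^2(J;V)}\le c_4\,\tau^{q+1}\,\|u^{(q+1)}\|_{L^2(J;V)}.$$ If $q=0$ and $u'\in\mathcal{X}$, then $$\sup_{1\le n\le N}\|u(t_n)-u_\tau(t_n)\|+\|u-u_\tau\|_{L^2(J;V)}\le c_4\,\tau\,\|u'\|_{\mathcal{X}}.$$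
   Context: Fix real Hilbert spaces $V\subset H$, with $V$ dense in $H$ and continuous injection. Norms are $\|\cdot\|_V$ and $\|\cdot\|=\|\cdot\|_H$; $(\cdot,\cdot)$ is the inner product of $H$. Identify $H$ with $H'$, so $V\subset H\subset V'$, and let $\langle\cdot,\cdot\rangle$ be the duality pairing between $V'$ and $V$. Let $T>0$, $J=(0,T)$. For a.e. $t\in J$ let $A(t):V\to V'$ be linear (with $t\mapsto\langle A(t)w,v\rangle$ measurable for $w,v\in V$), and let $M,\alpha>0$ be constants independent of $t$ such that for a.e. $t\in J$: $|\langle A(t)w,v\rangle|\le M\|w\|_V\|v\|_V$ for all $w,v\in V$, and $\langle A(t)v,v\rangle\ge\alpha\|v\|_V^2$ for all $v\in V$. Let $\mathcal{X}=L^2(J;V)\cap H^1(J;V')$ with $\|w\|_{\mathcal{X}}^2=\|w\|_{L^2(J;V)}^2+\|w'\|_{L^2(J;V')}^2$; $\mathcal X$ is embedded in $C^0(\overline J;H)$. Write $u^{(s)}=(d/dt)^su$. Given $F\in L^2(J;V')$ and $u_0\in H$, problem (P) is: find $u\in\mathcal{X}$ with $$\int_J[\langle u',v_1\rangle+\langle A(t)u,v_1\rangle]dt+(u(0),v_2)=\int_J\langle F,v_1\rangle dt+(u_0,v_2)\quad\forall (v_1,v_2)\in L^2(J;V)\times H.$$ Partition: $0=t_0<t_1<\cdots<t_N=T$, $J_n=(t_n,t_{n+1}]$, $\tau_n=t_{n+1}-t_n$ ($0\le n\le N-1$), $\tau=\max_n\tau_n$, and it is assumed that $\tau\le1$. For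 an integer $q\ge0$, $\mathcal{S}_\tau$ is the set of functions $v$ on $(0,T]$ such that for each $n$ the restriction $v|_{J_n}$ is a $V$-valued polynomial in $t$ of degree $\le q$. Write $v^{n,+}=\lim_{t\downarrow t_n}v(t)$ and $v^{n+1}=v(t_{n+1})$ for $n=0,\dots,N-1$. Derivatives of elements of $\mathcal{S}_\tau$ are taken on each $J_n$. Set $$B_\tau(w,v)=\sum_{n=0}^{N-1}\int_{J_n}\left[(w',v)+\langle A(t)w,v\rangle\right]dt+(w^{0,+},v^{0,+})+\sum_{n=1}^{N-1}(w^{n,+}-w^n,v^{n,+}).$$ Problem (DG): find $u_\tau\in\mathcal{S}_\tau$ with $B_\tau(u_\tau,v_\tau)=\int_J\langle F,v_\tau\rangle dt+(u_0,v_\tau^{0,+})$ for all $v_\tau\in\mathcal{S}_\tau$. *)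

(* Defs.v *)
From HB Require Import structures.
From mathcomp Require Import all_boot all_order all_algebra.
From mathcomp Require Import ring.
From mathcomp Require Import all_classical all_reals all_analysis.

Set Implicit Arguments.
Unset Strict Implicit.
Unset Printing Implicit Defensive.

Import Order.TTheory GRing.Theory Num.Theory.
Import numFieldNormedType.Exports.

Local Open Scope classical_set_scope.
Local Open Scope ring_scope.

HB.mixin Record CompleteNormedModule_isHilbert (R : realType) H
    & CompleteNormedModule R H := {
  inner : H -> H -> R ;
  innerC : forall x y, inner x y = inner y x ;
  innerPl : forall (a : R) x y z,
    inner (a *: x + y) z = a * inner x z + inner y z ;
  innerxx : forall x, inner x x = `|x| ^+ 2 }.

#[short(type="hilbertType")]
HB.structure Definition Hilbert (R : realType) :=
  { H of CompleteNormedModule_isHilbert R H & CompleteNormedModule R H }.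

Section BoundedLinear.
Context {R : realType}.
Variables (V W : normedModType R).

Definition blin_pred : {pred (V -> W)} :=
  fun f => `[< linear f /\ continuous f >].

Lemma blin_predP f : reflect (linear f /\ continuous f) (f \in blin_pred).
Proof. exact: asboolP. Qed.

Lemma blin_submod : submod_closed blin_pred.
Proof.
split.
  apply/blin_predP; split; last exact: cst_continuous.
  by move=> a x y /=; rewrite scaler0 addr0.
move=> a f g /blin_predP[fl fc] /blin_predP[gl gc]; apply/blin_predP; split.
  move=> b x y; rewrite !fctE/= fl gl.
  rewrite !scalerDr !scalerA (mulrC a b) -!addrA; congr (_ + _).
  by rewrite addrCA.
move=> x; apply: (@cvgD _ W _ (nbhs x)); last exact: gc.
by apply: (@cvgZl_tmp _ W _ (nbhs x)); exact: fc.
Qed.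

HB.instance Definition _ := GRing.isSubmodClosed.Build R (V -> W) blin_pred
  blin_submod.

Record blin := BLin { blin_fun :> V -> W ; blin_funP : blin_fun \in blin_pred }.

HB.instance Definition _ := [isSub for blin_fun].
HB.instance Definition _ := gen_eqMixin blin.
HB.instance Definition _ := gen_choiceMixin blin.
HB.instance Definition _ := [SubChoice_isSubLmodule of blin by <:].


Lemma blin_is_linear (f : blin) : linear f.
Proof. by case/blin_predP: (blin_funP f). Qed.

Lemma blin_continuous (f : blin) : continuous f.
Proof. by case/blin_predP: (blin_funP f). Qed.

HB.instance Definition _ (f : blin) :=
  GRing.isLinear.Build R V W *:%R (blin_fun f) (@blin_is_linear f).

Definition blin_norm (f : blin) : R :=
  sup [set `|f v| | v in [set v : V | `|v| <= 1]].

Lemma blin_norm_has_sup (f : blin) :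
  has_sup [set `|f v| | v in [set v : V | `|v| <= 1]].
Proof.
split; first by exists `|f 0|, 0 => //=; rewrite normr0.
have /linear_bounded_continuous/linear_boundedP := @blin_continuous f.
move=> /pinfty_ex_gt0[r r0 fr]; exists r => _ [v /= v1 <-].
by apply: le_trans (fr v) _; rewrite ler_piMr// ltW.
Qed.

Lemma ler_blin_norm (f : blin) v : `|f v| <= blin_norm f * `|v|.
Proof.
have [->|v0] := eqVneq v 0; first by rewrite linear0 !normr0 mulr0.
have nv0 : 0 < `|v| by rewrite normr_gt0.
rewrite -ler_pdivrMr// mulrC -[X in X * _]ger0_norm ?invr_ge0//.
rewrite -normrZ -linearZ; apply: sup_upper_bound (blin_norm_has_sup f) _ _.
exists (`|v|^-1 *: v) => //=.
by rewrite normrZ ger0_norm ?invr_ge0// mulVf// gt_eqF.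
Qed.

Lemma blin_norm_le (f : blin) c : 0 <= c ->
  (forall v, `|f v| <= c * `|v|) -> blin_norm f <= c.
Proof.
move=> c0 fc; apply: ge_sup; first by case: (blin_norm_has_sup f).
by move=> _ [v /= v1 <-]; apply: le_trans (fc v) _; rewrite ler_piMr.
Qed.

Lemma blin_norm_ge0 (f : blin) : 0 <= blin_norm f.
Proof.
apply: le_trans (normr_ge0 (f 0)) _.
apply: sup_upper_bound (blin_norm_has_sup f) _ _.
by exists 0 => //=; rewrite normr0.
Qed.

Lemma blin_normD (f g : blin) : blin_norm (f + g) <= blin_norm f + blin_norm g.
Proof.
apply: blin_norm_le; first by rewrite addr_ge0// blin_norm_ge0.
move=> v; rewrite mulrDl; apply: le_trans (ler_normD _ _) _.
by apply: lerD; exact: ler_blin_norm.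
Qed.

Lemma blin_normZ (a : R) (f : blin) : blin_norm (a *: f) = `|a| * blin_norm f.
Proof.
have le b g : blin_norm (b *: g) <= `|b| * blin_norm g.
  apply: blin_norm_le; first by rewrite mulr_ge0// blin_norm_ge0.
  by move=> v; rewrite [_ v]/(b *: g v) normrZ -mulrA ler_wpM2l// ler_blin_norm.
apply/eqP; rewrite eq_le le/=.
have [->|a0] := eqVneq a 0; first by rewrite normr0 mul0r blin_norm_ge0.
rewrite -ler_pdivlMl ?normr_gt0// -normfV.
by apply: le_trans (le _ _); rewrite scalerA mulVf// scale1r.
Qed.

Lemma blin_norm_eq0 (f : blin) : blin_norm f = 0 -> f = 0.
Proof.
move=> f0; apply: val_inj; apply/funext => v /=; apply/eqP.
by rewrite -normr_le0; apply: le_trans (ler_blin_norm f v) _; rewrite f0 mul0r.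
Qed.

HB.instance Definition _ :=
  Lmodule_isNormed.Build R blin blin_normD blin_normZ blin_norm_eq0.

Lemma blin_normE (f : blin) : `|f| = blin_norm f. Proof. by []. Qed.

End BoundedLinear.

Notation "V ^dual" := (blin V _^o) (at level 2, format "V ^dual") : type_scope.

Section InnerProduct.
Context {R : realType} {H : hilbertType R}.
Implicit Types x y z : H.

Lemma innerPr (a : R) x y z : inner x (a *: y + z) = a * inner x y + inner x z.
Proof. by rewrite innerC innerPl !(innerC x). Qed.

Lemma inner_polar x y :
  inner x y = (`|x + y| ^+ 2 - `|x - y| ^+ 2) / 4.
Proof.
have hD z : inner x (y + z) = inner x y + inner x z.
  by rewrite -[y in LHS]scale1r innerPr mul1r.
have e (a : R) : `|x + a *: y| ^+ 2 =
    inner x x + 2 * a * inner x y + a ^+ 2 * inner y y.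
  rewrite -innerxx [x + _]addrC innerPl [inner y _]innerC [inner x _]innerC.
  by rewrite !innerPl (innerC y x); ring.
have := e 1; have := e (-1); rewrite scaleN1r scale1r => -> ->.
by field.
Qed.

Lemma inner_continuous x : continuous (inner x).
Proof.
move=> y; rewrite (funext (inner_polar x)).
have sq (f : H -> H) : {for y, continuous f} ->
    (fun z => `|f z| ^+ 2) @ y --> `|f y| ^+ 2.
  move=> fy; rewrite expr2; under eq_fun do rewrite expr2.
  exact: (cvgM (cvg_norm fy) (cvg_norm fy)).
have fD : {for y, continuous (fun z : H => x + z)}.
  exact: (cvgD (cvg_cst x) cvg_id).
have fB : {for y, continuous (fun z : H => x - z)}.
  exact: (cvgB (cvg_cst x) cvg_id).
apply: (@cvgM R H (nbhs y) _
  (fun z => `|x + z| ^+ 2 - `|x - z| ^+ 2) (fun=> 4^-1)); last exact: cvg_cst.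
exact: (@cvgB _ R^o _ _ _ _ _ _ _ (sq _ fD) (sq _ fB)).
Qed.

End InnerProduct.

Section GelfandTriple.
Context {R : realType} {V H : hilbertType R}.
Variable iota : blin V H.

Lemma HtoV'_subproof (h : H) :
  (fun v : V => inner h (iota v) : R^o) \in @blin_pred R V R^o.
Proof.
apply/blin_predP; split=> [a x y|x]; first by rewrite linearP innerPr.
by apply: continuous_comp; [exact: blin_continuous|exact: inner_continuous].
Qed.

Definition HtoV' (h : H) : V^dual := BLin (HtoV'_subproof h).

Definition VtoV' (v : V) : V^dual := HtoV' (iota v).

End GelfandTriple.

(* `lebesgue_measure` lives on the Borel sigma-algebra.  The predicates below
   ask for Borel measurability up to a null set, i.e. for Lebesgue
   measurability.  The integral of such a function is still the expected one,
   since the library's integral is computed from the Borel simple functions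
   below the integrand. *)
Section L2.
Context {R : realType}.
Notation mu := (@lebesgue_measure R).
Implicit Type D : set R.

Definition lebesgue_measurable_fun D (f : R -> R) :=
  exists2 g : R -> R, measurable_fun setT g &
    {ae mu, forall t, D t -> f t = g t}.

Section Bochner.
Context {E : normedModType R}.
Implicit Type f : R -> E.

Definition simple_fun f :=
  finite_set (range f) /\ forall y, measurable (f @^-1` [set y]).

Definition strongly_measurable D f :=
  exists2 s : nat -> R -> E, forall k, simple_fun (s k) &
    {ae mu, forall t, D t -> s k t @[k --> \oo] --> f t}.

Definition in_L2 D f :=
  strongly_measurable D f /\
  (\int[mu]_(t in D) (`|f t| ^+ 2)%:E < +oo)%E.

Definition L2norm D f : R := Num.sqrt (\int[mu]_(t in D) (`|f t| ^+ 2)).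

End Bochner.

Definition test_fun (T : R) (phi : R -> R) :=
  (forall k t, derivable (derive1n k phi) t 1) /\
  exists a b, [/\ 0 < a, b < T & forall t, t \notin `[a, b] -> phi t = 0].

(* g is the k-th distributional derivative of f on (0, T): the identity
   int phi^(k) f = (-1)^k int phi g of V'-valued integrals is evaluated at
   each v in V. *)
Definition weak_derivn {V : normedModType R} (T : R) (k : nat)
    (f g : R -> V^dual) :=
  forall phi, test_fun T phi -> forall v : V,
    \int[mu]_(t in `]0, T[) (derive1n k phi t * f t v) =
    (-1) ^+ k * \int[mu]_(t in `]0, T[) (phi t * g t v).

End L2.

Section ParabolicProblem.
Context {R : realType} {V H : hilbertType R}.
Variable iota : blin V H.
Notation mu := (@lebesgue_measure R).

Definition gelfand_triple := injective iota /\ dense (range iota).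

Definition elliptic_family (T M alpha : R) (A : R -> V -> V^dual) :=
  [/\ {ae mu, forall t, t \in `]0, T[ -> linear (A t)},
      forall w v, lebesgue_measurable_fun `]0, T[ (fun t => A t w v),
      {ae mu, forall t, t \in `]0, T[ ->
        forall w v, `|A t w v| <= M * `|w| * `|v|} &
      {ae mu, forall t, t \in `]0, T[ ->
        forall v, alpha * `|v| ^+ 2 <= A t v v}].

(* w belongs to the space X = L^2(J; V) \cap H^1(J; V') and w' = dw. *)
Definition in_X (T : R) (w : R -> V) (dw : R -> V^dual) :=
  [/\ in_L2 `]0, T[ w, in_L2 `]0, T[ dw &
      weak_derivn T 1 (VtoV' iota \o w) dw].

Definition Xnorm (T : R) (w : R -> V) (dw : R -> V^dual) : R :=
  Num.sqrt (L2norm `]0, T[ w ^+ 2 + L2norm `]0, T[ dw ^+ 2).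

(* The H-valued representative of w, continuous on [0, T]; it exists for w in
   X and is unique on [0, T], by the embedding of X in C^0([0, T]; H). *)
Definition C0rep (T : R) (w : R -> V) : R -> H :=
  xget (cst 0) [set wb : R -> H | {within `[0, T], continuous wb} /\
    {ae mu, forall t, t \in `]0, T[ -> wb t = iota (w t)}].

Definition parabolic_solution (T : R) (A : R -> V -> V^dual) (F : R -> V^dual)
    (u0 : H) (u : R -> V) (du : R -> V^dual) :=
  in_X T u du /\
  forall (v1 : R -> V) (v2 : H), in_L2 `]0, T[ v1 ->
    \int[mu]_(t in `]0, T[) (du t (v1 t) + A t (u t) (v1 t))
      + inner (C0rep T u 0) v2 =
    \int[mu]_(t in `]0, T[) F t (v1 t) + inner u0 v2.

Definition is_partition (T : R) (N : nat) (t : nat -> R) :=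
  [/\ t 0%N = 0, t N = T & forall n, (n < N)%N -> t n < t n.+1].

Definition mesh (N : nat) (t : nat -> R) : R :=
  \big[Num.max/0]_(n < N) (t n.+1 - t n).

Definition in_Stau (q N : nat) (t : nat -> R) (v : R -> V) :=
  forall n, (n < N)%N -> exists p : 'I_q.+1 -> V,
    forall s, s \in `]t n, t n.+1] -> v s = \sum_(i < q.+1) s ^+ i *: p i.

(* For a piecewise polynomial w, `derive1 w` is the derivative of the piece on
   (t_n, t_(n+1)] except at the endpoint t_(n+1), which is a null set. *)
Definition Btau (A : R -> V -> V^dual) (N : nat) (t : nat -> R)
    (w v : R -> V) : R :=
  \sum_(n < N) \int[mu]_(s in `]t n, t n.+1])
      (inner (iota (derive1 w s)) (iota (v s)) + A s (w s) (v s))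
  + inner (iota (lim (w @ (t 0%N)^'+))) (iota (lim (v @ (t 0%N)^'+)))
  + \sum_(1 <= n < N)
      inner (iota (lim (w @ (t n)^'+) - w (t n))) (iota (lim (v @ (t n)^'+))).

Definition dg_solution (T : R) (A : R -> V -> V^dual) (F : R -> V^dual)
    (u0 : H) (q N : nat) (t : nat -> R) (utau : R -> V) :=
  in_Stau q N t utau /\
  forall v, in_Stau q N t v ->
    Btau A N t utau v =
    \int[mu]_(s in `]0, T[) F s (v s)
      + inner u0 (iota (lim (v @ (t 0%N)^'+))).

Definition nodal_error (T : R) (N : nat) (t : nat -> R) (u utau : R -> V) : R :=
  \big[Num.max/0]_(1 <= n < N.+1) `|C0rep T u (t n) - iota (utau (t n))|.

End ParabolicProblem.

(* Main.v *)
Require Import Defs.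
From HB Require Import structures.
From mathcomp Require Import all_boot all_order all_algebra.
From mathcomp Require Import ring lra.
From mathcomp Require Import all_classical all_reals all_analysis measurable_realfun.
Set Implicit Arguments.
Unset Strict Implicit.
Unset Printing Implicit Defensive.
Import Order.TTheory GRing.Theory Num.Theory.
Import numFieldNormedType.Exports.
Local Open Scope classical_set_scope.
Local Open Scope ring_scope.

(** The estimates compare u_tau with a polynomial interpolant p of u on each
    interval J_n, chosen so that the scheme does not see the time derivative
    of u - p.

    Functions with values in V' are turned into V-valued ones by the Riesz
    isometry ([riesz]); the H inner product becomes an operator [mass] on V,
    and V-valued integrals are the vectors that represent the scalar ones
    ([vint]). A relation u^(k) = w between weak derivatives then says that u
    is almost everywhere a k-fold primitive of w ([weak_repr]): one order is
    removed at a time, and order 0 is the fundamental lemma. Hence Taylor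
    expansion at the right endpoint of an interval approximates u by
    polynomials ([taylor]). Correcting the Taylor polynomial by multiples of
    t_(n+1) - t gives an interpolant of the same quality that equals u at
    t_(n+1) and whose error is orthogonal to the polynomials of degree < q
    ([thomee], [interp_regular]).

    The value of u in H at each time is obtained from the embedding of X in
    C([0, T]; H) ([trace_rep]). Its proof follows u along points at which u
    is controlled in V and that approach the given time through intervals of
    dyadic lengths; the increments of the H norm telescope ([chain_step]).

    Testing both problems with a polynomial on J_n, extended by 0, isolates
    the scheme on J_n ([dg_local]). With the test function theta = p - u_tau,
    integration by parts leaves only boundary terms, which complete squares,
    and coercivity gives
      |e_(n+1)|^2 + alpha |theta|^2
        <= |e_n|^2 + (M^2 / alpha) |u - p|^2 + |u(t_(n+1)) - p(t_(n+1))|^2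
    for the nodal errors e_n in H, with the middle norms in L^2(J_n; V)
    ([energy_step]). The sum over n bounds the nodal errors and the error in
    L^2(J; V) by the interpolation error ([stability]). When q = 0 and u is
    only in X, p is the value of u at a suitable point of J_n
    ([constant_error]).

    For the derivative, subtract from u_tau' a Taylor polynomial of u'. The
    local equation, tested with polynomials that vanish at t_n, bounds the
    moments of this difference for the weight t - t_n by the error already
    estimated, and a Gram matrix argument recovers the difference from these
    moments ([dual_weights], [derivative_local]). The constants depend only
    on alpha, M and q because all local constructions are scale invariant. *)

(** * Integration up to null sets *)

Section Integral.
Context {R : realType}.
Notation mu := (@lebesgue_measure R).
Implicit Types (D : set R) (f g h : R -> R).

Lemma aeS (P Q : R -> Prop) : (forall t, P t -> Q t) ->
  {ae mu, forall t, P t} -> {ae mu, forall t, Q t}.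
Proof.
move=> PQ [N [mN N0 sub]]; exists N; split => //.
by move=> t nQ; apply: sub => /PQ.
Qed.

Lemma aeS2 (P P' Q : R -> Prop) : (forall t, P t -> P' t -> Q t) ->
  {ae mu, forall t, P t} -> {ae mu, forall t, P' t} -> {ae mu, forall t, Q t}.
Proof.
move=> PQ [N [mN N0 sub]] [N' [mN' N0' sub']].
have /measure_negligible h : mu.-negligible (N `|` N').
  by apply: negligibleU; apply/negligibleP.
exists (N `|` N'); split; [exact: measurableU | by apply: h; exact: measurableU |].
move=> t nQ; apply: contrapT => /not_orP[nN nN']; apply: nQ; apply: PQ.
  by apply: contrapT => np; apply: nN; apply: sub.
by apply: contrapT => np; apply: nN'; apply: sub'.
Qed.

Lemma aeS3 (P P' P'' Q : R -> Prop) : (forall t, P t -> P' t -> P'' t -> Q t) ->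
  {ae mu, forall t, P t} -> {ae mu, forall t, P' t} -> {ae mu, forall t, P'' t} ->
  {ae mu, forall t, Q t}.
Proof.
move=> PQ p p' p''; apply: (aeS2 _ (aeS2 _ p p') p''); last first.
  by move=> t; exact: conj.
by move=> t [] /PQ.
Qed.

Import HBNNSimple.

(** The integral of a nonnegative function is a supremum over the simple
    functions below it. Multiplying such a simple function by the indicator of
    the complement of a null Borel set keeps its integral and puts it below
    any function that dominates almost everywhere. *)
Lemma le_integral_ae D (f g : R -> \bar R) :
  (forall t, D t -> (0 <= f t)%E) -> (forall t, D t -> (0 <= g t)%E) ->
  {ae mu, forall t, D t -> (f t <= g t)%E} ->
  (\int[mu]_(t in D) f t <= \int[mu]_(t in D) g t)%E.
Proof.
move=> f0 g0 [N [mN N0 subN]].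
rewrite ge0_integralE// ge0_integralE//.
apply: ge_ereal_sup => _ [h hf <-].
pose k := mul_nnsfun h (indic_nnsfun R (measurableC mN)).
have kE t : k t = h t * \1_(~` N) t by [].
have -> : sintegral mu h = sintegral mu k.
  rewrite -!integralT_nnsfun; apply: ae_eq_integral => //.
    by apply/measurable_EFinP.
    by apply/measurable_EFinP.
  exists N; split => // t /=; apply: contra_notP => Nt _; congr EFin.
  by rewrite -[RHS]kE kE indicE mem_set ?mulr1.
apply: ereal_sup_ubound; exists k => // t.
rewrite kE indicE; have [Nt|nNt] := pselect (N t).
  rewrite memNset ?mulr0; last by move=> /(_ Nt).
  by rewrite /patch; case: ifPn => // /set_mem /g0.
rewrite mem_set// mulr1; apply: le_trans (hf t) _.
rewrite /patch; case: ifPn => // tD.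
by apply: contra_notT nNt => nfg; apply: subN => /=; apply/not_implyP; split;
  [exact/set_mem|exact/negP].
Qed.

Lemma ge0_integral_ae D (f g : R -> \bar R) :
  (forall t, D t -> (0 <= f t)%E) -> (forall t, D t -> (0 <= g t)%E) ->
  {ae mu, forall t, D t -> f t = g t} ->
  (\int[mu]_(t in D) f t = \int[mu]_(t in D) g t)%E.
Proof.
move=> f0 g0 fg; apply/eqP; rewrite eq_le; apply/andP; split;
  apply: le_integral_ae => //; apply: aeS _ fg => t /[apply] ->; exact: lexx.
Qed.

Lemma rint_ae D f g : {ae mu, forall t, D t -> f t = g t} ->
  \int[mu]_(t in D) f t = \int[mu]_(t in D) g t.
Proof.
move=> fg; congr fine; rewrite integralE [in RHS]integralE.
congr (_ - _)%E; apply: ge0_integral_ae => //;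
  by apply: aeS _ fg => t /[apply] ftgt; rewrite unlock /= ftgt.
Qed.

(** Integrable up to a null set: measurability is only known up to null sets
    for the data of the problem, and this class is where the rules of calculus
    below apply to them. *)
Definition LI D f := exists2 g, mu.-integrable setT (EFin \o g) &
  {ae mu, forall t, D t -> f t = g t}.

Lemma LI_ae D f g : {ae mu, forall t, D t -> f t = g t} -> LI D g -> LI D f.
Proof.
move=> fg [h ih gh]; exists h => //.
by apply: aeS2 _ fg gh => t fg gh Dt; rewrite fg// gh.
Qed.

Lemma LI_sub D D' f : D' `<=` D -> LI D f -> LI D' f.
Proof. by move=> sub [g ig fg]; exists g => //; apply: aeS _ fg => t + /sub. Qed.

Lemma LI_integrable D f : measurable D -> LI D f ->
  exists g, [/\ measurable_fun setT g, mu.-integrable D (EFin \o g),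
    {ae mu, forall t, D t -> f t = g t} &
    \int[mu]_(t in D) f t = \int[mu]_(t in D) g t].
Proof.
move=> mD [g ig fg]; exists g; split => //.
- by apply/measurable_EFinP; exact: measurable_int ig.
- exact: integrableS ig.
- exact: rint_ae.
Qed.

Lemma LID D f g : LI D f -> LI D g -> LI D (fun t => f t + g t).
Proof.
move=> [f' f1 f2] [g' g1 g2]; exists (fun t => f' t + g' t).
  exact: (@integrableD _ _ _ mu _ measurableT (EFin \o f') (EFin \o g')).
by apply: aeS2 _ f2 g2 => t h1 h2 Dt; rewrite h1// h2.
Qed.

Lemma LIZ D f c : LI D f -> LI D (fun t => c * f t).
Proof.
move=> [f' f1 f2]; exists (fun t => c * f' t).
  exact: (@integrableZl _ _ _ mu _ measurableT c (EFin \o f')).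
by apply: aeS _ f2 => t h1 Dt; rewrite h1.
Qed.

Lemma LI0 D : LI D (fun=> 0).
Proof. by exists (fun=> 0); [exact: integrable0 | apply/aeW]. Qed.

Lemma LIN D f : LI D f -> LI D (fun t => - f t).
Proof.
by move=> /(LIZ (-1)); under eq_fun do rewrite mulN1r.
Qed.

Lemma LIB D f g : LI D f -> LI D g -> LI D (fun t => f t - g t).
Proof. by move=> lf /LIN lg; exact: LID. Qed.

Lemma LI_abs D f : LI D f -> LI D (fun t => `|f t|).
Proof.
move=> [f' f1 f2]; exists (fun t => `|f' t|).
  exact: (integrable_norm f1).
by apply: aeS _ f2 => t h1 Dt; rewrite h1.
Qed.

Lemma LI_sum D (I : Type) (r : seq I) (P : pred I) (F : I -> R -> R) :
  (forall i, LI D (F i)) -> LI D (fun t => \sum_(i <- r | P i) F i t).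
Proof.
move=> FI; elim: r => [|i r IH].
  by under eq_fun do rewrite big_nil; exact: LI0.
under eq_fun do rewrite big_cons.
by case: (P i) => //; apply: LID.
Qed.

Section rules.
Variable D : set R.
Hypothesis mD : measurable D.

Lemma rintD f g : LI D f -> LI D g ->
  \int[mu]_(t in D) (f t + g t) = \int[mu]_(t in D) f t + \int[mu]_(t in D) g t.
Proof.
move=> /(LI_integrable mD)[f' [_ f1 f2 ->]] /(LI_integrable mD)[g' [_ g1 g2 ->]].
rewrite -RintegralD//; apply: rint_ae.
by apply: aeS2 _ f2 g2 => t h1 h2 Dt; rewrite h1// h2.
Qed.

Lemma rintZ c f : LI D f ->
  \int[mu]_(t in D) (c * f t) = c * \int[mu]_(t in D) f t.
Proof.
move=> /(LI_integrable mD)[f' [_ f1 f2 ->]].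
rewrite -RintegralZl//; apply: rint_ae.
by apply: aeS _ f2 => t h1 Dt; rewrite h1.
Qed.

Lemma rintN f : LI D f ->
  \int[mu]_(t in D) (- f t) = - \int[mu]_(t in D) f t.
Proof.
by move=> lf; rewrite -mulN1r -rintZ//; under eq_Rintegral do rewrite -mulN1r.
Qed.

Lemma rintB f g : LI D f -> LI D g ->
  \int[mu]_(t in D) (f t - g t) = \int[mu]_(t in D) f t - \int[mu]_(t in D) g t.
Proof. by move=> lf lg; rewrite rintD ?rintN//; exact: LIN. Qed.

Lemma rint0 : \int[mu]_(t in D) (0 : R) = 0.
Proof. by rewrite /Rintegral integral0. Qed.

Lemma rint_sum (I : Type) (r : seq I) (P : pred I) (F : I -> R -> R) :
  (forall i, LI D (F i)) ->
  \int[mu]_(t in D) (\sum_(i <- r | P i) F i t) =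
  \sum_(i <- r | P i) \int[mu]_(t in D) F i t.
Proof.
move=> FI; elim: r => [|i r IH].
  by under eq_Rintegral do rewrite big_nil; rewrite rint0 big_nil.
under eq_Rintegral do rewrite big_cons.
rewrite big_cons; case: ifP => // _; rewrite rintD ?IH//; exact: LI_sum.
Qed.

Lemma rint_le f g : LI D f -> LI D g ->
  {ae mu, forall t, D t -> f t <= g t} ->
  \int[mu]_(t in D) f t <= \int[mu]_(t in D) g t.
Proof.
move=> /(LI_integrable mD)[f' [mf f1 f2 ->]] /(LI_integrable mD)[g' [mg g1 g2 ->]] fg.
have -> : \int[mu]_(t in D) f' t = \int[mu]_(t in D) Num.min (f' t) (g' t).
  apply: rint_ae; apply: aeS3 _ f2 g2 fg => t h1 h2 h3 Dt.
  by apply/esym/min_idPl; rewrite -h1// -h2// h3.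
apply: le_Rintegral => //; last by move=> t _; rewrite ge_min lexx orbT.
have : mu.-integrable D (EFin \o (fun t => `|f' t| + `|g' t|)).
  exact: (@integrableD _ _ _ mu _ mD (EFin \o (fun t => `|f' t|))
    (EFin \o (fun t => `|g' t|)) (integrable_norm f1) (integrable_norm g1)).
apply: le_integrable => //.
  apply/measurable_EFinP; apply: measurable_minr; exact: measurable_funTS.
move=> t Dt /=; rewrite lee_fin [leRHS]ger0_norm ?addr_ge0//.
by rewrite /Num.min; case: ifP => _; rewrite ?lerDl ?lerDr.
Qed.

Lemma rint_ge0 f : {ae mu, forall t, D t -> 0 <= f t} ->
  0 <= \int[mu]_(t in D) f t.
Proof.
move=> f0; rewrite (@rint_ae _ _ (fun t => Num.max 0 (f t))).
  by apply: Rintegral_ge0 => t _; rewrite le_max lexx.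
by apply: aeS _ f0 => t /[apply] /max_idPr.
Qed.

(** Domination by an integrable function is enough to compare: the integral
    only depends on simple functions below the integrand. *)
Lemma rint_le_dom f g : {ae mu, forall t, D t -> 0 <= f t <= g t} -> LI D g ->
  \int[mu]_(t in D) f t <= \int[mu]_(t in D) g t.
Proof.
move=> fg lg; have [g' [mg g1 g2 gg]] := LI_integrable mD lg.
rewrite (@rint_ae _ f (fun t => Num.max 0 (f t))); last first.
  by apply: aeS _ fg => t /[apply] /andP[/max_idPr].
rewrite (@rint_ae _ g (fun t => Num.max 0 (g' t))); last first.
  by apply: aeS2 _ fg g2 => t h1 h2 Dt; have /andP[/le_trans h /h] := h1 Dt;
    rewrite h2// => /max_idPr.
have ifin : (\int[mu]_(t in D) (Num.max 0 (g' t))%:E < +oo)%E.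
  have /integrableP[_] := g1; apply: le_lt_trans.
  apply: ge0_le_integral => //.
  - by move=> t Dt; rewrite lee_fin le_max lexx.
  - by apply/measurable_EFinP; apply: measurable_maxr => //; exact: measurable_funTS.
  - by apply/measurable_EFinP; apply: measurableT_comp => //; exact: measurable_funTS.
  - by move=> t Dt /=; rewrite lee_fin ge_max normr_ge0 ler_norm.
rewrite /Rintegral.
have le1 : (\int[mu]_(t in D) (Num.max 0 (f t))%:E <=
    \int[mu]_(t in D) (Num.max 0 (g' t))%:E)%E.
  apply: le_integral_ae => [t Dt|t Dt|].
  - by rewrite lee_fin le_max lexx.
  - by rewrite lee_fin le_max lexx.
  apply: aeS2 _ fg g2 => t h1 h2 Dt; rewrite lee_fin -h2//.
  by have /andP[a b] := h1 Dt; rewrite !(max_idPr _)// (le_trans a b).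
have ge (k : R -> R) : (0 <= \int[mu]_(t in D) (Num.max 0 (k t))%:E)%E.
  by apply: integral_ge0 => t Dt; rewrite lee_fin le_max lexx.
apply: fine_le => //; rewrite ge0_fin_numE//.
exact: le_lt_trans le1 ifin.
Qed.

Lemma rint_abs f : LI D f ->
  `|\int[mu]_(t in D) f t| <= \int[mu]_(t in D) `|f t|.
Proof.
move=> lf; have [g [mg g1 g2 ->]] := LI_integrable mD lf.
have /le_trans := @le_normr_Rintegral _ _ _ mu D g mD g1; apply.
rewrite (@rint_ae _ (fun t => `|g t|) (fun t => `|f t|))//.
by apply: aeS _ g2 => t /[apply] ->.
Qed.

(** The form in which a vanishing average or a vanishing energy forces a
    function to vanish. *)
Lemma rint_eq0_ae f : LI D f -> {ae mu, forall t, D t -> 0 <= f t} ->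
  \int[mu]_(t in D) f t <= 0 -> {ae mu, forall t, D t -> f t = 0}.
Proof.
move=> lf f0; have [g [mg g1 g2 ->]] := LI_integrable mD lf.
have g0 : {ae mu, forall t, D t -> g t = `|g t|}.
  by apply: aeS2 _ f0 g2 => t h1 h2 Dt; rewrite ger0_norm// -h2// h1.
rewrite (rint_ae g0) => h.
have h0 : (\int[mu]_(t in D) `|(g t)%:E| = 0)%E.
  have := @EFin_normr_Rintegral _ _ _ mu D (fun t => `|g t|) mD (integrable_norm g1).
  rewrite gee0_abs; last by apply: integral_ge0 => t Dt; rewrite lee_fin.
  move=> /= <-; congr EFin; apply/eqP; rewrite normr_eq0 eq_le h/=.
  by apply: Rintegral_ge0.
have := (ae_eq_integral_abs mu mD (measurable_int _ g1)).1 h0.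
by apply: aeS2 _ g2 => t h1 h2 Dt; rewrite h1//; have [] := h2 Dt.
Qed.

End rules.

Lemma rint_mkcond D D' f : D' `<=` D ->
  \int[mu]_(t in D') f t = \int[mu]_(t in D) (\1_D' t * f t).
Proof.
move=> sub; rewrite Rintegral_mkcond [in RHS]Rintegral_mkcond.
apply: eq_Rintegral => t _; rewrite /patch indicE.
case: ifPn => [/set_mem tD'|]; first by rewrite mem_set ?mul1r//; exact: sub.
by rewrite mul0r; case: ifP.
Qed.

End Integral.

(** * Inner products *)

Section InnerTheory.
Context {R : realType} {V : hilbertType R}.
Implicit Types x y z : V.

Lemma innerDl x y z : inner (x + y) z = inner x z + inner y z.
Proof. by rewrite -{1}[x]scale1r innerPl mul1r. Qed.
Lemma innerDr x y z : inner x (y + z) = inner x y + inner x z.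
Proof. by rewrite innerC innerDl !(innerC x). Qed.
Lemma inner0l x : inner 0 x = 0.
Proof. by have := innerDl 0 0 x; rewrite addr0 => /eqP; rewrite -subr_eq0 opprD addNKr oppr_eq0 => /eqP. Qed.
Lemma inner0r x : inner x 0 = 0. Proof. by rewrite innerC inner0l. Qed.
Lemma innerZl (a : R) x y : inner (a *: x) y = a * inner x y.
Proof. by rewrite -[a *: x]addr0 innerPl inner0l addr0. Qed.
Lemma innerZr (a : R) x y : inner x (a *: y) = a * inner x y.
Proof. by rewrite innerC innerZl innerC. Qed.
Lemma innerNl x y : inner (- x) y = - inner x y.
Proof. by rewrite -scaleN1r innerZl mulN1r. Qed.
Lemma innerNr x y : inner x (- y) = - inner x y.
Proof. by rewrite innerC innerNl innerC. Qed.
Lemma innerBl x y z : inner (x - y) z = inner x z - inner y z.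
Proof. by rewrite innerDl innerNl. Qed.
Lemma innerBr x y z : inner x (y - z) = inner x y - inner x z.
Proof. by rewrite innerDr innerNr. Qed.
Lemma inner_suml (I : Type) (r : seq I) (P : pred I) (F : I -> V) y :
  inner (\sum_(i <- r | P i) F i) y = \sum_(i <- r | P i) inner (F i) y.
Proof.
elim/big_rec2 : _ => [|i a b _ <-]; [exact: inner0l | exact: innerDl].
Qed.
Lemma inner_sumr (I : Type) (r : seq I) (P : pred I) (F : I -> V) y :
  inner y (\sum_(i <- r | P i) F i) = \sum_(i <- r | P i) inner y (F i).
Proof. by rewrite innerC inner_suml; apply: eq_bigr => i _; rewrite innerC. Qed.

Lemma inner_sqr_ge0 x : 0 <= inner x x. Proof. by rewrite innerxx sqr_ge0. Qed.

Lemma inner_CS x y : `|inner x y| <= `|x| * `|y|.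
Proof.
have [->|y0] := eqVneq y 0; first by rewrite inner0r !normr0 mulr0.
have ny : 0 < `|y| by rewrite normr_gt0.
have := inner_sqr_ge0 (`|y| ^+ 2 *: x - inner x y *: y).
rewrite innerBl !innerBr !innerZl !innerZr !innerxx (innerC y x) => h.
have {}h : 0 <= `|y| ^+ 2 * ((`|x| * `|y|) ^+ 2 - inner x y ^+ 2) by move: h; nra.
rewrite pmulr_rge0 ?exprn_gt0// subr_ge0 in h.
by rewrite -ler_sqr ?nnegrE ?mulr_ge0// real_normK// num_real.
Qed.

Lemma inner_young x y : `|inner x y| <= (`|x| ^+ 2 + `|y| ^+ 2) / 2.
Proof.
by apply: le_trans (inner_CS x y) _; have := sqr_ge0 (`|x| - `|y|); nra.
Qed.

(** Joint continuity of the inner product follows from continuity of the norm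
    by polarization. *)
Lemma cvg_inner {T : Type} (F : set_system T) {FF : Filter F} (f g : T -> V) x y :
  f @ F --> x -> g @ F --> y -> inner (f t) (g t) @[t --> F] --> inner x y.
Proof.
move=> fx gy; under eq_fun do rewrite inner_polar; rewrite inner_polar.
have sq (h : T -> V) z : h @ F --> z -> `|h t| ^+ 2 @[t --> F] --> `|z| ^+ 2.
  move=> hz; under eq_fun do rewrite expr2; rewrite expr2.
  by apply: cvgM; exact: cvg_norm.
apply: cvgMl; apply: (@cvgB _ R^o); [exact: (sq _ _ (cvgD fx gy))|].
exact: (sq _ _ (cvgB fx gy)).
Qed.

Lemma inner_eq0 x : (forall y, inner x y = 0) -> x = 0.
Proof.
by move=> /(_ x) /eqP; rewrite innerxx sqrf_eq0 normr_eq0 => /eqP.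
Qed.

Lemma normD_sqr x y : `|x + y| ^+ 2 = `|x| ^+ 2 + 2 * inner x y + `|y| ^+ 2.
Proof.
by rewrite -!innerxx innerDl !innerDr (innerC y x); ring.
Qed.

Lemma normB_sqr x y : `|x - y| ^+ 2 = `|x| ^+ 2 - 2 * inner x y + `|y| ^+ 2.
Proof. by rewrite normD_sqr innerNr normrN; ring. Qed.

(** The parallelogram identity, with one of the two diagonals dropped. *)
Lemma norm_sqrD_le x y : `|x + y| ^+ 2 <= 2 * `|x| ^+ 2 + 2 * `|y| ^+ 2.
Proof.
by rewrite normD_sqr; have := inner_sqr_ge0 (x - y); rewrite innerxx normB_sqr; lra.
Qed.

End InnerTheory.

(** * Strong measurability *)

Section StrongMeas.
Context {R : realType}.
Notation mu := (@lebesgue_measure R).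
Implicit Type D : set R.

Lemma simple_map2 (E E' E'' : normedModType R) (Phi : E -> E' -> E'')
    (s : R -> E) (s' : R -> E') : simple_fun s -> simple_fun s' ->
  simple_fun (fun t => Phi (s t) (s' t)).
Proof.
move=> [fs ms] [fs' ms']; split.
  apply: (@sub_finite_set _ _ [set Phi x y | x in range s & y in range s']).
    by move=> _ [t _ <-]; exists (s t); [by exists t|]; exists (s' t) => //; exists t.
  exact: finite_image2.
move=> y.
have -> : (fun t => Phi (s t) (s' t)) @^-1` [set y] =
    \bigcup_(a in range s) \bigcup_(b in range s' `&` [set b | Phi a b = y])
      (s @^-1` [set a] `&` s' @^-1` [set b]).
  apply/seteqP; split => [t /= e|t [a _ [b [_ /= e]]] [/= -> ->]//].
  exists (s t); first by exists t.
  by exists (s' t) => //; split => //; exists t.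
apply: fin_bigcup_measurable => // a _.
apply: fin_bigcup_measurable => [|b _]; first exact: finite_setIl.
exact: measurableI.
Qed.

Lemma simple_cst (E : normedModType R) (c : E) : simple_fun (fun _ : R => c).
Proof.
split.
  by apply: (@sub_finite_set _ _ [set c]) => // _ [t _ <-].
move=> y; have [->|ne] := eqVneq y c.
  by rewrite (_ : _ @^-1` _ = setT)//; apply/seteqP; split.
rewrite (_ : _ @^-1` _ = set0)//; apply/seteqP; split => // t /= e.
by move: ne; rewrite e eqxx.
Qed.

Lemma simple_indic (A : set R) : measurable A -> simple_fun (\1_A : R -> R^o).
Proof.
move=> mA; split.
  apply: (@sub_finite_set _ _ [set 0; 1]) => // _ [t _ <-] /=.
  by rewrite indicE; case: (t \in A); [right|left].
move=> y; rewrite -[_ @^-1` _]setTI; apply: (measurable_indic mA) => //.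
Qed.

Lemma ae_finite (I : choiceType) (A : set I) (P : I -> R -> Prop) : finite_set A ->
  (forall i, A i -> {ae mu, forall t, P i t}) ->
  {ae mu, forall t, forall i, A i -> P i t}.
Proof.
move=> /finite_seqP[X ->] h.
suff : {ae mu, forall t, forall i, i \in X -> P i t}.
  by apply: aeS => t ht i /= iX; apply: ht.
have {}h : forall i, i \in X -> {ae mu, forall t, P i t} by move=> i; exact: h.
elim: X h => [|i s IH] h; first by apply/aeW.
have h1 := h i (mem_head _ _).
have h2 := IH (fun j js => h j (mem_behead (s := i :: s) js)).
apply: aeS2 _ h1 h2 => t p ps j; rewrite inE => /orP[/eqP ->//|]; exact: ps.
Qed.

Notation aem := (@lebesgue_measurable_fun R).

(** A function of two variables that is measurable in the first one stays
    measurable after substitution of a simple function in the second: only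
    finitely many sections are glued. With [aem_lim] this gives the
    measurability of A(t) applied to strongly measurable functions. *)
Lemma aem_caratheodory (E : normedModType R) D (Psi : R -> E -> R) (s : R -> E) :
  simple_fun s -> (forall y, aem D (Psi^~ y)) -> aem D (fun t => Psi t (s t)).
Proof.
move=> [fs ms] /(_ _)/cid2 h.
pose g y := s2val (h y).
have mg y : measurable_fun setT (g y) := s2valP (h y).
have eg y := s2valP' (h y).
exists (fun t => g (s t) t).
  move=> _ B mB; rewrite setTI.
  have -> : (fun t => g (s t) t) @^-1` B =
      \bigcup_(y in range s) (s @^-1` [set y] `&` g y @^-1` B).
    apply/seteqP; split => [t /= Bt|t [y _ [/= <-]]//].
    by exists (s t) => //; exists t.
  apply: fin_bigcup_measurable => // y _; apply: measurableI => //.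
  by rewrite -[X in measurable X]setTI; apply: mg.
have := ae_finite fs (fun y _ => eg y); apply: aeS => t ht Dt.
by apply: ht => //; exists t.
Qed.

Lemma aem_lim D (f_ : nat -> R -> R) f : (forall k, aem D (f_ k)) ->
  {ae mu, forall t, D t -> f_ k t @[k --> \oo] --> f t} -> aem D f.
Proof.
move=> /(_ _)/cid2 h fl.
pose g k := s2val (h k).
have mg k : measurable_fun setT (g k) := s2valP (h k).
have eg k := s2valP' (h k).
exists (fun t => fine (limn_esup (fun k => (g k t)%:E))).
  apply: measurableT_comp => //.
  apply: (@measurable_fun_limn_esup _ _ _ setT (fun k t => (g k t)%:E)) => // k.
  exact/measurable_EFinP.
apply: aeS2 _ fl (ae_foralln eg) => t h1 h2 Dt.
have e : (fun k => (g k t)%:E) @ \oo --> (f t)%:E.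
  apply/cvg_EFin; first by apply: nearW => k.
  rewrite (_ : fine \o _ = f_^~ t); first exact: h1.
  by apply/funext => k /=; rewrite h2.
by rewrite (cvg_limn_einf_sup e).2.
Qed.

Lemma simple_Borel (s : R -> R^o) : simple_fun s -> measurable_fun setT (s : R -> R).
Proof.
move=> [fs ms] _ B mB; rewrite setTI.
have -> : s @^-1` B = \bigcup_(y in range s `&` B) (s @^-1` [set y]).
  apply/seteqP; split => [t /= Bt|t [y [_ By] /= ->]//].
  by exists (s t) => //; split => //; exists t.
apply: fin_bigcup_measurable => //; exact: finite_setIl.
Qed.

Lemma sm_aem D (f : R -> R^o) : strongly_measurable D f -> aem D f.
Proof.
move=> [s ss sf]; apply: aem_lim sf => k; exists (s k); first exact: simple_Borel.
by apply/aeW.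
Qed.

Lemma sm_map2 (E E' E'' : normedModType R) D (Phi : E -> E' -> E'') f g :
  (forall (x_ : nat -> E) (y_ : nat -> E') x y, x_ @ \oo --> x -> y_ @ \oo --> y ->
     Phi (x_ n) (y_ n) @[n --> \oo] --> Phi x y) ->
  strongly_measurable D f -> strongly_measurable D g ->
  strongly_measurable D (fun t => Phi (f t) (g t)).
Proof.
move=> cPhi [s ss sf] [s' ss' sg]; exists (fun k t => Phi (s k t) (s' k t)).
  by move=> k; apply: simple_map2.
apply: aeS2 _ sf sg => t h1 h2 Dt; apply: cPhi; [exact: h1|exact: h2].
Qed.

Lemma sm_simple (E : normedModType R) D (s : R -> E) : simple_fun s -> strongly_measurable D s.
Proof. by move=> ss; exists (fun=> s) => //; apply/aeW => t _; exact: cvg_cst. Qed.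

Lemma sm_cst (E : normedModType R) D (c : E) : strongly_measurable D (fun=> c).
Proof. exact/sm_simple/simple_cst. Qed.

Lemma sm_map (E E'' : normedModType R) D (Phi : E -> E'') f :
  (forall x_ x, x_ @ \oo --> x -> Phi (x_ n) @[n --> \oo] --> Phi x) ->
  strongly_measurable D f -> strongly_measurable D (fun t => Phi (f t)).
Proof.
move=> cPhi sf; apply: (@sm_map2 E E E'' D (fun x _ => Phi x) f (fun=> 0)) => //.
  by move=> x_ _ x _ + _; apply: cPhi.
exact: sm_cst.
Qed.

Lemma smD (E : normedModType R) D (f g : R -> E) : strongly_measurable D f ->
  strongly_measurable D g -> strongly_measurable D (fun t => f t + g t).
Proof. by apply: (@sm_map2 E E E D +%R) => x_ y_ x y; exact: cvgD. Qed.

Lemma smZ (E : normedModType R) D (c : R -> R^o) (f : R -> E) : strongly_measurable D c ->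
  strongly_measurable D f -> strongly_measurable D (fun t => (c t : R) *: f t).
Proof. by apply: (@sm_map2 R^o E E D (fun a x => (a : R) *: x)) => x_ y_ x y; exact: cvgZ. Qed.

Lemma smN (E : normedModType R) D (f : R -> E) : strongly_measurable D f ->
  strongly_measurable D (fun t => - f t).
Proof. by apply: sm_map => x_ x; exact: cvgN. Qed.

Lemma sm_norm (E : normedModType R) D (f : R -> E) : strongly_measurable D f ->
  strongly_measurable D (fun t => `|f t| : R^o).
Proof. by apply: (@sm_map E R^o) => x_ x; exact: cvg_norm. Qed.

Lemma sm_inner (V : hilbertType R) D (f g : R -> V) : strongly_measurable D f ->
  strongly_measurable D g -> strongly_measurable D (fun t => inner (f t) (g t) : R^o).
Proof. by apply: (@sm_map2 V V R^o) => x_ y_ x y; exact: cvg_inner. Qed.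

Import HBSimple.

(** Compose the function with simple approximations of the identity of the
    real line. *)
Lemma sm_cont (E : normedModType R) D (f : R -> E) : continuous f ->
  strongly_measurable D f.
Proof.
move=> cf.
have [g gE] := @approximation_sfun _ _ R (fun t : R => t%:E) setT measurableT
  ((measurable_EFinP _ _).2 (@measurable_id _ _ setT)).
exists (fun k t => f (g k t)).
  move=> k; apply: (@simple_map2 R^o R^o E (fun x _ => f x) (g k) (g k));
    by split => // y; apply: measurable_sfunP.
apply/aeW => t _; apply: continuous_cvg; first exact: cf.
by have /fine_cvgP[_] := gE t I.
Qed.

Lemma sm_sub (E : normedModType R) D D' (f : R -> E) : D' `<=` D ->
  strongly_measurable D f -> strongly_measurable D' f.
Proof.
by move=> sub [s ss sf]; exists s => //; apply: aeS _ sf => t h /sub.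
Qed.

Lemma sm_ae (E : normedModType R) D (f g : R -> E) :
  {ae mu, forall t, D t -> f t = g t} ->
  strongly_measurable D g -> strongly_measurable D f.
Proof.
by move=> fg [s ss sf]; exists s => //; apply: aeS2 _ fg sf => t h1 h2 Dt; rewrite h1//; exact: h2.
Qed.

(** Test with the values of the approximating simple functions: there are
    countably many of them, so one null set serves all, and in the limit h is
    tested against itself. *)
Lemma pettis (V K : hilbertType R) (j : blin V K) D (h : R -> V) : injective j ->
  strongly_measurable D h ->
  (forall v, {ae mu, forall t, D t -> inner (j (h t)) (j v) = 0}) ->
  {ae mu, forall t, D t -> h t = 0}.
Proof.
move=> ji [s ss sh] hv.
have : {ae mu, forall t, forall k, D t -> inner (j (h t)) (j (s k t)) = 0}.
  apply: ae_foralln => k.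
  have [fs _] := ss k.
  have := ae_finite fs (fun y _ => hv y); apply: aeS => t ht Dt.
  by apply: ht => //; exists t.
apply: aeS2 _ sh => t st h0 Dt.
have c : inner (j (h t)) (j (s k t)) @[k --> \oo] --> inner (j (h t)) (j (h t)).
  apply: cvg_inner; first exact: cvg_cst.
  by apply: continuous_cvg; [exact: blin_continuous | exact: st].
have : inner (j (h t)) (j (h t)) = 0.
  rewrite -(cvg_lim _ c)//; under eq_fun do rewrite h0//.
  by rewrite lim_cst.
rewrite innerxx => /eqP; rewrite sqrf_eq0 normr_eq0 => /eqP e.
by apply: ji; rewrite e linear0.
Qed.

End StrongMeas.

(** * Square-integrable functions *)

Section L2class.
Context {R : realType}.
Notation mu := (@lebesgue_measure R).
Notation aem := (@lebesgue_measurable_fun R).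
Implicit Type D : set R.

(** Truncating the Borel representative of f by that of h makes the domination
    hold everywhere. *)
Lemma LI_dom D f h : aem D f -> {ae mu, forall t, D t -> `|f t| <= h t} ->
  LI D h -> LI D f.
Proof.
move=> [g mg fg] fh [k ik hk].
have mk : measurable_fun setT k.
  by apply/measurable_EFinP; exact: measurable_int ik.
exists (fun t => Num.max (- `|k t|) (Num.min (g t) `|k t|)).
  apply: (@le_integrable _ _ _ mu setT measurableT _ (EFin \o k)) => //.
    apply/measurable_EFinP; apply: measurable_maxr.
      by apply: measurable_funN; exact: measurableT_comp.
    by apply: measurable_minr => //; exact: measurableT_comp.
  move=> t _ /=; rewrite lee_fin ler_norml; apply/andP; split.
    by rewrite le_max lexx.
  by rewrite ge_max ge_min lexx orbT andbT; have := normr_ge0 (k t); lra.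
apply: aeS3 _ fg fh hk => t h1 h2 h3 Dt.
have := h2 Dt; rewrite h1// h3// => hg.
have := le_trans hg (ler_norm _); rewrite ler_norml => /andP[a b].
by rewrite (min_idPl _)// (max_idPr _).
Qed.

Lemma LI_aem D f : LI D f -> aem D f.
Proof.
move=> [g ig fg]; exists g => //.
by apply/measurable_EFinP; exact: measurable_int ig.
Qed.

Definition fin_meas D := measurable D /\ (mu D < +oo)%E.

Lemma fin_meas_itv (b1 b2 : bool) (a b : R) :
  fin_meas [set` Interval (BSide b1 a) (BSide b2 b)].
Proof.
split; first exact: measurable_itv.
by rewrite lebesgue_measure_itv /=; case: ifP => // _; rewrite ltry.
Qed.

Lemma LI_cst D c : fin_meas D -> LI D (fun=> c).
Proof.
move=> [mD fD]; suff : LI D (fun=> 1) by move=> /(LIZ c); under eq_fun do rewrite mulr1.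
exists (\1_D : R -> R); last by apply/aeW => t Dt; rewrite indicE mem_set.
apply/integrableP; split; first by apply/measurable_EFinP.
rewrite (_ : (fun x => _) = (fun x => (\1_D x)%:E)); last first.
  by apply/funext => t /=; rewrite ger0_norm.
by rewrite integral_indic//= setIT.
Qed.

Lemma LI_bdd D f c : fin_meas D -> aem D f ->
  {ae mu, forall t, D t -> `|f t| <= c} -> LI D f.
Proof. by move=> fD mf fc; apply: LI_dom mf fc _; exact: LI_cst. Qed.

Lemma aemM D f g : aem D f -> aem D g -> aem D (fun t => f t * g t).
Proof.
move=> [f' mf ff] [g' mg gg]; exists (fun t => f' t * g' t).
  exact: measurable_funM.
by apply: aeS2 _ ff gg => t h1 h2 Dt; rewrite h1// h2.
Qed.

Lemma aem_sub D D' f : D' `<=` D -> aem D f -> aem D' f.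
Proof. by move=> sub [g mg fg]; exists g => //; apply: aeS _ fg => t + /sub. Qed.

Lemma aem_cont D (f : R -> R) : continuous f -> aem D f.
Proof. by move=> cf; apply: (@sm_aem _ _ f); exact: (@sm_cont _ R^o). Qed.

Lemma LI_mul D c f K : aem D c -> {ae mu, forall t, D t -> `|c t| <= K} -> LI D f ->
  LI D (fun t => c t * f t).
Proof.
move=> mc cK lf; apply: (@LI_dom _ _ (fun t => K * `|f t|)).
- by apply: aemM => //; exact: LI_aem.
- by apply: aeS _ cK => t h Dt; rewrite normrM ler_wpM2r//; exact: h.
- by apply: LIZ; exact: LI_abs.
Qed.

Lemma LI_indic D D' f : measurable D' -> D' `<=` D -> LI D' f -> LI D (fun t => \1_D' t * f t).
Proof.
move=> mD' sub [g ig fg]; exists (fun t => \1_D' t * g t).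
  apply: (@le_integrable _ _ _ mu setT measurableT _ (EFin \o g)) => //.
    apply/measurable_EFinP; apply: measurable_funM => //.
    by apply/measurable_EFinP; exact: measurable_int ig.
  move=> t _ /=; rewrite lee_fin normrM indicE ler_piMl//.
  by case: (_ \in _); rewrite ?normr1 ?normr0.
apply: aeS _ fg => t h Dt; rewrite indicE.
by case: (boolP (t \in D')) => [/set_mem /h ->//|_]; rewrite !mul0r.
Qed.

Lemma bnd_on_itv (E : normedModType R) (a b : R) (f : R -> E) : continuous f ->
  exists2 K : R, 0 <= K & forall t, t \in `[a, b] -> `|f t| <= K.
Proof.
move=> cf; have [ab|ba] := leP a b; last first.
  exists 0 => // t; rewrite in_itv/= => /andP[h1 h2].
  by move: (le_trans h1 h2); rewrite leNgt ba.
have [c _ hc] := @EVT_max R (fun t => `|f t|) a b ab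
    (continuous_subspaceT (fun t => continuous_comp (cf t) (@norm_continuous _ _ _))).
by exists `|f c|.
Qed.

Lemma sm_norm_sqr (E : normedModType R) D (f : R -> E) : strongly_measurable D f ->
  aem D (fun t => `|f t| ^+ 2).
Proof. by move=> /sm_norm sf; under eq_fun do rewrite expr2; apply: aemM; exact: sm_aem sf. Qed.

Section norms.
Context {E : normedModType R}.
Implicit Types f g : R -> E.

Definition L2 D f := strongly_measurable D f /\ LI D (fun t => `|f t| ^+ 2).

Lemma in_L2P D f : measurable D -> in_L2 D f <-> L2 D f.
Proof.
move=> mD; split => -[sf lf]; split => //.
  have [g mg fg] := sm_norm_sqr sf.
  have lg : mu.-integrable D (EFin \o g).
    apply/integrableP; split.
      by apply/measurable_EFinP; exact: measurable_funTS.
    apply: le_lt_trans lf; apply: le_integral_ae => [t _|t _|]; rewrite ?lee_fin ?sqr_ge0//.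
    by apply: aeS _ fg => t h Dt /=; rewrite -h// lee_fin ger0_norm ?sqr_ge0.
  exists (fun t => \1_D t * g t).
    have := (@integrable_mkcond _ _ _ mu D (EFin \o g) mD).1 lg.
    apply: eq_integrable => // t _; rewrite /patch /= indicE.
    by case: ifP; rewrite ?mul1r ?mul0r.
  by apply: aeS _ fg => t h Dt; rewrite indicE mem_set// mul1r h.
have [g [mg ig fg _]] := LI_integrable mD lf.
have /integrableP[_] := ig; apply: le_lt_trans.
apply: le_integral_ae => [t _|t _|]; rewrite ?lee_fin ?sqr_ge0//.
by apply: aeS _ fg => t h Dt /=; rewrite -h// lee_fin ler_norm.
Qed.

Lemma L2D D f g : L2 D f -> L2 D g -> L2 D (fun t => f t + g t).
Proof.
move=> [sf lf] [sg lg]; split; first exact: smD.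
apply: (@LI_dom _ _ (fun t => 2 * `|f t| ^+ 2 + 2 * `|g t| ^+ 2)).
- exact: sm_norm_sqr (smD sf sg).
- apply/aeW => t _; rewrite ger0_norm ?sqr_ge0//.
  have := ler_normD (f t) (g t); have := sqr_ge0 (`|f t| - `|g t|).
  have := normr_ge0 (f t + g t); have := normr_ge0 (f t); have := normr_ge0 (g t); nra.
- by apply: LID; exact: LIZ.
Qed.

Lemma L2Z D (c : R -> R^o) f K : strongly_measurable D c ->
  {ae mu, forall t, D t -> `|c t| <= K} -> L2 D f -> L2 D (fun t => (c t : R) *: f t).
Proof.
move=> sc cK [sf lf]; split; first exact: smZ.
under eq_fun do rewrite normrZ exprMn.
apply: (@LI_mul _ _ _ (K ^+ 2)) lf.
  exact: sm_norm_sqr sc.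
apply: aeS _ cK => t h Dt; rewrite (@ger0_norm _ (`|c t| ^+ 2)) ?sqr_ge0//.
by have := h Dt; have := normr_ge0 (c t : R); nra.
Qed.

Lemma L2N D f : L2 D f -> L2 D (fun t => - f t).
Proof.
move=> [sf lf]; split; first exact: smN.
by under eq_fun do rewrite normrN.
Qed.

Lemma L2B D f g : L2 D f -> L2 D g -> L2 D (fun t => f t - g t).
Proof. by move=> lf /L2N; exact: L2D. Qed.

Lemma L2_sub D D' f : D' `<=` D -> L2 D f -> L2 D' f.
Proof. by move=> sub [sf lf]; split; [exact: sm_sub sf|exact: LI_sub lf]. Qed.

Lemma L2_ae D f g : {ae mu, forall t, D t -> f t = g t} -> L2 D g -> L2 D f.
Proof.
move=> fg [sg lg]; split; first exact: sm_ae sg.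
by apply: LI_ae lg; apply: aeS _ fg => t /[apply] ->.
Qed.

Lemma L2_bdd D f K : fin_meas D -> strongly_measurable D f ->
  {ae mu, forall t, D t -> `|f t| <= K} -> L2 D f.
Proof.
move=> fD sf fK; split => //.
apply: (@LI_bdd _ _ (K ^+ 2)) => //.
  exact: sm_norm_sqr sf.
apply: aeS _ fK => t h Dt; rewrite (@ger0_norm _ (`|f t| ^+ 2)) ?sqr_ge0//.
by have := h Dt; have := normr_ge0 (f t); nra.
Qed.

Lemma L2_cont (a b : R) f : continuous f -> L2 `]a, b[ f /\ L2 `]a, b] f.
Proof.
move=> cf.
have [K _ hK] := bnd_on_itv a b cf.
by split; (apply: (@L2_bdd _ _ K); [exact: fin_meas_itv|exact: sm_cont|
  apply: aeW => t /=; rewrite in_itv /= => /andP[h1 h2]; apply: hK; rewrite in_itv/= ?(ltW h1) ?(ltW h2) ?h2]).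
Qed.

Lemma LI_norm D f : fin_meas D -> L2 D f -> LI D (fun t => `|f t|).
Proof.
move=> fD [sf lf]; apply: (@LI_dom _ _ (fun t => 1 + `|f t| ^+ 2)).
- exact: (sm_aem (sm_norm sf)).
- by apply/aeW => t _; rewrite normr_id; have := sqr_ge0 (`|f t| - 1); nra.
- by apply: LID => //; exact: LI_cst.
Qed.

(** Cauchy-Schwarz from the nonnegativity of the integral of (l - |f|)^2,
    optimized over l. *)
Lemma rint_norm_sqr D f : fin_meas D -> L2 D f ->
  (\int[mu]_(t in D) `|f t|) ^+ 2 <= fine (mu D) * \int[mu]_(t in D) (`|f t| ^+ 2).
Proof.
move=> fD lf; have [mD _] := fD.
have l1 := LI_norm fD lf; have [_ l2] := lf.
set I := \int[mu]_(t in D) `|f t|; set S := \int[mu]_(t in D) _.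
have S0 : 0 <= S by apply: rint_ge0 => //; apply/aeW => t _; rewrite sqr_ge0.
have I0 : 0 <= I by apply: rint_ge0 => //; apply/aeW => t _.
have key l : 2 * l * I <= l ^+ 2 * fine (mu D) + S.
  rewrite -rintZ// (_ : l ^+ 2 * _ = \int[mu]_(t in D) (l ^+ 2)); last first.
    by rewrite Rintegral_cst.
  rewrite -rintD//; last exact: LI_cst.
  apply: rint_le => //; [exact: LIZ|by apply: LID => //; exact: LI_cst|].
  by apply/aeW => t _; have := sqr_ge0 (l - `|f t|); nra.
have m0 : 0 <= fine (mu D) by apply: fine_ge0.
set m := fine (mu D) in key m0 *.
have [m00|m1] := eqVneq m 0.
  have := key (S / 2 / I + I^-1); rewrite m00 mulr0 add0r mul0r => k.
  have [->|In0] := eqVneq I 0; first by rewrite expr2 mulr0.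
  have : 2 * (S / 2 / I + I^-1) * I = S + 2 by field.
  by move=> e; rewrite e in k; lra.
have mp : 0 < m by rewrite lt_neqAle eq_sym m1.
have := key (I / m); rewrite (_ : 2 * (I / m) * I = 2 * I ^+ 2 / m); last by field.
rewrite (_ : (I / m) ^+ 2 * m = I ^+ 2 / m); last by field.
move=> k; have {k} : I ^+ 2 / m <= S by lra.
by rewrite ler_pdivrMr// mulrC.
Qed.

End norms.

Lemma LI_inner (V : hilbertType R) D (f g : R -> V) : L2 D f -> L2 D g ->
  LI D (fun t => inner (f t) (g t)).
Proof.
move=> [sf lf] [sg lg]; apply: (@LI_dom _ _ (fun t => (`|f t| ^+ 2 + `|g t| ^+ 2) * 2^-1)).
- exact: (sm_aem (sm_inner sf sg)).
- by apply/aeW => t _; exact: inner_young.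
- by under eq_fun do rewrite mulrC; apply: LIZ; exact: LID.
Qed.

Lemma L2_cst (E : normedModType R) D (c : E) : fin_meas D -> L2 D (fun=> c).
Proof. by move=> fD; apply: (@L2_bdd _ _ _ `|c|) => //; [exact: sm_cst | apply/aeW]. Qed.

Lemma cvg_lip (E E' : normedModType R) (Phi : E -> E') (K : R) :
  (forall x y, `|Phi x - Phi y| <= K * `|x - y|) ->
  forall x_ x, x_ @ \oo --> x -> Phi (x_ n) @[n --> \oo] --> Phi x.
Proof.
move=> lip x_ x xl; apply/(@cvgrPdist_lt _ E') => e e0.
have K1 : 0 < `|K| + 1 by rewrite ltr_wpDl.
have /(@cvgrPdist_lt _ E)/(_ (e / (`|K| + 1))) := xl; rewrite divr_gt0// => /(_ isT).
apply: filterS => n; rewrite ltr_pdivlMr// mulrC; apply: le_lt_trans.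
apply: le_trans (lip _ _) _; rewrite ler_wpM2r//.
by apply: le_trans (ler_norm _) _; rewrite lerDl.
Qed.

Lemma L2_lip (E E' : normedModType R) (Phi : E -> E') (K : R) D f :
  (forall x y, `|Phi x - Phi y| <= K * `|x - y|) -> Phi 0 = 0 ->
  L2 D f -> L2 D (fun t => Phi (f t)).
Proof.
move=> lip P0 [smf If]; have smP := sm_map (cvg_lip lip) smf; split => //.
apply: (@LI_dom _ _ (fun t => K ^+ 2 * `|f t| ^+ 2)); [exact: sm_norm_sqr| |exact: LIZ].
apply: aeW => t _; rewrite ger0_norm ?sqr_ge0// -exprMn.
have := lip (f t) 0; rewrite P0 !subr0 => h.
have h0 := le_trans (normr_ge0 _) h.
by rewrite ler_sqr ?nnegrE.
Qed.

Lemma L2_blin (V W : normedModType R) (j : blin V W) D f : L2 D f -> L2 D (fun t => j (f t)).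
Proof.
apply: (@L2_lip _ _ _ (blin_norm j)) => [x y|]; last exact: linear0.
by rewrite -linearB ler_blin_norm.
Qed.

End L2class.

(** * The Riesz representation theorem *)

Section Riesz.
Context {R : realType} {V : hilbertType R}.

Lemma cauchy_seq (x_ : nat -> V) :
  (forall e : R, 0 < e -> exists N, forall n, (N <= n)%N -> `|x_ N - x_ n| < e) ->
  exists x : V, x_ @ \oo --> x.
Proof.
move=> h; suff : cvg (x_ @ \oo) by move=> c; exists (lim (x_ @ \oo)).
apply/cauchy_cvgP/cauchy_exP => e e0.
have [N hN] := h e e0; exists (x_ N).
by exists N => // n /= Nn; rewrite -ball_normE /=; exact: hN.
Qed.

(** The representative minimizes |x|^2 - 2 l(x). By the parallelogram identity
    a minimizing sequence is Cauchy, and the minimality of its limit along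
    every line gives l. *)
Lemma riesz_ex (l : V -> R) (c : R) : (forall a x y, l (a *: x + y) = a * l x + l y) ->
  (forall v, `|l v| <= c * `|v|) -> exists x, forall v, l v = inner x v.
Proof.
move=> lin lc.
have l0 : l 0 = 0 by apply/normr0_eq0/eqP; rewrite eq_le normr_ge0 andbT (le_trans (lc 0))// normr0 mulr0.
have lD x y : l (x + y) = l x + l y by rewrite -{1}[x]scale1r lin mul1r.
have lZ a x : l (a *: x) = a * l x by rewrite -[a *: x]addr0 lin l0 addr0.
have lN x : l (- x) = - l x by rewrite -scaleN1r lZ mulN1r.
pose E x : R := `|x| ^+ 2 - 2 * l x.
have Elb x : - c ^+ 2 <= E x.
  by rewrite /E; have := lc x; rewrite ler_norml => /andP[_]; have := sqr_ge0 (`|x| - c); nra.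
pose S := range E; pose m := inf S.
have hS : has_inf S by split; [exists (E 0), 0 | exists (- c ^+ 2) => _ [x _ <-]].
have mE x : m <= E x by apply: ge_inf; [exact: hS.2 | exists x].
have ex n : exists x, E x < m + n.+1%:R^-1.
  have [_ [x _ <-] h] := inf_adherent (ltac:(by rewrite invr_gt0) : 0 < (n.+1%:R^-1 : R)) hS.
  by exists x.
have [x_ hx] := choice ex.
have par x y : `|x - y| ^+ 2 <= 2 * (E x - m) + 2 * (E y - m).
  have := mE (2^-1 *: (x + y)); rewrite /E normrZ exprMn lZ lD normD_sqr normB_sqr.
  by rewrite ger0_norm ?invr_ge0//; lra.
have [x xl] : exists x : V, x_ @ \oo --> x.
  apply: cauchy_seq => e e0.
  have [N N1] : exists N : nat, (4 / e ^+ 2 < N.+1%:R :> R).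
    exists (Num.truncn (4 / e ^+ 2)); exact: truncnS_gt.
  exists N => n Nn; rewrite -ltr_sqr ?nnegrE ?normr_ge0 ?(ltW e0)//.
  apply: le_lt_trans (par _ _) _.
  have := hx N; have := hx n.
  have : n.+1%:R^-1 <= N.+1%:R^-1 :> R by rewrite lef_pV2 ?posrE// ler_nat.
  have : 4 * N.+1%:R^-1 < e ^+ 2.
    by rewrite ltr_pdivrMr// mulrC -ltr_pdivrMr// exprn_gt0.
  by move: (N.+1%:R^-1) (n.+1%:R^-1) => a b; lra.
have Ex : E x <= m.
  have c1 : E (x_ n) @[n --> \oo] --> E x.
    apply: (@cvgB _ R^o).
      under eq_fun do rewrite expr2; rewrite /= expr2.
      by apply: cvgM; exact: cvg_norm.
    apply: (@cvgMr R); apply/(@cvgrPdist_le _ R^o) => e e0.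
    have c0 : 0 < `|c| + 1 by have := normr_ge0 c; lra.
    have /(@cvgrPdist_le _ V) := xl => /(_ (e / (`|c| + 1))) h.
    near=> n; rewrite -lN -lD; apply: le_trans (lc _) _.
    have : `|x - x_ n| <= e / (`|c| + 1) by near: n; apply: h; exact: divr_gt0.
    rewrite ler_pdivlMr//; have := ler_norm c; have := normr_ge0 (x - x_ n); nra.
  have c2 : (m + n.+1%:R^-1 : R) @[n --> \oo] --> m + 0.
    by apply: (@cvgD _ R^o); [exact: cvg_cst|exact: cvg_harmonic].
  rewrite addr0 in c2; apply: ler_cvg_to c1 c2 _.
  by apply: nearW => n; exact: ltW.
exists x => v.
have [->|v0] := eqVneq v 0; first by rewrite l0 inner0r.
have nv : 0 < `|v| ^+ 2 by rewrite exprn_gt0 ?normr_gt0.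
pose d := inner x v - l v; apply/eqP; rewrite eq_sym -subr_eq0 -/d.
have := mE (x + (- d / `|v| ^+ 2) *: v).
rewrite /E normD_sqr lD lZ innerZr normrZ exprMn real_normK ?num_real//.
have -> : (- d / `|v| ^+ 2) ^+ 2 * `|v| ^+ 2 = d ^+ 2 / `|v| ^+ 2.
  by field; rewrite normr_eq0.
move=> h; have : d ^+ 2 / `|v| ^+ 2 <= 0.
  suff : d ^+ 2 / `|v| ^+ 2 = - (2 * (- d / `|v| ^+ 2 * inner x v)) + 2 * (- d / `|v| ^+ 2 * l v) - d ^+ 2 / `|v| ^+ 2.
    by move: Ex h; rewrite /E; lra.
  by rewrite /d; field; rewrite normr_eq0.
rewrite pmulr_lle0 ?invr_gt0// => d2.
by rewrite -sqrf_eq0 eq_le d2 sqr_ge0.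
Unshelve. all: end_near. Qed.

End Riesz.

(** * The dual of V *)

Section DualSpace.
Context {R : realType}.
Notation mu := (@lebesgue_measure R).

Context {V : hilbertType R}.

Lemma riesz_dual (f : V^dual) : exists x, forall v, inner x v = f v.
Proof.
have [|x hx] := @riesz_ex R V f `|f| _ (ler_blin_norm f); last by exists x.
by move=> a x y; rewrite linearP.
Qed.

(** All V'-valued functions are handled through their V-valued images under
    this isometry. *)
Definition riesz (f : V^dual) : V := projT1 (cid (riesz_dual f)).

Lemma rieszE f v : inner (riesz f) v = f v.
Proof. exact: (projT2 (cid (riesz_dual f))). Qed.

Lemma riesz_uniq (x y : V) : (forall v, inner x v = inner y v) -> x = y.
Proof.
move=> h; apply/eqP; rewrite -subr_eq0; apply/eqP; apply: inner_eq0 => v.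
by rewrite innerBl h subrr.
Qed.

Lemma rieszB f g : riesz (f - g) = riesz f - riesz g.
Proof. by apply: riesz_uniq => v; rewrite innerBl !rieszE. Qed.

Lemma riesz_norm f : `|riesz f| = `|f|.
Proof.
apply/eqP; rewrite eq_le; apply/andP; split.
  have [->|r0] := eqVneq (riesz f) 0; first by rewrite normr0.
  have r1 : 0 < `|riesz f| by rewrite normr_gt0.
  rewrite -(ler_pM2r r1) -expr2 -innerxx rieszE.
  by apply: le_trans (ler_norm _) (ler_blin_norm _ _).
by apply: blin_norm_le => // v; rewrite -rieszE; exact: inner_CS.
Qed.

Lemma L2_riesz D f : L2 D f -> L2 D (fun t => riesz (f t)).
Proof.
apply: (@L2_lip _ _ _ _ 1) => [x y|]; first by rewrite mul1r -rieszB riesz_norm.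
by apply/eqP; rewrite -normr_eq0 riesz_norm normr0.
Qed.

Lemma id_blin_subproof : (id : V -> V) \in @blin_pred R V V.
Proof. by apply/blin_predP; split => // x; exact: cvg_id. Qed.

Definition id_blin : blin V V := BLin id_blin_subproof.

Lemma id_blin_inj : injective id_blin.
Proof. by []. Qed.

Context {H : hilbertType R} (iota : blin V H).

(** The operator V -> V given by the H inner product; it is VtoV' after Riesz. *)
Definition mass (x : V) : V := riesz (VtoV' iota x).

Lemma massE x v : inner (mass x) v = inner (iota x) (iota v).
Proof. by rewrite rieszE. Qed.

Lemma massP (a : R) x y : mass (a *: x + y) = a *: mass x + mass y.
Proof. by apply: riesz_uniq => v; rewrite innerPl !massE linearP innerPl. Qed.

HB.instance Definition _ := GRing.isLinear.Build R V V *:%R mass massP.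

Lemma mass_le x : `|mass x| <= `|iota| ^+ 2 * `|x|.
Proof.
have [->|r0] := eqVneq (mass x) 0; first by rewrite normr0 mulr_ge0 ?sqr_ge0.
have r1 : 0 < `|mass x| by rewrite normr_gt0.
rewrite -(ler_pM2r r1) -expr2 -innerxx massE.
apply: le_trans (ler_norm _) _; apply: le_trans (inner_CS _ _) _.
have -> : `|iota| ^+ 2 * `|x| * `|mass x| = (`|iota| * `|x|) * (`|iota| * `|mass x|) by ring.
by apply: ler_pM => //; exact: ler_blin_norm.
Qed.

Lemma L2_mass D f : L2 D f -> L2 D (fun t => mass (f t)).
Proof.
apply: (@L2_lip _ _ _ _ (`|iota| ^+ 2)) => [x y|]; last exact: linear0.
by rewrite -linearB mass_le.
Qed.

Lemma mass_sym x v : inner (iota x) (iota v) = inner x (mass v).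
Proof. by rewrite [RHS]innerC massE innerC. Qed.

End DualSpace.

(** * Smooth functions of compact support *)

Section Smooth.
Context {R : realType}.
Implicit Types f g : R -> R.

(** n-fold differentiability, phrased so that products and affine
    substitutions are handled by induction without iterating the derivative
    operator. *)
Fixpoint Cn (n : nat) f : Prop :=
  if n is m.+1 then exists2 f', (forall x : R, is_derive x (1 : R) f (f' x)) & Cn m f'
  else True.

Lemma Cn_smooth f : (forall n, Cn n f) -> forall k t, derivable (derive1n k f) t 1.
Proof.
move=> h k; have {h} := h k.+1; elim: k f => [|k IH] f.
  by move=> [f' ff' _] t; rewrite derive1n0; exact: (@ex_derive _ _ _ _ _ _ _ (ff' t)).
move=> [f' ff' Cf']; rewrite /derive1n iterSr -/(derive1n k _).
have -> : f^`()%classic = f'.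
  by apply/funext => t; rewrite derive1E; exact: (@derive_val _ _ _ _ _ _ _ (ff' t)).
exact: IH.
Qed.

Lemma CnW n f : Cn n.+1 f -> Cn n f.
Proof.
elim: n f => // n IH f [f' ff' Cf']; exists f' => //; exact: IH.
Qed.

Lemma CnD n f g : Cn n f -> Cn n g -> Cn n (fun x => f x + g x).
Proof.
elim: n f g => // n IH f g [f' ff' Cf'] [g' gg' Cg'].
by exists (fun x => f' x + g' x) => [x|]; [exact: is_deriveD|exact: IH].
Qed.

Lemma is_derive1_eq (f g : R -> R) (x l l' : R) : is_derive x (1 : R) f l -> f =1 g ->
  l = l' -> is_derive x (1 : R) g l'.
Proof. by move=> h /funext <- <-. Qed.

Lemma CnM n f g : Cn n f -> Cn n g -> Cn n (fun x => f x * g x).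
Proof.
elim: n f g => // n IH f g Cf Cg.
have [f' ff' Cf'] := Cf; have [g' gg' Cg'] := Cg.
exists (fun x => f x * g' x + g x * f' x) => [x|].
  by apply: is_derive1_eq (is_deriveM (ff' x) (gg' x)) _ _ => //.
by apply: CnD; apply: IH => //; exact: CnW.
Qed.

Lemma Cn_cst n (c : R) : Cn n (fun=> c).
Proof.
elim: n c => // n IH c; exists (fun=> 0) => [x|]; [exact: is_derive_cst|exact: IH].
Qed.

Lemma Cn_affine n f (a b : R) : Cn n f -> Cn n (fun x => f (a * x + b)).
Proof.
elim: n f => // n IH f [f' ff' Cf'].
exists (fun x => f' (a * x + b) * a) => [x|].
  apply: (@is_derive1_comp _ f (fun x => a * x + b)).
  have d1 : is_derive x (1 : R) (a *: (id : R -> R)) (a *: (1 : R)) by apply: is_deriveZ.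
  apply: is_derive1_eq (is_deriveD d1 (is_derive_cst b x (1 : R))) _ _ => //.
  by rewrite addr0 /GRing.scale /= mulr1.
by apply: CnM; [exact: IH|exact: Cn_cst].
Qed.

Lemma is_derive_horner (P : {poly R}) (x : R) : is_derive x (1 : R) (horner P) P^`().[x].
Proof.
elim/poly_ind: P => [|P c IH].
  by rewrite deriv0 horner0; apply: is_derive1_eq (is_derive_cst (0 : R) x (1 : R)) _ _ => // y; rewrite horner0.
apply: is_derive1_eq (is_deriveD (is_deriveM IH (is_derive_id x (1 : R))) (is_derive_cst c x (1 : R))) _ _.
  by move=> y; rewrite !hornerE.
rewrite derivD derivM derivX derivC !hornerE /GRing.scale /=; ring.
Qed.

(** P(1/x) exp(-1/x), extended by 0. Unlike exp(-1/x) alone, this family is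
    stable under differentiation. *)
Definition flat (P : {poly R}) (x : R) : R := if 0 < x then P.[x^-1] * expR (- x^-1) else 0.

Lemma pow_expR_le (y : R) n : 0 < y -> y ^+ n * expR (- y) <= n`!%:R.
Proof.
move=> y0; rewrite expRN ler_pdivrMr ?expR_gt0//.
case: n => [|n].
  by rewrite expr0 mul1r; have := expR_ge1Dx y; lra.
have := expR_ge1Dxn n (ltW y0) => h.
rewrite -ler_pdivrMl ?ltr0n ?fact_gt0// mulrC.
by apply: le_trans h; rewrite lerDr.
Qed.

Lemma flat_le (P : {poly R}) : exists2 C, 0 <= C & forall x, `|flat P x| <= C * x ^+ 2.
Proof.
exists (\sum_(i < size P) `|P`_i| * (i + 2)`!%:R).
  by apply: sumr_ge0 => i _; rewrite mulr_ge0.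
move=> x; rewrite /flat; case: ifPn => x0; last first.
  by rewrite normr0 mulr_ge0 ?sqr_ge0// sumr_ge0// => i _; rewrite mulr_ge0.
rewrite horner_coef normrM mulr_suml (@ger0_norm _ (expR _)) ?expR_ge0//.
rewrite mulrC; apply: le_trans (ler_wpM2l (expR_ge0 _) (ler_norm_sum _ _ _)) _.
rewrite mulr_sumr; apply: ler_sum => i _.
have y0 : 0 < x^-1 by rewrite invr_gt0.
have := pow_expR_le (i + 2) y0; rewrite normrM (@ger0_norm _ (_ ^+ _)) ?exprn_ge0 ?(ltW y0)//.
set e := expR _; set a := `|_| => h.
have -> : e * (a * x^-1 ^+ i) = a * (x^-1 ^+ (i + 2) * e) * x ^+ 2.
  by rewrite exprD; field; rewrite gt_eqF.
by apply: ler_wpM2r; [exact: sqr_ge0|apply: ler_wpM2l; [exact: normr_ge0|exact: h]].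
Qed.

(** Away from 0 this is the chain rule; at 0 the quadratic bound of [flat_le]
    makes the difference quotient vanish. *)
Lemma flat_derive (P : {poly R}) (x : R) :
  is_derive x (1 : R) (flat P) (flat ((P - P^`()) * 'X^2) x).
Proof.
have near_eq (f g : R -> R) (l : R) : (\forall y \near x, f y = g y) ->
    is_derive x (1 : R) f l -> is_derive x (1 : R) g l.
  by move=> fg; apply: near_eq_is_derive.
have [x0|x0|->] := ltgtP x 0.
- have -> : flat ((P - P^`()) * 'X^2) x = 0 by rewrite /flat ltNge ltW.
  apply: near_eq (is_derive_cst (0 : R) x (1 : R)).
  by near=> y; rewrite /flat ltNge ltW//=; near: y; exact: lt_nbhsl.
- apply: (near_eq (fun y => P.[y^-1] * expR (- y^-1))).
    by near=> y; rewrite /flat ifT//; near: y; exact: lt_nbhsr.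
  rewrite /flat x0 hornerM hornerXn hornerD hornerN.
  have xn : x != 0 by rewrite gt_eqF.
  have d1 : is_derive x (1 : R) (fun y : R => y^-1) (- x ^- 2).
    have := @is_deriveV R id x 1 1 xn (is_derive_id _ _); rewrite /GRing.scale/= mulr1; exact.
  have d2 : is_derive x (1 : R) (fun y : R => P.[y^-1]) (P^`().[x^-1] * - x ^- 2).
    exact: (is_derive1_eq (is_derive1_comp (is_derive_horner P x^-1) d1)).
  have d3 : is_derive x (1 : R) (fun y : R => expR (- y^-1)) (expR (- x^-1) * x ^- 2).
    apply: (@is_derive1_comp _ expR (fun y => - y^-1)).
    by have := is_deriveN d1; rewrite opprK.
  apply: is_derive1_eq (is_deriveM d2 d3) _ _ => //; rewrite /GRing.scale /=.
  by rewrite exprVn; ring.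
have [C C0 hC] := flat_le P.
have f0 : flat P 0 = 0 by rewrite /flat ltxx.
rewrite [X in is_derive _ _ _ X](_ : _ = 0); last by rewrite /flat ltxx.
have c0 : h^-1 *: (flat P (h *: 1 + 0) - flat P 0) @[h --> 0^'] --> (0 : R).
  apply/(@cvgrPdist_le _ R^o) => e e0; near=> h.
  rewrite sub0r normrN f0 subr0 addr0 /GRing.scale /= mulr1 normrM normfV.
  have hn : h != 0 by near: h; exact: nbhs_dnbhs_neq.
  rewrite mulrC ler_pdivrMr ?normr_gt0//; apply: le_trans (hC h) _.
  rewrite -[h ^+ 2]real_normK ?num_real// expr2 mulrA ler_wpM2r//.
  have : `|h| <= e / (C + 1).
    near: h; apply: dnbhs0_le; rewrite divr_gt0//; lra.
  rewrite ler_pdivlMr; [|lra]; have := normr_ge0 h; nra.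
by split; [apply/cvg_ex; exists 0|exact: cvg_lim].
Unshelve. all: end_near. Qed.

Lemma Cn_flat n P : Cn n (flat P).
Proof.
elim: n P => // n IH P; exists (flat ((P - P^`()) * 'X^2)) => //; exact: flat_derive.
Qed.

(** Smooth functions with support [c, d] that increase to the indicator of ]c,
    d[. *)
Definition hump (c d : R) (n : nat) (x : R) : R :=
  flat 1 (n.+1%:R * x + - (n.+1%:R * c)) * flat 1 (- n.+1%:R * x + n.+1%:R * d).

Lemma humpE c d n x : hump c d n x =
  if c < x < d then expR (- (n.+1%:R * (x - c))^-1 - (n.+1%:R * (d - x))^-1) else 0.
Proof.
rewrite /hump /flat -mulrBr.
have -> : - n.+1%:R * x + n.+1%:R * d = n.+1%:R * (d - x) by rewrite mulrBr mulNr addrC.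
rewrite !pmulr_rgt0// !subr_gt0 !hornerE.
case: (c < x) => /=; last by rewrite mul0r.
case: (x < d) => /=; last by rewrite mulr0.
by rewrite -expRD.
Qed.

Lemma hump_test (T c d : R) n : 0 < c -> d < T -> test_fun T (hump c d n).
Proof.
move=> c0 dT; split.
  by apply: Cn_smooth => k; apply: CnM; exact: Cn_affine (Cn_flat _ _).
exists c, d; split => // t; rewrite in_itv/= => h; rewrite humpE.
by case: ifP => // /andP[a b]; rewrite (ltW a) (ltW b) in h.
Qed.

Lemma hump_bnd c d n x : 0 <= hump c d n x <= 1.
Proof.
rewrite humpE; case: ifP => [/andP[a b]|]; last by rewrite lexx ler01.
rewrite expR_ge0 /= -[leRHS]expR0 ler_expR.
have := ltr0Sn R n; set m := n.+1%:R => m0.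
have : 0 <= (m * (x - c))^-1 by rewrite invr_ge0 mulr_ge0 ?ltW// subr_gt0.
have : 0 <= (m * (d - x))^-1 by rewrite invr_ge0 mulr_ge0 ?ltW// subr_gt0.
by move: (_^-1) (_^-1) => u v; lra.
Qed.

Lemma hump_cvg c d x : hump c d n x @[n --> \oo] --> (\1_`]c, d[ x : R).
Proof.
under eq_fun do rewrite humpE; rewrite indicE.
have -> : (x \in `]c, d[%classic) = (c < x < d) by rewrite mem_setE in_itv.
case: (boolP (c < x < d)) => [/andP[a b]|_]; last exact: cvg_cst.
have -> : (true%:R : R) = expR 0 by rewrite expR0.
apply: continuous_cvg; first exact: continuous_expR.
have e : (- 0 * (x - c)^-1 - 0 * (d - x)^-1 : R) = 0 by rewrite !(mul0r,oppr0) addr0.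
rewrite -e.
under eq_fun do rewrite !invfM -!mulNr.
rewrite -mulNr; apply: (@cvgD _ R^o); apply: cvgMl;
  by apply: (@cvgN _ R^o); exact: cvg_harmonic.
Qed.

End Smooth.

(** * The fundamental lemma of the calculus of variations *)

Section FundLemma.
Context {R : realType}.
Notation mu := (@lebesgue_measure R).

Lemma test_cont (T : R) (phi : R -> R) : test_fun T phi -> forall k, continuous (derive1n k phi).
Proof.
move=> [h _] k t; apply: differentiable_continuous; apply/derivable1_diffP; exact: h.
Qed.

(** Dominated convergence along the humps shows that f has integral 0 over
    every interval inside ]0, T[. Its primitive is then constant there, and
    differentiates to f almost everywhere. *)
Lemma fund_lemma (T : R) (f : R -> R) : LI `]0, T[ f ->
  (forall phi, test_fun T phi -> \int[mu]_(t in `]0, T[) (phi t * f t) = 0) ->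
  {ae mu, forall t, t \in `]0, T[ -> f t = 0}.
Proof.
move=> [g0 ig fg0] h.
pose g t := \1_`]0, T[ t * g0 t.
have mg0 : measurable_fun setT g0 by apply/measurable_EFinP; exact: measurable_int ig.
have ig' : mu.-integrable setT (EFin \o g).
  have i0 : mu.-integrable `]0, T[ (EFin \o g0) by apply: integrableS ig.
  have := (@integrable_mkcond _ _ _ mu `]0, T[%classic (EFin \o g0)
    (measurable_itv _)).1 i0.
  by apply: eq_integrable => // t _; rewrite /patch /g /= indicE; case: ifP; rewrite ?mul1r ?mul0r.
have mg : measurable_fun setT g by apply/measurable_EFinP; exact: measurable_int ig'.
have fg : {ae mu, forall t, `]0, T[%classic t -> f t = g t}.
  by apply: aeS _ fg0 => t H Dt; rewrite /g indicE mem_set// mul1r H.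
have I0 c d : 0 < c -> d < T -> \int[mu]_(t in `]c, d[) g t = 0.
  move=> c0 dT.
  have [] := @dominated_convergence _ _ _ mu setT measurableT
    (fun n t => (hump c d n t * g t)%:E) (fun t => (\1_`]c, d[ t * g t)%:E)
    (fun t => `|g t|%:E).
  - move=> n; apply/measurable_EFinP; apply: measurable_funM => //.
    apply: continuous_measurable_fun => t.
    exact: (@test_cont _ _ (@hump_test _ T c d n c0 dT) 0%N).
  - by apply/measurable_EFinP; apply: measurable_funM.
  - apply/aeW => t _; apply: cvg_EFin; first by apply: nearW.
    by apply: cvgMl; exact: hump_cvg.
  - exact: (integrable_norm ig').
  - apply/aeW => t n _; rewrite /= lee_fin normrM ler_piMl//.
    by have /andP[a b] := hump_bnd c d n t; rewrite ger0_norm.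
  move=> _ _ cv.
  have e0 n : (\int[mu]_t (hump c d n t * g t)%:E = 0)%E.
    have := h _ (@hump_test _ T c d n c0 dT).
    have in1 : mu.-integrable setT (fun t => (hump c d n t * g t)%:E).
      apply: (@le_integrable _ _ _ mu setT measurableT _ (EFin \o g)) => //.
        apply/measurable_EFinP; apply: measurable_funM => //.
        apply: continuous_measurable_fun => t.
        exact: (@test_cont _ _ (@hump_test _ T c d n c0 dT) 0%N).
      move=> t _; rewrite /= lee_fin normrM ler_piMl//.
      by have /andP[a b] := hump_bnd c d n t; rewrite ger0_norm.
    rewrite (@rint_ae _ _ _ (fun t => hump c d n t * g t)); last first.
      by apply: aeS _ fg => t H Dt; rewrite H.
    rewrite Rintegral_mkcond /Rintegral.
    rewrite (_ : (fun x => _) = (fun t => (hump c d n t * g t)%:E)); last first.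
      apply/funext => t; rewrite /patch; case: ifPn => //.
      by rewrite /g indicE => /negbTE ->; rewrite mul0r mulr0.
    by move=> H; rewrite -[LHS]fineK ?H//; exact: integrable_fin_num in1.
  have : [sequence (\int[mu]_x (hump c d n x * g x)%:E)%E]_n = (fun=> 0%E).
    by apply/funext => n /=; exact: e0.
  move=> H; rewrite H in cv.
  have := cvg_unique _ cv (@cvg_cst _ _ _ _ _) => H2.
  rewrite Rintegral_mkcond /Rintegral (_ : (fun x => _) = (fun x => (\1_`]c, d[ x * g x)%:E)).
    by rewrite H2.
  by apply/funext => t; rewrite /patch indicE; case: ifP; rewrite ?mul1r ?mul0r.
have lg : locally_integrable setT g.
  split => //; [exact: openT|move=> K _ cK].
  have /integrableP[_] : mu.-integrable K (EFin \o g).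
    by apply: integrableS ig' => //; exact: compact_measurable.
  by [].
have iS (i : interval R) : mu.-integrable [set` i] (EFin \o g) :=
  @integrableS _ _ _ mu _ _ _ measurableT (measurable_itv i) (fun _ _ => I) ig'.
have F1 := @FTC1Ny R g (fun y => iS _) lg.
apply: aeS2 _ fg F1 => x fgx [_ Fx] xT; rewrite fgx// -Fx.
have /andP[x0 xlT] : 0 < x < T by move: xT; rewrite in_itv.
rewrite derive1E; rewrite (@near_eq_derive _ _ _ _ (fun=> \int[mu]_(t in `]-oo, x]) g t)).
  exact: derive_cst.
have Fc y z : 0 < y -> y <= z -> z < T ->
    \int[mu]_(t in `]-oo, z]) g t = \int[mu]_(t in `]-oo, y]) g t.
  move=> y0 yz zT; apply/eqP; rewrite -subr_eq0 Rintegral_itvB ?bnd_simp//.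
  have [->|ne] := eqVneq y z.
    by rewrite set_itvoc0 /Rintegral integral_set0.
  rewrite -Rintegral_itv_bndo_bndc//.
  by rewrite I0.
near=> y; have y0 : 0 < y by near: y; exact: lt_nbhsr.
have yT : y < T by near: y; exact: lt_nbhsl.
by have [yx|/ltW xy] := leP y x; [rewrite (Fc y x)|rewrite (Fc x y)].
Unshelve. all: end_near. Qed.

End FundLemma.

(** * Calculus on intervals *)

Section IntervalCalculus.
Context {R : realType}.
Notation mu := (@lebesgue_measure R).
Implicit Types f g : R -> R.

Lemma sub_oc (a b s t : R) : a <= s -> t <= b -> `]s, t] `<=` `]a, b]%classic.
Proof.
move=> as_ tb r /=; rewrite !in_itv/= => /andP[sr rt].
by rewrite (le_lt_trans as_ sr) (le_trans rt tb).
Qed.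

Lemma rint_split (a b c : R) f : a <= b -> b <= c -> LI `]a, c] f ->
  \int[mu]_(t in `]a, c]) f t = \int[mu]_(t in `]a, b]) f t + \int[mu]_(t in `]b, c]) f t.
Proof.
move=> ab bc lf; have [g [_ ig fg ->]] := LI_integrable (measurable_itv _) lf.
have sub1 : `]a, b] `<=` `]a, c]%classic by apply: subset_itvl; rewrite bnd_simp.
have sub2 : `]b, c] `<=` `]a, c]%classic by apply: subset_itvr; rewrite bnd_simp.
rewrite (@rint_ae _ `]a, b] f g); last by apply: aeS _ fg => t h /sub1.
rewrite (@rint_ae _ `]b, c] f g); last by apply: aeS _ fg => t h /sub2.
by rewrite -(@Rintegral_itvB _ g (BRight a) (BRight c) b ig) ?bnd_simp// addrC subrK.
Qed.

Lemma rint_subset (a b s t : R) f : a <= s -> s <= t -> t <= b -> (forall r, 0 <= f r) ->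
  LI `]a, b] f -> \int[mu]_(r in `]s, t]) f r <= \int[mu]_(r in `]a, b]) f r.
Proof.
move=> as_ st tb f0 lf; have at_ := le_trans as_ st.
have I0 x y : 0 <= \int[mu]_(r in `]x, y]) f r.
  by apply: rint_ge0 => //; apply: aeW.
have lf' : LI `]a, t] f by apply: LI_sub lf; exact: sub_oc.
rewrite (rint_split at_ tb lf) (rint_split as_ st lf').
by rewrite -addrA addrC -addrA lerDl addr_ge0.
Qed.

Lemma ae_neq (a : R) : {ae mu, forall t, t <> a}.
Proof.
exists [set a]; split => //; first by rewrite lebesgue_measure_set1.
by move=> t /= /contrapT.
Qed.

Lemma rint_oo_oc (a b : R) f :
  \int[mu]_(t in `]a, b[) f t = \int[mu]_(t in `]a, b]) f t.
Proof.
rewrite Rintegral_mkcond [in RHS]Rintegral_mkcond.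
apply: rint_ae; apply: aeS _ (ae_neq b) => t tb _; rewrite /patch.
rewrite !mem_setE !in_itv /= [t < b]lt_neqAle.
by have -> : (t != b) by apply/eqP.
Qed.

Lemma ae_oo_oc (a b : R) (P : R -> Prop) :
  {ae mu, forall t, `]a, b[%classic t -> P t} -> {ae mu, forall t, `]a, b]%classic t -> P t}.
Proof.
apply: aeS2 _ (ae_neq b) => t tb h /=; rewrite in_itv/= => /andP[at_ tlb].
by apply: h; rewrite /= in_itv/= at_ lt_neqAle tlb andbT; apply/eqP.
Qed.

Lemma LI_oo_oc (a b : R) f : LI `]a, b[ f -> LI `]a, b] f.
Proof. by move=> [g ig fg]; exists g => //; exact: ae_oo_oc. Qed.

Lemma L2_oo_oc (E : normedModType R) (a b : R) (f : R -> E) : L2 `]a, b[ f -> L2 `]a, b] f.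
Proof.
move=> [[s ss sf] lf]; split; last exact: LI_oo_oc.
by exists s => //; exact: (@ae_oo_oc _ _ (fun t => s k t @[k --> \oo] --> f t)).
Qed.

Lemma FTC_C1 (a b : R) (f f' : R -> R) : a <= b ->
  (forall x, is_derive x (1 : R) f (f' x)) -> continuous f' ->
  \int[mu]_(t in `]a, b]) f' t = f b - f a.
Proof.
rewrite le_eqVlt => /predU1P[->|ab] df cf'.
  by rewrite set_itvoc0 /Rintegral integral_set0 subrr.
have cf : continuous f.
  move=> x; apply: differentiable_continuous; apply/derivable1_diffP.
  exact: (@ex_derive _ _ _ _ _ _ _ (df x)).
have ii : mu.-integrable `[a, b] (EFin \o f').
  apply: continuous_compact_integrable; first exact: segment_compact.
  exact: continuous_subspaceT.
rewrite Rintegral_itv_obnd_cbnd; last first.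
  apply: (@integrableS _ _ _ mu _ _ _ _ _ _ ii) => //.
  by apply: subset_itvr; rewrite bnd_simp.
have := @continuous_FTC2 R f' f a b ab (continuous_subspaceT cf').
rewrite /Rintegral => -> //.
- split.
  + by move=> x _; exact: (@ex_derive _ _ _ _ _ _ _ (df x)).
  + by apply: cvg_at_right_filter; exact: cf.
  + by apply: cvg_at_left_filter; exact: cf.
- by move=> x _; rewrite derive1E; exact: (@derive_val _ _ _ _ _ _ _ (df x)).
Qed.

(** An additive function of intervals that is small to second order vanishes:
    cutting [a, b] into 2^n equal pieces divides the bound by 2^n. *)
Lemma additive_small (E m : R -> R -> R) (a b C : R) : 0 <= C ->
  (forall s r t, a <= s -> s <= r -> r <= t -> t <= b -> E s t = E s r + E r t) ->
  (forall s r t, a <= s -> s <= r -> r <= t -> t <= b -> m s t = m s r + m r t) ->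
  (forall s t, a <= s -> s <= t -> t <= b -> `|E s t| <= C * (t - s) * m s t) ->
  a <= b -> E a b = 0.
Proof.
move=> C0 addE addm Em ab.
have key n : forall s t, a <= s -> s <= t -> t <= b ->
    `|E s t| <= C * (t - s) * m s t / 2 ^+ n.
  elim: n => [|n IH] s t as_ st tb; first by rewrite expr0 divr1; exact: Em.
  pose r := (s + t) / 2.
  have sr : s <= r by rewrite /r; lra.
  have rt : r <= t by rewrite /r; lra.
  rewrite (addE s r t)// (addm s r t)//; apply: le_trans (ler_normD _ _) _.
  have h1 := IH s r as_ sr (le_trans rt tb).
  have h2 := IH r t (le_trans as_ sr) rt tb.
  apply: le_trans (lerD h1 h2) _; rewrite exprS.
  have -> : r - s = (t - s) / 2 by rewrite /r; field.
  have -> : t - r = (t - s) / 2 by rewrite /r; field.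
  by rewrite le_eqVlt; apply/orP; left; apply/eqP; field; rewrite expf_neq0.
apply/normr0_eq0/eqP; rewrite eq_le normr_ge0 andbT.
have c : (C * (b - a) * m a b / 2 ^+ n : R) @[n --> \oo] --> C * (b - a) * m a b * 0.
  apply: cvgMr; under eq_fun do rewrite -exprVn; apply: cvg_expr.
  by rewrite ger0_norm ?invf_lt1// ?ltr1n.
rewrite mulr0 in c; apply: ler_cvg_to (@cvg_cst _ _ _ _ _) c _.
by apply: nearW => n; exact: key.
Qed.

Lemma LI_cont (a b : R) f : continuous f -> LI `]a, b] f.
Proof.
move=> cf; have [K _ hK] := @bnd_on_itv R R^o a b f cf.
apply: (@LI_bdd _ _ _ K); [exact: fin_meas_itv|exact: aem_cont|].
apply: aeW => t /=; rewrite in_itv /= => /andP[h1 h2]; apply: hK.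
by rewrite in_itv/= (ltW h1) h2.
Qed.

Lemma LI_mulcont (a b : R) (c f : R -> R) : continuous c -> LI `]a, b] f ->
  LI `]a, b] (fun t => c t * f t).
Proof.
move=> cc; have [K _ hK] := @bnd_on_itv R R^o a b c cc.
apply: (@LI_mul _ _ _ _ K); first exact: aem_cont.
apply: aeW => t /=; rewrite in_itv /= => /andP[h1 h2]; apply: hK.
by rewrite in_itv/= (ltW h1) h2.
Qed.

Lemma rint_cst (a b c : R) : a <= b -> \int[mu]_(t in `]a, b]) c = c * (b - a).
Proof.
move=> ab; rewrite Rintegral_cst//= lebesgue_measure_itv/= lte_fin.
move: ab; rewrite le_eqVlt => /predU1P[->|ab]; first by rewrite ltxx subrr.
by rewrite ab.
Qed.

Lemma rint_norm_sqr_itv (E : normedModType R) (a b : R) (f : R -> E) : a <= b -> L2 `]a, b] f ->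
  (\int[mu]_(s in `]a, b]) `|f s|) ^+ 2 <= (b - a) * \int[mu]_(s in `]a, b]) (`|f s| ^+ 2).
Proof.
move=> ab lf; apply: le_trans (rint_norm_sqr (fin_meas_itv _ _ _ _) lf) _.
rewrite lebesgue_measure_itv/= lte_fin.
move: ab; rewrite le_eqVlt => /predU1P[->|ab]; first by rewrite ltxx subrr !mul0r.
by rewrite ab -EFinB.
Qed.

(** G is absolutely continuous with derivative g, in integrated form. *)
Definition primitive_on (a b : R) (G g : R -> R) :=
  forall s t, a <= s -> s <= t -> t <= b -> G t - G s = \int[mu]_(r in `]s, t]) g r.

(** The defect in the formula is additive in the interval and, as both phi and
    G vary little on a short one, at most 2 K (t - s) times the integral of
    |g|; so [additive_small] applies. *)
Lemma ibp (a b : R) (G g phi phi' : R -> R) : a <= b -> LI `]a, b] g ->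
  continuous G -> primitive_on a b G g ->
  (forall x, is_derive x (1 : R) phi (phi' x)) -> continuous phi' ->
  \int[mu]_(t in `]a, b]) (phi t * g t) =
  phi b * G b - phi a * G a - \int[mu]_(t in `]a, b]) (phi' t * G t).
Proof.
move=> ab lg cG pG dphi cphi'.
have cphi : continuous phi.
  move=> x; apply: differentiable_continuous; apply/derivable1_diffP.
  exact: (@ex_derive _ _ _ _ _ _ _ (dphi x)).
have [K K0 hK] := @bnd_on_itv R R^o a b phi' cphi'.
pose E s t := \int[mu]_(r in `]s, t]) (phi r * g r) - (phi t * G t - phi s * G s -
  \int[mu]_(r in `]s, t]) (phi' r * G r)).
pose m s t := \int[mu]_(r in `]s, t]) `|g r|.
have sub s t : a <= s -> t <= b -> `]s, t] `<=` `]a, b]%classic.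
  exact: sub_oc.
have lg' s t : a <= s -> t <= b -> LI `]s, t] g.
  by move=> as_ tb; apply: LI_sub lg; exact: sub.
have cphiG : continuous (fun r => phi' r * G r).
  by move=> x; apply: cvgM; [exact: cphi'|exact: cG].
suff : E a b = 0 by rewrite /E => /eqP; rewrite subr_eq0 => /eqP.
apply: (@additive_small E m a b (2 * K)) => //; first by rewrite mulr_ge0.
- move=> s r t as_ sr rt tb; rewrite /E (@rint_split s r t)//; last first.
    by apply: LI_mulcont => //; exact: lg'.
  by rewrite (@rint_split s r t (fun r => phi' r * G r))//; [ring|exact: LI_cont].
- move=> s r t as_ sr rt tb; apply: rint_split => //.
  by apply: LI_abs; exact: lg'.
move=> s t as_ st tb.
have mst : measurable `]s, t]%classic by exact: measurable_itv.
have e1 : phi t * G t - phi s * G s = phi t * (G t - G s) + G s * (phi t - phi s) by ring.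
have e2 : phi t - phi s = \int[mu]_(r in `]s, t]) phi' r by rewrite (FTC_C1 st dphi).
have lgst := lg' s t as_ tb.
have -> : E s t = \int[mu]_(r in `]s, t]) ((phi r - phi t) * g r + phi' r * (G r - G s)).
  rewrite /E e1 (pG s t)// e2.
  transitivity (\int[mu]_(r in `]s, t])
      ((phi r * g r - phi t * g r) + (phi' r * G r - G s * phi' r))); last first.
    by apply: eq_Rintegral => r _; ring.
  rewrite rintD// ?rintB// ?rintZ//; first by ring.
  all: repeat first [exact: lgst | exact: cphi | exact: LI_cont | apply: LIZ | apply: LIB | apply: LI_mulcont].
apply: le_trans (rint_abs mst _) _.
  apply: LID.
    apply: LI_mulcont => // x; apply: (@cvgB _ R^o); [exact: cphi|exact: cvg_cst].
  apply: LI_cont => x; apply: cvgM; first exact: cphi'.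
  by apply: (@cvgB _ R^o); [exact: cG|exact: cvg_cst].
have m0 : 0 <= m s t by apply: rint_ge0 => //; apply: aeW => r _.
have -> : 2 * K * (t - s) * m s t = \int[mu]_(r in `]s, t]) (K * (t - s) * `|g r| + K * m s t).
  rewrite rintD ?rintZ ?rint_cst//; first by rewrite -/(m s t); ring.
  all: repeat first [exact: LI_abs | exact: (LI_cst _ (fin_meas_itv _ _ _ _)) | apply: LIZ].
apply: rint_le => //.
- apply: LI_abs; apply: LID.
    apply: LI_mulcont => // x; apply: (@cvgB _ R^o); [exact: cphi|exact: cvg_cst].
  apply: LI_cont => x; apply: cvgM; first exact: cphi'.
  by apply: (@cvgB _ R^o); [exact: cG|exact: cvg_cst].
- by apply: LID; [apply: LIZ; exact: LI_abs|exact: (LI_cst _ (fin_meas_itv _ _ _ _))].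
apply: aeW => r /=; rewrite in_itv/= => /andP[sr rt].
have hK' x : s < x -> x <= t -> `|phi' x| <= K.
  by move=> sx xt; apply: hK; rewrite in_itv/= (le_trans as_ (ltW sx)) (le_trans xt tb).
apply: le_trans (ler_normD _ _) _; rewrite !normrM; apply: lerD.
  apply: ler_wpM2r => //.
  rewrite distrC -(FTC_C1 rt dphi cphi').
  apply: le_trans (rint_abs (measurable_itv _) (LI_cont _ _ cphi')) _.
  apply: le_trans (_ : _ <= \int[mu]_(x in `]r, t]) K) _.
    apply: rint_le => //; [by apply: LI_abs; exact: LI_cont|exact: (LI_cst _ (fin_meas_itv _ _ _ _))|].
    by apply: aeW => x /=; rewrite in_itv/= => /andP[rx xt]; apply: hK' => //; exact: lt_trans rx.
  by rewrite rint_cst// ler_wpM2l// lerD2l lerN2 ltW.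
apply: ler_pM => //; first exact: hK'.
rewrite (pG s r)// ?(ltW sr)//; last exact: le_trans rt tb.
have lgr : LI `]s, r] g by apply: lg' => //; exact: le_trans rt tb.
apply: le_trans (rint_abs (measurable_itv _) lgr) _.
rewrite /m (@rint_split s r t)// ?(ltW sr)//; last exact: LI_abs.
by rewrite lerDl; apply: rint_ge0 => //; apply: aeW.
Qed.

End IntervalCalculus.

(** * Primitives of vector-valued functions *)

Section Primitive.
Context {R : realType} {V : hilbertType R}.
Notation mu := (@lebesgue_measure R).
Implicit Types (D : set R) (f g : R -> V).

(** The Bochner integral, obtained as the Riesz representative of the scalar
    integrals. *)
Definition vint D f : V := xget 0 [set x | forall v, inner x v = \int[mu]_(t in D) inner (f t) v].

Lemma L2_inner D f v : fin_meas D -> L2 D f -> LI D (fun t => inner (f t) v).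
Proof. by move=> fD lf; apply: LI_inner => //; exact: L2_cst. Qed.

Lemma vintE D f : fin_meas D -> L2 D f ->
  forall v, inner (vint D f) v = \int[mu]_(t in D) inner (f t) v.
Proof.
move=> fD lf; have [mD _] := fD; suff [x hx] : exists x, forall v, inner x v = \int[mu]_(t in D) inner (f t) v.
  exact: (@xgetPex _ 0 [set x | forall v, inner x v = \int[mu]_(t in D) inner (f t) v] (ex_intro _ x hx)).
have [|v|x hx] := @riesz_ex R V (fun v => \int[mu]_(t in D) inner (f t) v)
    (\int[mu]_(t in D) `|f t|).
- move=> a x y; under eq_Rintegral do rewrite innerDr innerZr.
  by rewrite rintD ?rintZ//; try apply: LIZ; exact: L2_inner.
- apply: le_trans (rint_abs mD (L2_inner v fD lf)) _.
  rewrite mulrC -rintZ//; last exact: LI_norm.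
  apply: rint_le => //; [exact/LI_abs/L2_inner|by apply: LIZ; exact: LI_norm|].
  by apply: aeW => t _; rewrite mulrC; exact: inner_CS.
- by exists x => v; rewrite -hx.
Qed.

Lemma vint_norm D f : fin_meas D -> L2 D f -> `|vint D f| <= \int[mu]_(t in D) `|f t|.
Proof.
move=> fD lf; have [mD _] := fD; set x := vint D f.
have [->|x0] := eqVneq x 0.
  by rewrite normr0; apply: rint_ge0 => //; apply: aeW.
have nx : 0 < `|x| by rewrite normr_gt0.
rewrite -(ler_pM2r nx) -expr2 -innerxx vintE// mulrC -rintZ//; last exact: LI_norm.
apply: rint_le => //; [exact: L2_inner|by apply: LIZ; exact: LI_norm|].
apply: aeW => t _; apply: le_trans (ler_norm _) _; rewrite mulrC; exact: inner_CS.
Qed.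

Lemma vint_norm_sqr (a b : R) f : a <= b -> L2 `]a, b] f ->
  `|vint `]a, b] f| ^+ 2 <= (b - a) * \int[mu]_(t in `]a, b]) (`|f t| ^+ 2).
Proof.
move=> ab lf; have fD := fin_meas_itv false false a b.
apply: le_trans (_ : (\int[mu]_(t in `]a, b]) `|f t|) ^+ 2 <= _).
  rewrite ler_sqr ?nnegrE//; first exact: vint_norm.
  by apply: rint_ge0 => //; apply: aeW.
exact: rint_norm_sqr_itv.
Qed.

Variable T : R.
Hypothesis T0 : 0 < T.

(** Extending functions on [0, T] by constants makes their continuity plain
    continuity on the line. *)
Definition clamp (t : R) := Num.min (Num.max t 0) T.

Lemma clampE t : 0 <= t -> t <= T -> clamp t = t.
Proof. by move=> t0 tT; rewrite /clamp (max_idPl _)// (min_idPl _). Qed.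

Lemma clamp_itv t : 0 <= clamp t <= T.
Proof. by rewrite /clamp le_min (ltW T0) le_max lexx orbT ge_min lexx orbT. Qed.

Lemma clamp_lip s t : `|clamp s - clamp t| <= `|s - t|.
Proof.
wlog st : s t / s <= t.
  by move=> H; have [/H//|/ltW /H] := leP s t; rewrite distrC (distrC s).
have mx : 0 <= Num.max t 0 - Num.max s 0 <= t - s.
  by rewrite /Num.max; case: ltrP => h1; case: ltrP => h2; apply/andP; split; lra.
have mn x y : x <= y -> 0 <= Num.min y T - Num.min x T <= y - x.
  by rewrite /Num.min; case: ltrP => h1; case: ltrP => h2 h3; apply/andP; split; lra.
have /andP[m0 m1] := mx; rewrite subr_ge0 in m0.
have /andP[c0 c1] := mn _ _ m0.
rewrite distrC ger0_norm // distrC ger0_norm ?subr_ge0//.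
exact: le_trans c1 m1.
Qed.

Definition prim f (t : R) : V := vint `]0, clamp t] f.

Lemma prim_clamp f t : prim f (clamp t) = prim f t.
Proof.
by rewrite /prim; have /andP[a b] := clamp_itv t; have -> := clampE a b.
Qed.

Lemma primB f s t : L2 `]0, T] f -> 0 <= s -> s <= t -> t <= T ->
  prim f t - prim f s = vint `]s, t] f.
Proof.
move=> lf s0 st tT.
have sub a b : 0 <= a -> b <= T -> `]a, b] `<=` `]0, T]%classic.
  exact: sub_oc.
have fD a b := fin_meas_itv false false a b.
have lf' a b : 0 <= a -> b <= T -> L2 `]a, b] f by move=> a0 bT; apply: L2_sub lf; exact: sub.
have t0 := le_trans s0 st; have sT := le_trans st tT.
apply/eqP; rewrite -subr_eq0; apply/eqP; apply: inner_eq0 => v.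
rewrite /prim !clampE// !innerBl !vintE//; try exact: lf'.
rewrite (@rint_split _ 0 s t)//; first by ring.
by apply: L2_inner => //; exact: lf'.
Qed.

Lemma prim_holder f s t : L2 `]0, T] f ->
  `|prim f t - prim f s| ^+ 2 <= `|t - s| * \int[mu]_(r in `]0, T]) (`|f r| ^+ 2).
Proof.
move=> lf.
wlog st : s t / clamp s <= clamp t.
  move=> H; have [/H//|/ltW /H] := leP (clamp s) (clamp t).
  by rewrite (distrC (prim f s)) (distrC s t).
have /andP[s0 sT] := clamp_itv s; have /andP[t0 tT] := clamp_itv t.
have -> : prim f t - prim f s = vint `]clamp s, clamp t] f.
  by rewrite -[prim f t]prim_clamp -[prim f s]prim_clamp; exact: primB.
have lf' : L2 `]clamp s, clamp t] f.
  by apply: L2_sub lf; exact: sub_oc.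
apply: le_trans (vint_norm_sqr st lf') _.
have I0 : 0 <= \int[mu]_(r in `]clamp s, clamp t]) (`|f r| ^+ 2).
  by apply: rint_ge0 => //; apply: aeW => r _; rewrite sqr_ge0.
apply: ler_pM => //; rewrite ?subr_ge0//.
  by apply: le_trans (ler_norm _) (clamp_lip _ _).
have [_ l2] := lf.
by apply: rint_subset => // r; exact: sqr_ge0.
Qed.

Lemma prim_cont f : L2 `]0, T] f -> continuous (prim f).
Proof.
move=> lf t; apply/(@cvgrPdist_lt _ V) => e e0.
pose K := \int[mu]_(r in `]0, T]) (`|f r| ^+ 2) + 1.
have K0 : 0 < K.
  by rewrite ltr_wpDl//; apply: rint_ge0 => //; apply: aeW => r _; rewrite sqr_ge0.
near=> s; rewrite -ltr_sqr ?nnegrE ?normr_ge0 ?(ltW e0)//.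
apply: le_lt_trans (prim_holder _ _ lf) _.
have : `|t - s| < e ^+ 2 / K.
  by near: s; apply: cvgr_dist_lt => //; rewrite divr_gt0// exprn_gt0.
rewrite ltr_pdivlMr//; apply: le_lt_trans; apply: ler_wpM2l => //.
by rewrite /K lerDl.
Unshelve. all: end_near. Qed.

Lemma prim_primitive f v : L2 `]0, T] f ->
  primitive_on 0 T (fun t => inner (prim f t) v) (fun t => inner (f t) v).
Proof.
move=> lf s t s0 st tT; rewrite -innerBl primB// vintE//; first exact: fin_meas_itv.
by apply: L2_sub lf; exact: sub_oc.
Qed.

End Primitive.

(** * Weak derivatives *)

Section WeakDerivatives.
Context {R : realType}.
Notation mu := (@lebesgue_measure R).

Section TestFunctions.
Variable T : R.
Hypothesis T0 : 0 < T.

Lemma test_derive (phi : R -> R) t : test_fun T phi -> is_derive t (1 : R) phi (derive1 phi t).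
Proof.
by move=> [h _]; rewrite derive1E; apply: derivableP; exact: (h 0%N t).
Qed.

Lemma test_fun_deriv phi : test_fun T phi -> test_fun T (derive1 phi).
Proof.
move=> tp; have [h [a [b [a0 bT hab]]]] := tp; split.
  by move=> k t; have := h k.+1 t; rewrite /derive1n iterSr.
exists a, b; split => // t tab; rewrite derive1E.
rewrite (@near_eq_derive _ _ _ _ (cst 0)); first exact: derive_cst.
move: tab; rewrite in_itv/= negb_and -!ltNge => /orP[ta|bt].
  near=> x; apply: hab; rewrite in_itv/= negb_and -!ltNge; apply/orP; left.
  by near: x; exact: lt_nbhsl.
near=> x; apply: hab; rewrite in_itv/= negb_and -!ltNge; apply/orP; right.
by near: x; exact: lt_nbhsr.
Unshelve. all: end_near. Qed.

Lemma test_fun_derivn phi k : test_fun T phi -> test_fun T (derive1n k phi).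
Proof. by move=> h; elim: k => // k IH; exact: test_fun_deriv. Qed.

Lemma derive1nSr (phi : R -> R) k : derive1n k.+1 phi = derive1n k (derive1 phi).
Proof. by rewrite /derive1n iterSr. Qed.

Lemma test_fun0 phi t : test_fun T phi -> t <= 0 -> phi t = 0.
Proof.
move=> [_ [a [b [a0 bT hab]]]] t0; apply: hab.
by rewrite in_itv/= negb_and -!ltNge (le_lt_trans t0 a0).
Qed.

Lemma test_funT phi t : test_fun T phi -> T <= t -> phi t = 0.
Proof.
move=> [_ [a [b [a0 bT hab]]]] Tt; apply: hab.
by rewrite in_itv/= negb_and -!ltNge (lt_le_trans bT Tt) orbT.
Qed.

Lemma test_cont0 phi : test_fun T phi -> continuous phi.
Proof. by move=> /(@test_cont _ _ _)/(_ 0%N). Qed.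

Lemma derive1n_lin (phi chi : R -> R) (c : R) k : test_fun T phi -> test_fun T chi ->
  derive1n k (fun t => phi t - c * chi t) = (fun t => derive1n k phi t - c * derive1n k chi t).
Proof.
move=> tp tc; elim: k => // k IH; rewrite !derive1nS IH; apply/funext => t.
have d1 := test_derive t (test_fun_derivn k tp).
have d2 := test_derive t (test_fun_derivn k tc).
by rewrite derive1E; exact: (@derive_val _ _ _ _ _ _ _ (is_deriveB d1 (is_deriveZ c d2))).
Qed.

Lemma test_fun_lin (phi chi : R -> R) (c : R) : test_fun T phi -> test_fun T chi ->
  test_fun T (fun t => phi t - c * chi t).
Proof.
move=> tp tc; split => [k t|].
  rewrite derive1n_lin//.
  have d1 := test_derive t (test_fun_derivn k tp).
  have d2 := test_derive t (test_fun_derivn k tc).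
  exact: (@ex_derive _ _ _ _ _ _ _ (is_deriveB d1 (is_deriveZ c d2))).
have [_ [a [b [a0 bT hab]]]] := tp; have [_ [a' [b' [a0' bT' hab']]]] := tc.
exists (Num.min a a'), (Num.max b b'); split; rewrite ?lt_min ?gt_max ?a0 ?bT//.
move=> t; rewrite in_itv/= negb_and -!ltNge lt_min gt_max => h.
rewrite hab ?hab' ?mulr0 ?subr0// in_itv/= negb_and -!ltNge;
 by case/orP : h => /andP[h1 h2]; rewrite ?h1 ?h2 ?orbT.
Qed.

(** The primitive of a test function vanishes left of the support, and right
    of it because the total integral is 0. *)
Lemma test_antideriv phi0 : test_fun T phi0 -> \int[mu]_(t in `]0, T]) phi0 t = 0 ->
  exists2 psi, test_fun T psi & derive1 psi = phi0.
Proof.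
move=> tp I0; have cp := test_cont0 tp.
pose psi x := \int[mu]_(t in `]- 1, x]) phi0 t.
have dpsi x : -1 < x -> derivable psi x 1 /\ derive1 psi x = phi0 x.
  move=> x1; apply: (@continuous_FTC1 R phi0 (BRight (-1)) x (x + 1)).
  - by rewrite ltrDl.
  - have [] : mu.-integrable `[-1, (x + 1)] (EFin \o phi0) /\ True; last first.
      move=> ii _; apply: (@integrableS _ _ _ mu _ _ _ _ _ _ ii) => //.
      by apply: subset_itvr; rewrite bnd_simp.
    split => //; apply: continuous_compact_integrable; first exact: segment_compact.
    exact: continuous_subspaceT.
  - first [exact: x1 | by rewrite lteBSide | by rewrite /Order.lt /=].
  - exact: cp.
have psi0 x : x <= 0 -> psi x = 0.
  move=> x0; rewrite /psi -[RHS](@rint0 R `]-1, x]); apply: eq_Rintegral => t.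
  rewrite mem_setE in_itv/= => /andP[_ tx]; apply: test_fun0 tp _; exact: le_trans x0.
have psiD x : derivable psi x 1 /\ derive1 psi x = phi0 x.
  have [/dpsi//|x1] := ltP (-1) x.
  have nz : \forall y \near x, 0 = psi y.
    near=> y; rewrite psi0//; apply: ltW; near: y; apply: lt_nbhsl; lra.
  split; first by apply: near_eq_derivable nz _; exact: derivable_cst.
  rewrite derive1E -(near_eq_derive _ nz) derive_cst (test_fun0 tp)//; lra.
have e1 : derive1 psi = phi0 by apply/funext => x; have [] := psiD x.
exists psi => //; split.
  case=> [|k] t; first by have [] := psiD t.
  by rewrite derive1nSr e1; case: tp => h _; exact: h.
have [_ [a [b [a0 bT hab]]]] := tp.
have LIp u v : LI `]u, v] phi0 by exact: LI_cont.
exists a, b; split => // t; rewrite in_itv/= negb_and -!ltNge => /orP[ta|bt].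
  have [/psi0//|t0] := leP t 0.
  rewrite /psi -[RHS](@rint0 R `]-1, t]); apply: eq_Rintegral => s.
  rewrite mem_setE in_itv/= => /andP[_ st]; apply: hab.
  by rewrite in_itv/= negb_and -!ltNge (le_lt_trans st ta).
have [ab|ba] := leP a b; last first.
  rewrite /psi -[RHS](@rint0 R `]-1, t]); apply: eq_Rintegral => s _; apply: hab.
  rewrite in_itv/= negb_and -!ltNge; case: (ltP s a) => //= as_; exact: lt_le_trans as_.
have t0 : 0 < t by apply: lt_trans bt; exact: lt_le_trans ab.
have z u v : v <= 0 \/ b < u -> \int[mu]_(s in `]u, v]) phi0 s = 0.
  move=> huv; rewrite -[RHS](@rint0 R `]u, v]); apply: eq_Rintegral => s.
  rewrite mem_setE in_itv/= => /andP[us sv]; case: huv => [v0|bu].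
    by apply: test_fun0 tp _; exact: le_trans v0.
  apply: hab; rewrite in_itv/= negb_and -!ltNge; apply/orP; right; exact: lt_trans us.
rewrite /psi (@rint_split _ (-1) 0 t) ?(ltW t0)// ?lerN10// z ?add0r; last by left.
have [tT|/ltW Tt] := leP t T.
  by have := I0; rewrite (@rint_split _ 0 t T) ?(ltW t0)// (z t T) ?addr0//; right.
rewrite (@rint_split _ 0 T t) ?(ltW T0)// I0 add0r.
rewrite -[RHS](@rint0 R `]T, t]); apply: eq_Rintegral => s.
rewrite mem_setE in_itv/= => /andP[Ts _]; apply: test_funT tp _; exact: ltW.
Unshelve. all: end_near. Qed.

(** If all test functions had integral 0, the fundamental lemma would give 1 =
    0 almost everywhere. *)
Lemma ex_unit_test : exists2 chi, test_fun T chi & \int[mu]_(t in `]0, T]) chi t = 1.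
Proof.
suff [chi tc ne] : exists2 chi, test_fun T chi & \int[mu]_(t in `]0, T]) chi t != 0.
  set c := \int[mu]_(t in _) _ in ne.
  have t0 : test_fun T (fun t => chi t - 1 * chi t) by exact: test_fun_lin.
  exists (fun t => (chi t - 1 * chi t) - (- c^-1) * chi t); first exact: test_fun_lin.
  rewrite -[RHS](mulVf ne) -rintZ//; last by apply: LI_cont; exact: test_cont0.
  by apply: eq_Rintegral => t _; ring.
apply: contrapT => h.
have : {ae mu, forall t : R, t \in `]0, T[ -> (1 : R) = 0}.
  apply: (@fund_lemma R T (fun=> 1)); first exact: (LI_cst _ (fin_meas_itv _ _ _ _)).
  move=> phi tp; rewrite rint_oo_oc; under eq_Rintegral do rewrite mulr1.
  by apply: contrapT => /eqP ne; apply: h; exists phi.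
move=> [N [mN N0 sub]].
have : (mu `]0%R, T[%classic <= mu N)%E.
  apply: le_measure; rewrite ?inE//.
  move=> t tT; apply: sub => /= /(_ _)/eqP; rewrite oner_eq0 => h1.
  by have := h1 tT.
by rewrite N0 lebesgue_measure_itv/= lte_fin T0 -EFinB lee_fin subr0 leNgt T0.
Qed.

End TestFunctions.

Section Reduction.
Context {V K : hilbertType R} (j : blin V K).
Variable T : R.
Hypothesis T0 : 0 < T.
Implicit Types f g : R -> V.

(** f is the k-th weak derivative of g after the embedding j. It is used with
    j = iota for the V-valued functions u and w, whose derivatives are taken
    in V', and with j = id for Riesz representatives of V'-valued functions. *)
Definition weak_pair (k : nat) g f := forall phi, test_fun T phi -> forall v,
  \int[mu]_(t in `]0, T]) (derive1n k phi t * inner (j (g t)) (j v)) =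
  (-1) ^+ k * \int[mu]_(t in `]0, T]) (phi t * inner (j (f t)) (j v)).

Lemma L2_jinner f v : L2 `]0, T] f -> LI `]0, T] (fun t => inner (j (f t)) (j v)).
Proof. by move=> lf; apply: L2_inner; [exact: fin_meas_itv|exact: L2_blin]. Qed.

Lemma L2_testZ phi f : test_fun T phi -> L2 `]0, T] f -> L2 `]0, T] (fun t => phi t *: f t).
Proof.
move=> tp lf; have cp := test_cont0 tp.
have [K0 _ hK] := @bnd_on_itv R R^o 0 T phi cp.
apply: (@L2Z _ _ _ (phi : R -> R^o) _ K0) => //; first exact: (@sm_cont _ R^o).
apply: aeW => t /=; rewrite in_itv/= => /andP[t0 tT]; apply: hK.
by rewrite in_itv/= ltW.
Qed.

(** With chi of integral 1, every test function is c chi + psi' for a test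
    function psi. On psi' the hypothesis applies, after an integration by
    parts on the side of f; the value at chi fixes the constant C. *)
Lemma weak_reduce k g f : L2 `]0, T] g -> L2 `]0, T] f -> weak_pair k.+1 g f ->
  exists C, weak_pair k g (fun t => C + prim T f t).
Proof.
move=> lg lf w.
have mD : measurable `]0, T]%classic by exact: measurable_itv.
have [chi tc c1] := ex_unit_test T0.
have cP := prim_cont T0 lf.
have lP : L2 `]0, T] (prim T f) by case: (L2_cont 0 T cP).
pose h t := (-1) ^+ k *: (derive1n k chi t *: g t) - chi t *: prim T f t.
have lh : L2 `]0, T] h.
  apply: L2B; last exact: L2_testZ.
  apply: (@L2Z _ _ _ (fun=> (-1) ^+ k) _ `|(-1) ^+ k|); [exact: sm_cst|by apply: aeW|].
  by apply: L2_testZ => //; exact: test_fun_derivn.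
(* this constant makes the relation true for phi = chi *)
exists (vint `]0, T] h) => phi tp v.
pose c := \int[mu]_(t in `]0, T]) phi t.
have tp0 := test_fun_lin c tp tc.
have Lphi p q : test_fun T p -> L2 `]0, T] q -> LI `]0, T] (fun t => p t * inner (j (q t)) (j v)).
  by move=> tpp lq; apply: LI_mulcont; [exact: (test_cont0 tpp)|exact: L2_jinner].
have Lp p : test_fun T p -> LI `]0, T] p by move=> tpp; apply: LI_cont; exact: (test_cont0 tpp).
have [psi tpsi dpsi] : exists2 psi, test_fun T psi & derive1 psi = (fun t => phi t - c * chi t).
  apply: test_antideriv => //; rewrite rintB// ?rintZ// ?c1 ?mulr1 ?subrr//.
  - exact: Lp.
  - exact: Lp.
  - by apply: LIZ; exact: Lp.
have := w psi tpsi v; rewrite derive1nSr dpsi (derive1n_lin c k tp tc).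
have -> : \int[mu]_(t in `]0, T]) (psi t * inner (j (f t)) (j v)) =
    - \int[mu]_(t in `]0, T]) ((phi t - c * chi t) * inner (j (prim T f t)) (j v)).
  pose x := mass j v; have hx y : inner (j y) (j v) = inner y x := mass_sym j y v.
  under eq_Rintegral do rewrite hx.
  under [in RHS]eq_Rintegral do rewrite hx.
  have ib := @ibp R 0 T (fun t => inner (prim T f t) x) (fun t => inner (f t) x)
    psi (fun t => phi t - c * chi t) (ltW T0).
  have lfx : LI `]0, T] (fun t => inner (f t) x) by apply: L2_inner => //; exact: fin_meas_itv.
  have cPx : continuous (fun t => inner (prim T f t) x).
    by move=> t; apply: cvg_inner; [exact: cP|exact: cvg_cst].
  have dps t : is_derive t (1 : R) psi (phi t - c * chi t).
    by rewrite -[_ - _]/((fun t => phi t - c * chi t) t) -dpsi; exact: test_derive tpsi.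
  have pP : primitive_on 0 T (fun t => inner (prim T f t) x) (fun t => inner (f t) x).
    exact: prim_primitive.
  rewrite (ib lfx cPx pP dps (test_cont0 tp0)).
  by rewrite (test_fun0 tpsi (lexx 0)) (test_funT tpsi (lexx T)) !mul0r subrr sub0r.
move=> e; under [in RHS]eq_Rintegral do rewrite linearD innerDl mulrDr.
rewrite [in RHS]rintD//; last 2 first.
- apply: (@LI_ae _ _ _ (fun t => inner (j (vint `]0, T] h)) (j v) * phi t)).
    by apply: aeW => t _; rewrite mulrC.
  by apply: LIZ; exact: Lp.
- exact: Lphi.
have -> : \int[mu]_(t in `]0, T]) (phi t * inner (j (vint `]0, T] h)) (j v)) =
    c * ((-1) ^+ k * \int[mu]_(t in `]0, T]) (derive1n k chi t * inner (j (g t)) (j v)) -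
    \int[mu]_(t in `]0, T]) (chi t * inner (j (prim T f t)) (j v))).
  under eq_Rintegral do rewrite mulrC; rewrite rintZ//; last exact: Lp.
  rewrite mulrC; congr (_ * _).
  pose x := mass j v; have hx y : inner (j y) (j v) = inner y x := mass_sym j y v; rewrite hx vintE//; last exact: fin_meas_itv.
  under eq_Rintegral => t _ do rewrite /h innerBl !innerZl -!hx.
  rewrite rintB//; [|by apply: LIZ; apply: Lphi => //; exact: test_fun_derivn|exact: Lphi].
  by rewrite rintZ//; apply: Lphi => //; exact: test_fun_derivn.
move: e; under eq_Rintegral do rewrite mulrBl -mulrA.
under [in RHS]eq_Rintegral do rewrite mulrBl -mulrA.
have t1 := test_fun_derivn k tp; have t2 := test_fun_derivn k tc.
rewrite !rintB ?rintZ//; try (by apply: Lphi); try (by apply: LIZ; apply: Lphi).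
rewrite exprS mulN1r => e.
have s1 : (-1) ^+ k * (-1) ^+ k = 1 :> R by rewrite -exprMn mulrNN mulr1 expr1n.
move: e; move: ((-1) ^+ k) s1 => s s1.
move: (\int[mu]_(_ in _) _) (\int[mu]_(_ in _) _) (\int[mu]_(_ in _) _) (\int[mu]_(_ in _) _) => a b x y e.
have -> : y = c * x + s * (b - c * a) by rewrite -(subrK (c * x) y) e; ring.
rewrite -{1}[c * x]mul1r -s1; ring.
Qed.

Lemma L2_iter f C : L2 `]0, T] f -> continuous (fun t => C + prim T f t).
Proof. by move=> lf t; apply: (@cvgD _ V); [exact: cvg_cst|exact: prim_cont]. Qed.

(** h arises from f by k successive primitives with free constants of
    integration. *)
Fixpoint iter_prim (k : nat) (h f : R -> V) : Prop :=
  if k is k'.+1 then exists C, iter_prim k' h (fun t => C + prim T f t) else h = f.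

Lemma iter_prim_cont k h f : continuous f -> iter_prim k h f -> continuous h.
Proof.
elim: k f => [f cf -> //|k IH f cf [C]]; apply: IH; apply: L2_iter.
by case: (L2_cont 0 T cf).
Qed.

Hypothesis ji : injective j.

(** Order by order with [weak_reduce]; at order 0 the fundamental lemma gives
    equality tested with each v, and [pettis] removes v. *)
Lemma weak_repr k g f : L2 `]0, T] g -> L2 `]0, T] f -> weak_pair k g f ->
  exists2 h, iter_prim k h f & {ae mu, forall t, `]0, T]%classic t -> g t = h t}.
Proof.
elim: k f => [|k IH] f lg lf w.
  exists f => //.
  have : {ae mu, forall t, `]0, T]%classic t -> g t - f t = 0}.
    have [sd _] := L2B lg lf.
    apply: (pettis ji sd) => v; apply: ae_oo_oc.
    have Lgf : LI `]0, T[ (fun t => inner (j (g t - f t)) (j v)).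
      apply: LI_sub (L2_jinner v (L2B lg lf)).
      by apply: subset_itvl; rewrite bnd_simp.
    apply: fund_lemma Lgf _ => phi tp.
    rewrite rint_oo_oc; under eq_Rintegral do rewrite linearB innerBl mulrBr.
    rewrite rintB//; last 2 first.
    - by apply: LI_mulcont; [exact: (test_cont0 tp)|exact: L2_jinner].
    - by apply: LI_mulcont; [exact: (test_cont0 tp)|exact: L2_jinner].
    have := w phi tp v; rewrite derive1n0 expr0 mul1r => ->.
    by rewrite subrr.
  by apply: aeS => t h Dt; apply/eqP; rewrite -subr_eq0; apply/eqP; exact: h.
have [C wC] := weak_reduce lg lf w.
have [h ih gh] := IH _ lg (L2_cont 0 T (L2_iter (C := C) lf)).2 wC.
by exists h => //; exists C.
Qed.

End Reduction.
End WeakDerivatives.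

(** * Vector-valued polynomials and Taylor approximation *)

Section VectorPolynomials.
Context {R : realType} {V : hilbertType R}.
Notation mu := (@lebesgue_measure R).

(** Polynomials are kept as coefficient sequences cut at degree m, so that
    derivatives and values at points need no normal form. *)
Definition vpol (m : nat) (c : nat -> V) (t : R) : V := \sum_(i < m) t ^+ i *: c i.

Definition ispol (m : nat) (f : R -> V) := exists c, forall t, f t = vpol m c t.

Lemma ispol_vpol m c : ispol m (vpol m c). Proof. by exists c. Qed.

Lemma ispol_horner m (P : {poly R}) (x : V) : (size P <= m)%N -> ispol m (fun t => P.[t] *: x).
Proof.
move=> sP; exists (fun i => P`_i *: x) => t.
rewrite (horner_coef_wide _ sP) scaler_suml; apply: eq_bigr => i _.
by rewrite scalerA mulrC.
Qed.

Lemma ispolD m f g : ispol m f -> ispol m g -> ispol m (fun t => f t + g t).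
Proof.
move=> [c fc] [d gd]; exists (fun i => c i + d i) => t; rewrite fc gd -big_split.
by apply: eq_bigr => i _; rewrite scalerDr.
Qed.

Lemma ispolZ m (a : R) f : ispol m f -> ispol m (fun t => a *: f t).
Proof.
move=> [c fc]; exists (fun i => a *: c i) => t; rewrite fc scaler_sumr.
by apply: eq_bigr => i _; rewrite !scalerA mulrC.
Qed.

Lemma ispolB m f g : ispol m f -> ispol m g -> ispol m (fun t => f t - g t).
Proof. by move=> pf /(ispolZ (-1)) pg; under eq_fun do rewrite -scaleN1r; exact: ispolD. Qed.

Lemma ispol0 m : ispol m (fun=> 0).
Proof. by exists (fun=> 0) => t; rewrite /vpol big1// => i _; rewrite scaler0. Qed.

Lemma ispol_sum m (I : Type) (r : seq I) (F : I -> R -> V) :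
  (forall i, ispol m (F i)) -> ispol m (fun t => \sum_(i <- r) F i t).
Proof.
move=> FI; elim: r => [|i r IH]; first by under eq_fun do rewrite big_nil; exact: ispol0.
by under eq_fun do rewrite big_cons; exact: ispolD.
Qed.

Lemma ispol_le m n f : (m <= n)%N -> ispol m f -> ispol n f.
Proof.
move=> mn [c fc]; exists (fun i => if (i < m)%N then c i else 0) => t; rewrite fc /vpol.
rewrite (big_ord_widen n (fun i => t ^+ i *: c i) mn) big_mkcond.
by apply: eq_bigr => i _; case: ifP; rewrite ?scaler0.
Qed.

Lemma ispol_affine m f (a b : R) : ispol m f -> ispol m (fun t => f (a * t + b)).
Proof.
move=> [c fc].
have -> : (fun t => f (a * t + b)) =
    (fun t => \sum_(i < m) ((a *: 'X + b%:P) ^+ i).[t] *: c i).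
  by apply/funext => t; rewrite fc; apply: eq_bigr => i _; rewrite horner_exp !hornerE.
apply: ispol_sum => i; apply: ispol_horner.
apply: leq_trans (ltn_ord i).
apply: leq_trans (size_poly_exp_leq _ _) _.
have sz : (size (a *: 'X + b%:P)%R <= 2)%N.
  apply: leq_trans (size_polyD _ _) _; rewrite geq_max.
  by rewrite (leq_trans (size_scale_leq _ _)) ?size_polyX// (leq_trans (size_polyC_leq1 _)).
by rewrite ltnS -[leqRHS]mul1n leq_mul2r -subn1 leq_subLR sz orbT.
Qed.

Lemma ispol_cont m f : ispol m f -> continuous f.
Proof.
move=> [c fc]; rewrite (funext fc); elim: m {fc} => [|m IH] t.
  by rewrite (_ : vpol 0 c = cst 0); [exact: cvg_cst|apply/funext => s; rewrite /vpol big_ord0].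
rewrite (_ : vpol m.+1 c = (fun s => vpol m c s + s ^+ m *: c m)).
  by apply: (@cvgD _ V); [exact: IH|apply: cvgZr_tmp; exact: exprn_continuous].
by apply/funext => s; rewrite /vpol big_ord_recr.
Qed.

Definition vder (c : nat -> V) (i : nat) : V := i.+1%:R *: c i.+1.

Lemma is_derive_scalel (phi : R -> R) (x : V) (t l : R) :
  is_derive t (1 : R) phi l -> is_derive t (1 : R) (fun s => phi s *: x) (l *: x).
Proof.
move=> [d e].
have c : h^-1 *: (phi (h *: 1 + t) *: x - phi t *: x) @[h --> 0^'] --> l *: x.
  under eq_fun do rewrite -scalerBl scalerA.
  by apply: cvgZr_tmp; rewrite -e; exact: d.
by split; [apply/cvg_ex; exists (l *: x)|exact: cvg_lim].
Qed.

Lemma vpol_derive m (c : nat -> V) (t : R) :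
  is_derive t (1 : R) (vpol m.+1 c) (vpol m (vder c) t).
Proof.
have mono (x : V) n : is_derive t (1 : R) (fun s : R => s ^+ n *: x) ((n%:R * t ^+ n.-1) *: x).
  apply: is_derive_scalel.
  by apply: is_derive1_eq (is_deriveX n (is_derive_id t (1 : R))) _ _; [move=> s; rewrite !fctE|rewrite /GRing.scale/= mulr1].
have -> : vpol m.+1 c = \sum_(i < m.+1) (fun s : R => s ^+ i *: c i).
  by apply/funext => s; rewrite fct_sumE.
have -> : vpol m (vder c) t = \sum_(i < m.+1) ((i%:R * t ^+ i.-1) *: c i).
  rewrite big_ord_recl mul0r scale0r add0r; apply: eq_bigr => i _.
  by rewrite /vder scalerA lift0 /= mulrC.
by apply: is_derive_sum => i; exact: mono.
Qed.

Lemma inner_derive (f : R -> V) (x : V) (t : R) (l : V) :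
  is_derive t (1 : R) f l -> is_derive t (1 : R) (fun s => inner (f s) x) (inner l x).
Proof.
move=> [d e].
have c : h^-1 *: (inner (f (h *: 1 + t)) x - inner (f t) x) @[h --> 0^'] --> inner l x.
  under eq_fun do rewrite -innerBl -[_ *: inner _ _]innerZl.
  by apply: cvg_inner; [rewrite -e; exact: d|exact: cvg_cst].
by split; [apply/cvg_ex; exists (inner l x)|exact: cvg_lim].
Qed.

Lemma ispol_antideriv m (f : R -> V) (x : V) : ispol m f -> exists2 F, ispol m.+1 F &
  F 0 = x /\ forall t, is_derive t (1 : R) F (f t).
Proof.
move=> [c fc]; pose d i := if i is k.+1 then k.+1%:R^-1 *: c k else x.
exists (vpol m.+1 d); first exact: ispol_vpol.
split.
  rewrite /vpol big_ord_recl expr0 scale1r big1 ?addr0// => i _.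
  by rewrite lift0 expr0n scale0r.
move=> t; have := vpol_derive m d t; congr is_derive.
rewrite fc; apply: eq_bigr => i _; congr (_ *: _).
by rewrite /vder /d scalerA mulfV// scale1r.
Qed.

Lemma FTC_vec (a b : R) (F f : R -> V) (v : V) : a <= b ->
  (forall t, is_derive t (1 : R) F (f t)) -> continuous f ->
  \int[mu]_(t in `]a, b]) inner (f t) v = inner (F b - F a) v.
Proof.
move=> ab dF cf; rewrite innerBl; apply: (@FTC_C1 R a b (fun t => inner (F t) v) (fun t => inner (f t) v)) => //.
  by move=> t; exact: inner_derive.
by move=> t; apply: cvg_inner; [exact: cf|exact: cvg_cst].
Qed.

Variable T : R.
Hypothesis T0 : 0 < T.

Lemma primC_sub (C : V) f s t : L2 `]0, T] f -> 0 <= s -> s <= t -> t <= T ->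
  (C + prim T f t) - (C + prim T f s) = vint `]s, t] f.
Proof. by move=> lf s0 st tT; rewrite opprD addrACA subrr add0r; exact: primB. Qed.

(** The primitive of p that agrees with C + prim T f at b differs from it by
    the integral of f - p over [t, b]. *)
Lemma taylor_step (a b e : R) (C : V) (f p : R -> V) m :
  0 <= a -> a <= b -> b <= T -> L2 `]0, T] f -> ispol m p ->
  (forall t, t \in `[a, b] -> `|f t - p t| <= e) ->
  exists p', [/\ ispol m.+1 p', p' b = C + prim T f b &
    forall t, t \in `[a, b] -> `|(C + prim T f t) - p' t| <= e * (b - a)].
Proof.
move=> a0 ab bT lf pp fp.
have [F FF [_ dF]] := ispol_antideriv 0 pp.
have e0 : 0 <= e by apply: le_trans (fp b _); rewrite ?in_itv/= ?ab ?lexx.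
exists (fun t => (F t - F b) + (C + prim T f b)); split.
- apply: ispolD; first apply: ispolB => //.
    by exists (fun i => if i is 0 then F b else 0) => t; rewrite /vpol big_ord_recl expr0 scale1r big1 ?addr0// => i _; rewrite lift0 scaler0.
  by exists (fun i => if i is 0 then (C + prim T f b) else 0) => t; rewrite /vpol big_ord_recl expr0 scale1r big1 ?addr0// => i _; rewrite lift0 scaler0.
- by rewrite subrr add0r.
move=> t; rewrite in_itv/= => /andP[at_ tb].
set D := _ - _.
have t0 := le_trans a0 at_.
have lf' : L2 `]t, b] f by apply: L2_sub lf; exact: sub_oc.
have cp := ispol_cont pp.
have lp : L2 `]t, b] p by case: (L2_cont t b cp).
have DE v : inner D v = - \int[mu]_(s in `]t, b]) inner (f s - p s) v.
  under eq_Rintegral do rewrite innerBl.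
  rewrite rintB//; [|exact: (L2_inner v (fin_meas_itv _ _ _ _) lf')|exact: (L2_inner v (fin_meas_itv _ _ _ _) lp)].
  rewrite (FTC_vec v tb dF cp) -vintE//; last exact: fin_meas_itv.
  rewrite -(primC_sub C lf)// /D !(innerBl, innerDl); ring.
have [->|Dn0] := eqVneq D 0; first by rewrite normr0 mulr_ge0// subr_ge0.
have nD : 0 < `|D| by rewrite normr_gt0.
rewrite -(ler_pM2r nD) -expr2 -innerxx DE.
apply: le_trans (ler_norm _) _; rewrite normrN.
have ld := L2_inner D (fin_meas_itv _ _ _ _) (L2B lf' lp).
apply: le_trans (rint_abs (measurable_itv _) ld) _.
apply: le_trans (_ : \int[mu]_(s in `]t, b]) (e * `|D|) <= _).
  apply: rint_le => //; [exact: LI_abs|exact: (LI_cst _ (fin_meas_itv _ _ _ _))|].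
  apply: aeW => s /=; rewrite in_itv/= => /andP[ts sb].
  apply: le_trans (inner_CS _ _) _; apply: ler_wpM2r => //; apply: fp.
  by rewrite in_itv/= sb (le_trans at_ (ltW ts)).
rewrite rint_cst// mulrAC; apply: ler_wpM2r => //; apply: ler_wpM2l => //.
by rewrite lerD2l lerN2.
Qed.

Lemma taylor_iter k (a b e : R) (h f p : R -> V) m :
  0 <= a -> a <= b -> b <= T -> L2 `]0, T] f -> ispol m p -> p b = f b ->
  (forall t, t \in `[a, b] -> `|f t - p t| <= e) -> iter_prim T k h f ->
  exists p', [/\ ispol (m + k) p', p' b = h b &
    forall t, t \in `[a, b] -> `|h t - p' t| <= e * (b - a) ^+ k].
Proof.
move=> a0 ab bT; elim: k m e f p => [|k IH] m e f p lf pp pb fp.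
  by move=> /= ->; exists p; split => //; rewrite ?addn0// => t tab; rewrite expr0 mulr1; exact: fp.
move=> [C ih].
have [p1 [pp1 p1b fp1]] := taylor_step C a0 ab bT lf pp fp.
have [p' [pp' p'b hp']] := IH _ _ _ _ (L2_cont 0 T (L2_iter T0 (C := C) lf)).2 pp1 p1b fp1 ih.
by exists p'; split; rewrite ?addnS//= => t tab; rewrite exprS mulrA; exact: hp'.
Qed.

(** The Taylor polynomial at the right endpoint b. The innermost primitive is
    approximated by its value at b, with an error at most the integral of |f|;
    each further primitive costs a factor b - a. *)
Lemma taylor k (a b : R) (h f : R -> V) : 0 <= a -> a <= b -> b <= T -> L2 `]0, T] f ->
  iter_prim T k.+1 h f ->
  exists p, [/\ ispol k.+1 p, p b = h b &
    forall t, t \in `[a, b] -> `|h t - p t| <= \int[mu]_(s in `]a, b]) `|f s| * (b - a) ^+ k].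
Proof.
move=> a0 ab bT lf [C ih].
have pc : ispol 1 (fun=> C + prim T f b).
  by exists (fun=> C + prim T f b) => t; rewrite /vpol big_ord_recl expr0 scale1r big_ord0 addr0.
rewrite -[k.+1]add1n.
apply: (taylor_iter a0 ab bT (L2_cont 0 T (L2_iter T0 (C := C) lf)).2 pc _ _ ih) => //.
move=> t; rewrite in_itv/= => /andP[at_ tb].
rewrite distrC primC_sub//; last exact: le_trans at_.
have lf' : L2 `]a, b] f by apply: L2_sub lf; exact: sub_oc.
have lft : L2 `]t, b] f by apply: L2_sub lf'; exact: sub_oc.
apply: le_trans (vint_norm (fin_meas_itv _ _ _ _) lft) _.
by apply: rint_subset => //; exact: (LI_norm (fin_meas_itv _ _ _ _) lf').
Qed.

End VectorPolynomials.

(** * Interpolation with vanishing moments *)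

Section Interpolation.
Context {R : realType}.
Notation mu := (@lebesgue_measure R).

Definition antideriv (P : {poly R}) : {poly R} :=
  \poly_(i < (size P).+1) (if i is k.+1 then P`_k / k.+1%:R else 0).

Lemma antiderivK P : (antideriv P)^`() = P.
Proof.
apply/polyP => i; rewrite coef_deriv coef_poly ltnS.
case: ltnP => [iP|Pi]; last by rewrite mul0rn nth_default.
by rewrite -(mulr_natr (_ / _)) divfK// pnatr_eq0.
Qed.

Lemma antideriv0 P : (antideriv P).[0] = 0.
Proof. by rewrite horner_coef0 coef_poly. Qed.

Lemma antideriv1X n : (antideriv 'X^n).[1] = n.+1%:R^-1.
Proof.
rewrite horner_poly size_polyXn big_ord_recr/= expr1n mulr1 coefXn eqxx mul1r.
rewrite big1 ?add0r// => -[i /= iS] _; rewrite expr1n mulr1.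
by case: i iS => // i iS; rewrite coefXn ltn_eqF ?mul0r.
Qed.

Lemma rint_affine (a b l m : R) (P : {poly R}) : a <= b -> l != 0 ->
  \int[mu]_(t in `]a, b]) P.[l * t + m] =
  l^-1 * ((antideriv P).[l * b + m] - (antideriv P).[l * a + m]).
Proof.
move=> ab l0; rewrite mulrBr.
apply: (@FTC_C1 R a b (fun t => l^-1 * (antideriv P).[l * t + m])) => // [t|].
  have d1 : is_derive t (1 : R) (fun t : R => l * t + m) l.
    apply: is_derive1_eq (is_deriveD (is_deriveZ l (is_derive_id t (1 : R))) (is_derive_cst m t (1 : R))) _ _ => //.
    by rewrite addr0 /GRing.scale/= mulr1.
  have d2 := @is_derive1_comp R (horner (antideriv P)) (fun t => l * t + m) t _ _
    (is_derive_horner (antideriv P) (l * t + m)) d1.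
  apply: is_derive1_eq (is_deriveZ l^-1 d2) _ _ => //.
  by rewrite antiderivK /GRing.scale/= mulrCA mulVf// mulr1.
move=> t; apply: (@continuous_comp _ _ _ (fun t : R => l * t + m) (horner P)); last exact: continuous_horner.
by apply: (@cvgD _ R^o); [apply: cvgMr; exact: cvg_id|exact: cvg_cst].
Qed.

Lemma moment_down (a b : R) n : a < b ->
  \int[mu]_(t in `]a, b]) ((b - t) / (b - a)) ^+ n = (b - a) / n.+1%:R.
Proof.
move=> ab; have d0 : b - a != 0 by rewrite subr_eq0 gt_eqF.
have e t : (b - t) / (b - a) = - (b - a)^-1 * t + b / (b - a) by field.
under eq_Rintegral do rewrite e -hornerXn.
rewrite rint_affine ?ltW ?oppr_eq0 ?invr_eq0//.
rewrite (_ : - (b - a)^-1 * b + _ = 0); last by field.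
rewrite (_ : - (b - a)^-1 * a + _ = 1); last by field.
by rewrite antideriv0 antideriv1X sub0r invrN invrK mulrNN.
Qed.

Lemma moment_up (a b : R) n : a < b ->
  \int[mu]_(t in `]a, b]) ((t - a) / (b - a)) ^+ n = (b - a) / n.+1%:R.
Proof.
move=> ab; have d0 : b - a != 0 by rewrite subr_eq0 gt_eqF.
have e t : (t - a) / (b - a) = (b - a)^-1 * t + - a / (b - a) by field.
under eq_Rintegral do rewrite e -hornerXn.
rewrite rint_affine ?ltW ?invr_eq0//.
rewrite (_ : (b - a)^-1 * b + _ = 1); last by field.
rewrite (_ : (b - a)^-1 * a + _ = 0); last by field.
by rewrite antideriv0 antideriv1X subr0 invrK.
Qed.

(** A property that holds almost everywhere holds somewhere in each nonempty
    interval. *)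
Lemma ae_dense (a b c d : R) (P : R -> Prop) : c < d ->
  {ae mu, forall t, `]a, b[%classic t -> P t} -> `]c, d[ `<=` `]a, b[%classic ->
  exists2 t, `]c, d[%classic t & P t.
Proof.
move=> cd [N [mN N0 sub]] sub2; apply: contrapT => h.
have : (mu `]c, d[%classic <= mu N)%E.
  apply: le_measure; rewrite ?inE//.
  move=> t tT; apply: sub => /= /(_ (sub2 _ tT)) Pt.
  by apply: h; exists t.
by rewrite N0 lebesgue_measure_itv/= lte_fin cd -EFinB lee_fin leNgt subr_gt0 cd.
Qed.

(** Each point of [a, b] is a limit of points where the functions agree. *)
Lemma ae_cont_eq (W : normedModType R) (a b : R) (f g : R -> W) : a < b ->
  {within `[a, b], continuous f} -> {within `[a, b], continuous g} ->
  {ae mu, forall t, `]a, b[%classic t -> f t = g t} ->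
  forall t, t \in `[a, b] -> f t = g t.
Proof.
move=> ab cf cg fg t; rewrite in_itv/= => /andP[at_ tb].
pose h s := f s - g s.
have ch : {within `[a, b], continuous h} by move=> s; apply: cvgB; [exact: cf|exact: cg].
suff : `|h t| <= 0 by rewrite normr_le0 subr_eq0 => /eqP.
apply/ler_addgt0Pl => e e0; rewrite addr0.
have tab : `[a, b]%classic t by rewrite /= in_itv/= at_ tb.
have /(@cvgrPdist_lt _ W)/(_ e e0)[r /= r0 hr] := (subspace_continuousP _ _).1 ch t tab.
have cd : Num.max a (t - r) < Num.min b (t + r).
  by rewrite gt_max !lt_min ab; apply/andP; split; [|apply/andP; split]; lra.
have sub : `](Num.max a (t - r)), (Num.min b (t + r))[ `<=` `]a, b[%classic.
  by move=> s; rewrite /= !in_itv/= gt_max lt_min => /andP[/andP[-> _] /andP[-> _]].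
have [s scd fs] := ae_dense cd fg sub.
have := sub s scd; rewrite /= in_itv/= => /andP[/ltW as_ /ltW sb].
move: scd; rewrite /= in_itv/= gt_max lt_min => /andP[/andP[_ rs] /andP[_ sr]].
have : `|h t - h s| < e.
  by apply: hr; rewrite ?in_itv/= ?as_//= ltr_norml; apply/andP; split; lra.
by rewrite /h fs subrr subr0 => /ltW.
Qed.

(** The Gram matrix of the monomials for the weight s on [0, 1] is invertible:
    a vector in its kernel is the coefficient vector of a polynomial p with
    vanishing integral of s p(s)^2. *)
Lemma dual_weights (q : nat) : exists W : 'I_q -> 'I_q -> R,
  (forall i k : 'I_q, \sum_(l < q) (i + l).+2%:R^-1 * W l k = (i == k)%:R) /\
  (forall i k : 'I_q, \sum_(l < q) W i l * (l + k).+2%:R^-1 = (i == k)%:R).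
Proof.
pose G : 'M[R]_q := \matrix_(i, k) (i + k).+2%:R^-1.
suff uG : G \in unitmx.
  exists (fun i k => invmx G i k); split => i k.
    have := mulmxV uG => /matrixP/(_ i k); rewrite !mxE => <-.
    by apply: eq_bigr => l _; rewrite mxE.
  have := mulVmx uG => /matrixP/(_ i k); rewrite !mxE => <-.
  by apply: eq_bigr => l _; rewrite mxE.
rewrite -row_free_unit -kermx_eq0; apply/eqP/row_matrixP => i0; rewrite row0.
set c := row i0 _.
have cG : c *m G = 0 by rewrite -row_mul mulmx_ker row0.
pose p : {poly R} := \sum_(i < q) c 0 i *: 'X^i.
have pE t : p.[t] = \sum_(i < q) c 0 i * t ^+ i.
  by rewrite horner_sum; apply: eq_bigr => i _; rewrite hornerZ hornerXn.
have cp : continuous (fun t : R => t * p.[t] ^+ 2).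
  move=> t; apply: cvgM; first exact: cvg_id.
  by under eq_fun do rewrite expr2; rewrite expr2; apply: cvgM; exact: continuous_horner.
have mom n : \int[mu]_(t in `]0, 1]) t ^+ n = n.+1%:R^-1 :> R.
  have := @moment_up 0 1 n ltr01; rewrite subr0 mul1r => <-.
  by apply: eq_Rintegral => t _; rewrite subr0 divr1.
have LIX n : LI `]0, 1] (fun t : R => t ^+ n) by apply: LI_cont; exact: exprn_continuous.
have I0 : \int[mu]_(t in `]0, 1]) (t * p.[t] ^+ 2) = 0.
  under eq_Rintegral => t _.
    rewrite (_ : t * p.[t] ^+ 2 = \sum_(i < q) (\sum_(k < q) (c 0 i * c 0 k) * t ^+ (i + k).+1)).
      over.
    rewrite pE expr2 mulrA mulrC mulr_suml; apply: eq_bigr => i _.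
    rewrite !mulr_sumr; apply: eq_bigr => k _.
    by rewrite exprS exprD; ring.
  rewrite rint_sum//; last by move=> i; apply: LI_sum => k; exact: LIZ.
  transitivity ((c *m G *m c^T) 0 0); last by rewrite cG mul0mx mxE.
  transitivity (\sum_(k < q) \sum_(i < q) c 0 k * c 0 i * (k + i).+2%:R^-1).
    apply: eq_bigr => i _; rewrite rint_sum//; last by move=> k; exact: LIZ.
    by apply: eq_bigr => k _; rewrite rintZ// mom.
  rewrite mxE exchange_big; apply: eq_bigr => k _; rewrite !mxE mulr_suml.
  by apply: eq_bigr => i _; rewrite !mxE; ring.
have p0 t : t \in `[0, 1] -> t * p.[t] ^+ 2 = 0.
  apply: (@ae_cont_eq R^o 0 1 (fun t => t * p.[t] ^+ 2) (fun=> 0) ltr01).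
  - exact: continuous_subspaceT.
  - by apply: continuous_subspaceT => ?; exact: cvg_cst.
  have pos : {ae mu, forall t : R, `]0, 1]%classic t -> 0 <= t * p.[t] ^+ 2}.
    by apply: aeW => s /=; rewrite in_itv/= => /andP[s0 _]; rewrite mulr_ge0 ?sqr_ge0// ltW.
  have := rint_eq0_ae (measurable_itv _) (LI_cont 0 1 cp) pos; rewrite I0 => /(_ (lexx _)).
  by apply: aeS => s h s01; apply: h; move: s01; rewrite /= !in_itv/= => /andP[-> /ltW].
have pz : p = 0.
  apply: (@roots_geq_poly_eq0 _ p [seq n.+1%:R^-1 | n <- iota 0 (size p)]).
  - apply/allP => _ /mapP[n _ ->]; rewrite /root.
    have n0 : (0 : R) < n.+1%:R^-1 by rewrite invr_gt0.
    have : n.+1%:R^-1 \in `[(0 : R), 1] by rewrite in_itv/= ltW// invf_le1// ler1n.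
    by move=> /p0/eqP; rewrite mulf_eq0 gt_eqF//= sqrf_eq0.
  - rewrite map_inj_uniq ?iota_uniq// => m n /invr_inj/eqP.
    by rewrite eqr_nat => /eqP[].
  - by rewrite size_map size_iota.
apply/rowP => i; rewrite !mxE.
have : p`_i = 0 by rewrite pz coef0.
rewrite coef_sum (bigD1 i)//= coefZ coefXn eqxx mulr1 big1 ?addr0 ?mxE//.
by move=> k ki; rewrite coefZ coefXn eq_sym (inj_eq val_inj) (negbTE ki) mulr0.
Qed.

(** Thomee's interpolant: equal to h at the right endpoint, with an error
    orthogonal to the polynomials of degree < q. With sigma = (b - t) / (b -
    a), the approximation p is corrected by multiples of sigma^(l + 1), which
    vanish at b; as the Gram matrix for the weight sigma is invertible, their
    coefficients can be chosen to cancel the moments of h - p, and they are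
    bounded by these moments. The constant is scale invariant. *)
Lemma thomee (q : nat) : exists2 Cq : R, 1 <= Cq &
  forall (V : hilbertType R) (h p : R -> V) (a b e : R) m, a < b -> (m <= q.+1)%N ->
    continuous h -> ispol m p -> p b = h b ->
    (forall t, t \in `[a, b] -> `|h t - p t| <= e) ->
  exists r, [/\ ispol q.+1 r, r b = h b,
    forall t, t \in `[a, b] -> `|h t - r t| <= Cq * e &
    forall (P : {poly R}) v, (size P <= q)%N ->
      \int[mu]_(t in `]a, b]) (P.[t] * inner (h t - r t) v) = 0].
Proof.
have [W [W1 _]] := dual_weights q.
pose S := \sum_(l < q) \sum_(k < q) `|W l k|.
have S0 : 0 <= S by apply: sumr_ge0 => l _; apply: sumr_ge0.
exists (1 + S); first by rewrite lerDl.
move=> V h p a b e m ab mq ch pp pb hp.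
have ba0 : 0 < b - a by rewrite subr_gt0.
have ban : b - a != 0 by rewrite gt_eqF.
pose sg t := (b - t) / (b - a).
have sgE t : sg t = - (b - a)^-1 * t + b / (b - a) by rewrite /sg; field.
have csg : continuous sg.
  rewrite (funext sgE) => t; apply: (@cvgD _ R^o); [apply: cvgMr; exact: cvg_id|exact: cvg_cst].
have csgn n : continuous (fun t => sg t ^+ n).
  by move=> t; apply: (@continuous_comp R R R sg (fun x => x ^+ n)); [exact: csg|exact: exprn_continuous].
have sg01 t : t \in `[a, b] -> 0 <= sg t <= 1.
  rewrite in_itv/= => /andP[at_ tb]; rewrite /sg divr_ge0 ?subr_ge0 ?(ltW ab)//=.
  by rewrite ler_pdivrMr// mul1r lerD2l lerN2.
pose D t := h t - p t.
have cD : continuous D by move=> t; apply: (@cvgB _ V); [exact: ch|exact: ispol_cont pp t].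
have fM := fin_meas_itv false false a b.
have csD n : continuous (fun t => sg t ^+ n *: D t).
  by move=> t; apply: cvgZ; [exact: csgn|exact: cD].
have LsD n : L2 `]a, b] (fun t => sg t ^+ n *: D t) by case: (L2_cont a b (csD n)).
pose mm n := (b - a)^-1 *: vint `]a, b] (fun t => sg t ^+ n *: D t).
have mmE n v : \int[mu]_(t in `]a, b]) (sg t ^+ n * inner (D t) v) = (b - a) * inner (mm n) v.
  rewrite /mm innerZl vintE// mulrA mulfV// mul1r.
  by apply: eq_Rintegral => t _; rewrite innerZl.
have e0 : 0 <= e by apply: le_trans (hp b _); rewrite ?in_itv/= ?(ltW ab) ?lexx.
have mmb n : `|mm n| <= e.
  rewrite /mm normrZ ger0_norm ?invr_ge0 ?(ltW ba0)// mulrC ler_pdivrMr//.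
  apply: le_trans (vint_norm fM (LsD n)) _.
  rewrite -rint_cst ?(ltW ab)//; apply: rint_le => //.
  - exact: LI_norm.
  - exact: LI_cst.
  apply: aeW => t /=; rewrite in_itv/= => /andP[at_ tb].
  have tab : t \in `[a, b] by rewrite in_itv/= ltW.
  have /andP[s0 s1] := sg01 t tab.
  rewrite normrZ ger0_norm ?exprn_ge0// -[leRHS]mul1r.
  by apply: ler_pM => //; [exact: exprn_ge0|exact: exprn_ile1|exact: hp].
(* mm k is the normalized k-th moment of h - p; the z l solve the moment equations *)
pose z (l : 'I_q) := \sum_(k < q) W l k *: mm k.
pose corr t := \sum_(l < q) sg t ^+ l.+1 *: z l.
exists (fun t => p t + corr t); split.
- apply: ispolD; first exact: ispol_le pp.
  apply: ispol_sum => l; rewrite (funext sgE).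
  apply: (@ispol_affine _ _ _ (fun s => s ^+ l.+1 *: z l)).
  have -> : (fun s : R => s ^+ l.+1 *: z l) = (fun s => ('X^(l.+1)).[s] *: z l).
    by apply/funext => s; rewrite hornerXn.
  by apply: ispol_horner; rewrite size_polyXn ltnS.
- rewrite pb /corr big1 ?addr0// => l _.
  by rewrite /sg subrr mul0r expr0n scale0r.
- move=> t tab; rewrite opprD addrA; apply: le_trans (ler_normB _ _) _.
  rewrite mulrDl mul1r; apply: lerD; first exact: hp.
  apply: le_trans (ler_norm_sum _ _ _) _; rewrite /S mulr_suml; apply: ler_sum => l _.
  have /andP[s0 s1] := sg01 t tab.
  rewrite normrZ ger0_norm ?exprn_ge0// -[leRHS]mul1r.
  apply: ler_pM => //; [exact: exprn_ge0|exact: exprn_ile1|].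
  apply: le_trans (ler_norm_sum _ _ _) _; rewrite mulr_suml; apply: ler_sum => k _.
  by rewrite normrZ ler_wpM2l.
move=> P v sP.
have mono (i : 'I_q) : \int[mu]_(t in `]a, b]) (sg t ^+ i * inner (h t - (p t + corr t)) v) = 0.
  transitivity (\int[mu]_(t in `]a, b]) (sg t ^+ i * inner (D t) v -
      \sum_(l < q) inner (z l) v * sg t ^+ (i + l).+1)).
    apply: eq_Rintegral => t _; rewrite opprD addrA innerBl mulrBr; congr (_ - _).
    rewrite /corr inner_suml mulr_sumr; apply: eq_bigr => l _.
    by rewrite innerZl mulrA -exprD mulrC addnS.
  have LIs n : LI `]a, b] (fun t => sg t ^+ n) by exact: LI_cont.
  have LI1 : LI `]a, b] (fun t => sg t ^+ i * inner (D t) v).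
    rewrite (_ : (fun t => _) = (fun t => inner (sg t ^+ i *: D t) v)); first exact: L2_inner.
    by apply/funext => t; rewrite innerZl.
  rewrite rintB//; last by apply: LI_sum => l; exact: LIZ.
  rewrite mmE rint_sum//; last by move=> l; exact: LIZ.
  under eq_bigr do rewrite rintZ// moment_down//.
  apply/eqP; rewrite subr_eq0; apply/eqP.
  transitivity (\sum_(k < q) (i == k)%:R * ((b - a) * inner (mm k) v)).
    rewrite (bigD1 i)//= eqxx mul1r big1 ?addr0// => k ki.
    by rewrite eq_sym (negbTE ki) mul0r.
  transitivity (\sum_(k < q) (\sum_(l < q) (i + l).+2%:R^-1 * W l k) * ((b - a) * inner (mm k) v)).
    by apply: eq_bigr => k _; rewrite W1.
  transitivity (\sum_(k < q) \sum_(l < q) (i + l).+2%:R^-1 * W l k * ((b - a) * inner (mm k) v)).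
    by apply: eq_bigr => k _; rewrite big_distrl.
  rewrite exchange_big; apply: eq_bigr => l _.
  rewrite /z inner_suml mulr_suml; apply: eq_bigr => k _.
  by rewrite innerZl; ring.
pose Q := P \Po (- (b - a) *: 'X + b%:P).
have QE t : P.[t] = Q.[sg t].
  rewrite horner_comp hornerD hornerZ hornerX hornerC; congr (P.[_]).
  by rewrite /sg; field.
have sQ : (size Q <= q)%N.
  have [q0|/prednK q'] := posnP q.
    by move: sP; rewrite /Q q0 !leqn0 !size_poly_eq0 => /eqP->; rewrite comp_poly0.
  rewrite -q' in sP *.
  apply: leq_trans (size_comp_poly_leq _ _) _; rewrite ltnS.
  have sz : (size (- (b - a) *: 'X + b%:P)%R <= 2)%N.
    apply: leq_trans (size_polyD _ _) _; rewrite geq_max.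
    by rewrite (leq_trans (size_scale_leq _ _)) ?size_polyX// (leq_trans (size_polyC_leq1 _)).
  by rewrite -[leqRHS]muln1; apply: leq_mul; rewrite -subn1 leq_subLR.
under eq_Rintegral => t _ do rewrite QE (horner_coef_wide _ sQ) mulr_suml.
have chc : continuous (fun t => h t - (p t + corr t)).
  move=> t; apply: (@cvgB _ V); first exact: ch.
  apply: (@cvgD _ V); first exact: ispol_cont pp t.
  rewrite /corr; apply: (@ispol_cont _ _ q.+1 corr).
  apply: ispol_sum => l; rewrite (funext sgE).
  apply: (@ispol_affine _ _ _ (fun s => s ^+ l.+1 *: z l)).
  have -> : (fun s : R => s ^+ l.+1 *: z l) = (fun s => ('X^(l.+1)).[s] *: z l).
    by apply/funext => s; rewrite hornerXn.
  by apply: ispol_horner; rewrite size_polyXn ltnS.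
have LIm i : LI `]a, b] (fun t => sg t ^+ i * inner (h t - (p t + corr t)) v).
  apply: LI_cont => t; apply: cvgM; first exact: csgn.
  by apply: cvg_inner; [exact: chc|exact: cvg_cst].
rewrite rint_sum//; last first.
  move=> i; rewrite (_ : (fun t => _) = (fun t => Q`_i * (sg t ^+ i * inner (h t - (p t + corr t)) v))).
    exact: LIZ.
  by apply/funext => t; rewrite mulrA.
by rewrite big1// => i _; under eq_Rintegral do rewrite -mulrA; rewrite rintZ// mono mulr0.
Qed.

End Interpolation.

(** * Continuity in H of functions in X *)

Section Trace.
Context {R : realType}.
Notation mu := (@lebesgue_measure R).

Lemma prim_within_cont (T : R) (x : R -> R) : 0 <= T -> LI `]0, T] x ->
  {within `[0, T], continuous (fun t => \int[mu]_(s in `]0, t]) x s)}.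
Proof.
move=> T0 [g ig xg].
have iS (i : interval R) : mu.-integrable [set` i] (EFin \o g) :=
  @integrableS _ _ _ mu _ _ _ measurableT (measurable_itv i) (fun _ _ => I) ig.
have := parameterized_integral_continuous T0 (iS `[0, T]).
apply: subspace_eq_continuous => t tT.
rewrite /from_subspace /parameterized_integral -Rintegral_itv_obnd_cbnd//.
apply: rint_ae; apply: aeS _ xg => s h st; rewrite h//.
move: tT st; rewrite inE /= !in_itv/= => /andP[_ tT] /andP[-> st].
exact: le_trans st tT.
Qed.

(** Here v_ k and y_ k stand for the values of u and of its H-mass at points
    s_k approaching an endpoint, where s_k lies in an interval of length of
    order l / 2^k, and Y_ k stands for the integral of |u|^2 + |du|^2 over the
    remaining part. The values of u in V may blow up like 2^(k/2), but in H
    they converge. *)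
Section Chain.
Context {V H : hilbertType R} (iota : blin V H).
Variables (l : R) (v_ y_ : nat -> V) (Y_ : nat -> R) (y : V).
Hypothesis l0 : 0 < l.
Hypothesis vy : forall k z, inner (iota (v_ k)) (iota z) = inner (y_ k) z.
Hypothesis Y0 : forall k, 0 <= Y_ k.
Hypothesis Ynon : forall k, Y_ k.+1 <= Y_ k.
Hypothesis A1 : forall k, l / 2 ^+ k * `|v_ k| ^+ 2 <= 2 * (Y_ k - Y_ k.+1).
Hypothesis A2 : forall k, `|y_ k.+1 - y_ k| ^+ 2 <= l / 2 ^+ k * (Y_ k - Y_ k.+2).

(** The increment of |v_i - v_n|^2 in H is the pairing of y_(k+1) - y_k with
    v_(k+1) + v_k - 2 v_n. Young's inequality with weight l / 2^k absorbs the
    growth of the first two terms into telescoping differences of Y_ and that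
    of the fixed term into a geometric series. *)
Lemma chain_step n i : `|iota (v_ (n + i)%N) - iota (v_ n)| ^+ 2 <=
  5 * (Y_ n + Y_ n.+1 - Y_ (n + i)%N - Y_ (n + i).+1) + 4 * (1 - 2^-1 ^+ i) * Y_ n.
Proof.
elim: i => [|i IH].
  by rewrite addn0 subrr normr0 expr0n /= expr0; have := Y0 n; have := Y0 n.+1; lra.
rewrite addnS; set k := (n + i)%N in IH *.
set lk := l / 2 ^+ k.
have lk0 : 0 < lk by rewrite divr_gt0 ?exprn_gt0.
have e1 : `|iota (v_ k.+1) - iota (v_ n)| ^+ 2 - `|iota (v_ k) - iota (v_ n)| ^+ 2 =
    inner (y_ k.+1 - y_ k) (v_ k.+1 + v_ k - 2 *: v_ n).
  rewrite innerBl -!vy.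
  have -> : iota (v_ k.+1 + v_ k - 2 *: v_ n) = iota (v_ k.+1) + iota (v_ k) - 2 *: iota (v_ n).
    by rewrite linearB linearD linearZ.
  move: (iota (v_ k.+1)) (iota (v_ k)) (iota (v_ n)) => a1 a0 an.
  rewrite !normB_sqr !(innerBr, innerDr, innerZr) !innerxx (innerC a1 a0); ring.
have e2 : inner (y_ k.+1 - y_ k) (v_ k.+1 + v_ k - 2 *: v_ n) <=
    `|y_ k.+1 - y_ k| * (`|v_ k.+1| + `|v_ k| + 2 * `|v_ n|).
  apply: le_trans (ler_norm _) _; apply: le_trans (inner_CS _ _) _.
  apply: ler_wpM2l => //; apply: le_trans (ler_normB _ _) _.
  rewrite normrZ ger0_norm//; apply: lerD => //; exact: ler_normD.
have a1 := A1 k; have a1' := A1 k.+1; have a2 := A2 k; have an := A1 n.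
rewrite -/lk in a1 a2.
have lkS : l / 2 ^+ k.+1 = lk / 2 by rewrite /lk exprS; field; rewrite expf_neq0.
have lkn : l / 2 ^+ n = lk * 2 ^+ i by rewrite /lk /k exprD; field; rewrite !expf_neq0.
rewrite lkS in a1'; rewrite lkn in an.
set D := `|y_ k.+1 - y_ k| in e2 a2 *.
set m1 := `|v_ k.+1| in e2 a1' *; set m0 := `|v_ k| in e2 a1 *; set mn := `|v_ n| in e2 an *.
have young a b : lk > 0 -> a * b <= (a ^+ 2 / lk + lk * b ^+ 2) / 2.
  move=> _; have := sqr_ge0 (a - lk * b) => h.
  have : 0 <= (a - lk * b) ^+ 2 / lk by rewrite divr_ge0// ltW.
  rewrite (_ : (a - lk * b) ^+ 2 / lk = a ^+ 2 / lk + lk * b ^+ 2 - 2 * (a * b)); first lra.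
  by field; rewrite gt_eqF.
have aD : D ^+ 2 / lk <= Y_ k - Y_ k.+2 by rewrite ler_pdivrMr// mulrC.
have y1 := young D m1 lk0; have y2 := young D m0 lk0; have y3 := young D mn lk0.
have h2 : (0 : R) < 2^-1 ^+ i by rewrite exprn_gt0.
have an' : lk * mn ^+ 2 <= 2 * (2^-1 ^+ i * Y_ n).
  have -> : lk * mn ^+ 2 = 2^-1 ^+ i * (lk * 2 ^+ i * mn ^+ 2).
    by rewrite exprVn; field; rewrite expf_neq0.
  rewrite [leRHS]mulrCA ler_pM2l//; apply: le_trans an _.
  by have := Y0 n.+1; lra.
have hS : 2^-1 ^+ i.+1 = 2^-1 * 2^-1 ^+ i :> R by rewrite exprS.
rewrite hS; set X := 2^-1 ^+ i in IH an' h2 *.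
have := Ynon k; have := Ynon k.+1.
move: e1 IH; set d1 := `|_| ^+ 2; set d0 := `|_| ^+ 2; set P := X * Y_ n in an' *.
have -> : 4 * (1 - X) * Y_ n = 4 * Y_ n - 4 * P by rewrite /P; ring.
have -> : 4 * (1 - 2^-1 * X) * Y_ n = 4 * Y_ n - 2 * P by rewrite /P; field.
move: y1 y2 y3 aD an' a1 a1' e2.
move: (D ^+ 2 / lk) (lk * mn ^+ 2) (lk * m0 ^+ 2) => x1 x2 x3.
have -> : lk / 2 * m1 ^+ 2 = (lk * m1 ^+ 2) / 2 by field.
move: (lk * m1 ^+ 2) => x4.
have -> : D * (m1 + m0 + 2 * mn) = D * m1 + D * m0 + 2 * (D * mn) by ring.
move: (D * m1) (D * m0) (D * mn) (inner _ _) => x5 x6 x7 x8; lra.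
Qed.

Lemma chain_bound n i : `|iota (v_ (n + i)%N) - iota (v_ n)| ^+ 2 <= 14 * Y_ n.
Proof.
apply: le_trans (chain_step n i) _.
have h2 : (0 : R) <= 2^-1 ^+ i * Y_ n by rewrite mulr_ge0 ?exprn_ge0.
(* 5 (Y_n + Y_(n+1)) + 4 Y_n <= 14 Y_n *)
have := Y0 n; have := Ynon n; have := Y0 (n + i)%N; have := Y0 (n + i).+1; nra.
Qed.

Hypothesis Yl : Y_ @ \oo --> 0.
Hypothesis yl : y_ @ \oo --> y.

(** The sequence converges in H by [chain_bound], and its limit pairs with V
    as y does. *)
Lemma chain_limit : exists h : H, (forall z, inner h (iota z) = inner y z) /\
  `|h - iota (v_ 0%N)| ^+ 2 <= 14 * Y_ 0%N.
Proof.
have [h hl] : exists h : H, (fun k => iota (v_ k)) @ \oo --> h.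
  apply: cauchy_seq => e e0.
  have /(@cvgrPdist_lt _ R^o)/(_ (e ^+ 2 / 15)) := Yl.
  have e20 : 0 < e ^+ 2 / 15 by rewrite divr_gt0// exprn_gt0.
  move=> /(_ e20)[N _ hN]; exists N => n Nn.
  rewrite -ltr_sqr ?nnegrE ?normr_ge0 ?(ltW e0)// distrC -(subnKC Nn).
  apply: le_lt_trans (chain_bound _ _) _.
  have := hN N (leqnn N); rewrite /= sub0r normrN ger0_norm//.
  rewrite ltr_pdivlMr//; have := exprn_gt0 2 e0; lra.
exists h; split=> [z|].
  have c1 : inner (iota (v_ k)) (iota z) @[k --> \oo] --> inner h (iota z).
    by apply: cvg_inner => //; exact: cvg_cst.
  have c2 : inner (iota (v_ k)) (iota z) @[k --> \oo] --> inner y z.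
    by under eq_fun do rewrite vy; apply: cvg_inner => //; exact: cvg_cst.
  exact: cvg_unique c1 c2.
have c : `|iota (v_ k) - iota (v_ 0%N)| ^+ 2 @[k --> \oo] --> `|h - iota (v_ 0%N)| ^+ 2.
  have c0 : `|iota (v_ k) - iota (v_ 0%N)| @[k --> \oo] --> `|h - iota (v_ 0%N)|.
    by apply: cvg_norm; apply: (@cvgB _ H) => //; exact: cvg_cst.
  by under eq_fun do rewrite expr2; rewrite expr2; apply: cvgM.
apply: ler_cvg_to c (@cvg_cst _ _ _ _ _) _.
by apply: nearW => k; exact: (chain_bound 0 k).
Qed.

End Chain.

Lemma dense_inner0 (V H : hilbertType R) (iota : blin V H) (h : H) :
  dense (range iota) -> (forall v, inner h (iota v) = 0) -> h = 0.
Proof.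
move=> di h0; apply/eqP; rewrite -normr_le0; apply/ler_addgt0Pl => e e0; rewrite addr0.
have [_ [] /[swap] [[v _ <-]]] := di (ball h e) (ex_intro _ h (ballxx _ e0)) (ball_open h e).
rewrite -ball_normE /= => hv.
have [->|hn] := eqVneq h 0; first by rewrite normr0 ltW.
have nh : 0 < `|h| by rewrite normr_gt0.
rewrite -(ler_pM2l nh) -expr2 -innerxx.
have -> : inner h h = inner h (h - iota v) by rewrite innerBr h0 subr0.
apply: le_trans (ler_norm _) _; apply: le_trans (inner_CS _ _) _.
by rewrite ler_pM2l// ltW.
Qed.

Section Representative.
Context {V H : hilbertType R} (iota : blin V H).
Variable T : R.
Hypothesis T0 : 0 < T.
Variables (u g U : R -> V).
Hypothesis lu : L2 `]0, T] u.
Hypothesis lg : L2 `]0, T] g.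
Hypothesis cU : continuous U.
Hypothesis UE : forall s t, 0 <= s -> s <= t -> t <= T -> U t - U s = vint `]s, t] g.

(** The points where the V-valued u agrees with the continuous function U,
    which represents its H-mass. *)
Definition good (t : R) := forall z, inner (iota (u t)) (iota z) = inner (U t) z.

Hypothesis goodae : {ae mu, forall t, `]0, T]%classic t -> good t}.

Let xx t := `|u t| ^+ 2 + `|g t| ^+ 2.
Let X a b := \int[mu]_(t in `]a, b]) xx t.

Let Lu a b : 0 <= a -> b <= T -> LI `]a, b] (fun t => `|u t| ^+ 2).
Proof. by move=> a0 bT; have [_ l] := lu; apply: LI_sub l; exact: sub_oc. Qed.

Let Lg a b : 0 <= a -> b <= T -> LI `]a, b] (fun t => `|g t| ^+ 2).
Proof. by move=> a0 bT; have [_ l] := lg; apply: LI_sub l; exact: sub_oc. Qed.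

Let Lx a b : 0 <= a -> b <= T -> LI `]a, b] xx.
Proof. by move=> a0 bT; apply: LID; [exact: Lu|exact: Lg]. Qed.

Let xx0 t : 0 <= xx t. Proof. by rewrite addr_ge0 ?sqr_ge0. Qed.

Let uX a b : 0 <= a -> b <= T -> \int[mu]_(t in `]a, b]) (`|u t| ^+ 2) <= X a b.
Proof.
move=> a0 bT; apply: rint_le => //; [exact: Lu|exact: Lx|].
by apply: aeW => t _; rewrite lerDl sqr_ge0.
Qed.

Let gX a b : 0 <= a -> b <= T -> \int[mu]_(t in `]a, b]) (`|g t| ^+ 2) <= X a b.
Proof.
move=> a0 bT; apply: rint_le => //; [exact: Lg|exact: Lx|].
by apply: aeW => t _; rewrite lerDr sqr_ge0.
Qed.

Let Xsplit a b c : 0 <= a -> a <= b -> b <= c -> c <= T -> X a c = X a b + X b c.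
Proof. by move=> a0 ab bc cT; apply: rint_split => //; exact: Lx. Qed.

Let X0 a b : 0 <= X a b. Proof. by apply: rint_ge0 => //; apply: aeW. Qed.

(** Some point does not exceed the mean value. *)
Lemma pick_good c d : 0 <= c -> c < d -> d <= T ->
  exists s, [/\ c < s, s < d, good s & (d - c) * `|u s| ^+ 2 <= \int[mu]_(t in `]c, d]) (`|u t| ^+ 2)].
Proof.
move=> c0 cd dT; apply: contrapT => h.
pose J := \int[mu]_(t in `]c, d]) (`|u t| ^+ 2).
pose f t := (d - c) * `|u t| ^+ 2 - J.
have Lu' := Lu c0 dT.
have gcd : {ae mu, forall t, `]c, d]%classic t -> good t}.
  by apply: aeS _ goodae => t Hg tcd; apply: Hg; apply: sub_oc tcd.
have Lf : LI `]c, d] f by apply: LIB; [exact: LIZ|exact: (LI_cst _ (fin_meas_itv _ _ _ _))].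
have fpos t : c < t -> t < d -> good t -> 0 < f t.
  move=> ct td gt; rewrite subr_gt0 ltNge; apply/negP => le; apply: h.
  by exists t.
have f0 : {ae mu, forall t, `]c, d]%classic t -> 0 <= f t}.
  apply: ae_oo_oc; apply: aeS _ gcd => t Hg tcd.
  move: (tcd); rewrite /= in_itv/= => /andP[ct td].
  by apply: ltW; apply: fpos => //; apply: Hg; rewrite /= in_itv/= ct ltW.
have If : \int[mu]_(t in `]c, d]) f t <= 0.
  rewrite rintB//; [|exact: LIZ|exact: (LI_cst _ (fin_meas_itv _ _ _ _))].
  by rewrite rintZ// rint_cst ?(ltW cd)// -/J (mulrC J) subrr.
have fz := rint_eq0_ae (measurable_itv _) Lf f0 If.
have fz' : {ae mu, forall t, `]c, d[%classic t -> f t = 0 /\ good t}.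
  apply: aeS2 _ fz gcd => t h1 h2; rewrite /= in_itv/= => /andP[ct td].
  by split; [apply: h1|apply: h2]; rewrite /= in_itv/= ct ltW.
have [t tcd [ft gt]] := ae_dense cd fz' (@subset_refl _ _).
move: tcd; rewrite /= in_itv/= => /andP[ct td].
by have := fpos t ct td gt; rewrite ft ltxx.
Qed.

Lemma U_holder c d s s' : 0 <= c -> d <= T -> c <= s -> s <= d -> c <= s' -> s' <= d ->
  `|U s - U s'| ^+ 2 <= (d - c) * X c d.
Proof.
move=> c0 dT.
wlog ss : s s' / s' <= s.
  move=> Hw h1 h2 h3 h4; have [/Hw|/ltW /Hw] := leP s' s; first exact.
  by rewrite distrC; exact.
move=> cs sd cs' sd'.
have s'0 := le_trans c0 cs'; have sT := le_trans sd dT.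
have lgs : L2 `]s', s] g by apply: L2_sub lg; exact: sub_oc.
rewrite (UE s'0 ss sT); apply: le_trans (vint_norm_sqr ss lgs) _.
apply: ler_pM; rewrite ?subr_ge0//.
- by apply: rint_ge0 => //; apply: aeW => t _; exact: sqr_ge0.
- by lra.
apply: le_trans (gX c0 dT); apply: rint_subset => //; last exact: Lg.
Qed.

(** The square in question is the pairing of U s - U s' with u s - u s', to
    which Young's inequality with weight l applies. *)
Lemma good_dist s s' l Z : good s -> good s' -> 0 < l -> `|U s - U s'| ^+ 2 <= l * Z ->
  `|iota (u s) - iota (u s')| ^+ 2 <= (Z + 2 * (l * `|u s| ^+ 2) + 2 * (l * `|u s'| ^+ 2)) / 2.
Proof.
move=> gs gs' l0 UZ.
have -> : `|iota (u s) - iota (u s')| ^+ 2 = inner (U s - U s') (u s - u s').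
  set d := u s - u s'.
  have ed : iota (u s) - iota (u s') = iota d by rewrite linearB.
  transitivity (inner (iota (u s) - iota (u s')) (iota d)); first by rewrite ed innerxx.
  by rewrite !innerBl (gs d) (gs' d).
apply: le_trans (ler_norm _) _; apply: le_trans (inner_CS _ _) _.
have := norm_sqrD_le (u s) (- u s'); rewrite normrN.
move: UZ; set a := `|U s - U s'|; set b := `|u s - u s'|; set p := `|u s| ^+ 2; set q := `|u s'| ^+ 2.
move=> UZ bpq.
have aZ : a ^+ 2 / l <= Z by rewrite ler_pdivrMr// mulrC.
have : 0 <= (a - l * b) ^+ 2 / l by rewrite divr_ge0 ?sqr_ge0// ltW.
rewrite (_ : (a - l * b) ^+ 2 / l = a ^+ 2 / l + l * b ^+ 2 - 2 * (a * b)); last first.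
  by field; rewrite gt_eqF.
have : l * b ^+ 2 <= l * (2 * p + 2 * q) by rewrite ler_pM2l.
lra.
Qed.

(** Instance of the chain for intervals ]c k, d k] of length l / 2^(k+1)
    shrinking to e: s_k is a good point of the k-th one, and ]c' k, d' k]
    contains two consecutive ones. *)
Lemma chain_itv (l e : R) (c d c' d' Y : nat -> R) : 0 < l ->
  (forall k, [/\ 0 <= c k, d k <= T & d k - c k = l / 2 ^+ k.+1]) ->
  (forall k, X (c k) (d k) <= Y k - Y k.+1) ->
  (forall k, [/\ 0 <= c' k, d' k <= T, d' k - c' k <= l / 2 ^+ k &
     [/\ c' k <= c k, d k <= d' k, c' k <= c k.+1 & d k.+1 <= d' k]]) ->
  (forall k, X (c' k) (d' k) <= Y k - Y k.+2) ->
  (forall k, 0 <= Y k) -> Y @ \oo --> 0 -> c @ \oo --> e -> d @ \oo --> e ->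
  exists s h, [/\ c 0%N < s < d 0%N, good s,
    (d 0%N - c 0%N) * `|u s| ^+ 2 <= X (c 0%N) (d 0%N),
    (forall z, inner h (iota z) = inner (U e) z) & `|h - iota (u s)| ^+ 2 <= 14 * Y 0%N].
Proof.
move=> l0 cd XY cd' XY' Y0 Yl ce de.
have lk k : 0 < l / 2 ^+ k by rewrite divr_gt0 ?exprn_gt0.
have ltcd k : c k < d k by have [_ _ e1] := cd k; rewrite -subr_gt0 e1.
have ex k : exists s, [/\ c k < s, s < d k, good s &
    (d k - c k) * `|u s| ^+ 2 <= \int[mu]_(t in `]c k, d k]) (`|u t| ^+ 2)].
  by have [c0 dT _] := cd k; exact: pick_good.
have [s_ hs] := choice ex.
have sX k : (d k - c k) * `|u (s_ k)| ^+ 2 <= X (c k) (d k).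
  by have [_ _ _ h] := hs k; have [c0 dT _] := cd k; apply: le_trans h (uX c0 dT).
have gs k : good (s_ k) by have [] := hs k.
have se : s_ @ \oo --> e.
  apply: (@squeeze_cvgr _ _ _ _ c d) => //.
  by apply: nearW => k; have [h1 h2 _ _] := hs k; rewrite !ltW.
have Us : U (s_ k) @[k --> \oo] --> U e by apply: continuous_cvg => //; exact: cU.
have Ynon k : Y k.+1 <= Y k by rewrite -subr_ge0; apply: le_trans (XY k).
have A1 k : l / 2 ^+ k * `|u (s_ k)| ^+ 2 <= 2 * (Y k - Y k.+1).
  have := le_trans (sX k) (XY k); have [_ _ ->] := cd k; rewrite exprS => h.
  rewrite -[leLHS](_ : 2 * (l / (2 * 2 ^+ k) * `|u (s_ k)| ^+ 2) = _).
    by rewrite ler_pM2l.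
  by field; rewrite expf_neq0.
have A2 k : `|U (s_ k.+1) - U (s_ k)| ^+ 2 <= l / 2 ^+ k * (Y k - Y k.+2).
  have [c0 dT dc [h1 h2 h3 h4]] := cd' k.
  have [a1 a2 _ _] := hs k; have [b1 b2 _ _] := hs k.+1.
  apply: le_trans (U_holder c0 dT _ _ _ _) _.
  - exact: le_trans h3 (ltW b1).
  - exact: le_trans (ltW b2) h4.
  - exact: le_trans h1 (ltW a1).
  - exact: le_trans (ltW a2) h2.
  apply: ler_pM; [|exact: X0|exact: dc|exact: XY'].
  by rewrite subr_ge0; apply: le_trans h1 _; apply: le_trans h2; rewrite ltW.
have [h [h1 h2]] := chain_limit l0 (fun k z => gs k z) Y0 Ynon A1 A2 Yl Us.
exists (s_ 0%N), h; split => //.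
by have [a1 a2 _ _] := hs 0%N; rewrite a1 a2.
Qed.

Let F t := X 0 (clamp T t).

Lemma F_cont : continuous F.
Proof.
have T0' := ltW T0.
have := prim_within_cont T0' (Lx (lexx 0) (lexx T)).
move/subspace_continuousP => cF t.
have cc : continuous (clamp T).
  move=> r; apply/(@cvgrPdist_lt _ R^o) => e e0; near=> s.
  have := clamp_lip T r s => h; apply: le_lt_trans h _.
  by near: s; apply: cvgr_dist_lt.
have cw : clamp T s @[s --> t] --> within `[0, T] (nbhs (clamp T t)).
  move=> Q hQ; change (\forall s \near t, Q (clamp T s)).
  have hQ' : nbhs (clamp T t) [set s | s \in `[0, T] -> Q s] by exact: hQ.
  have : \forall s \near t, clamp T s \in `[0, T] -> Q (clamp T s) by exact: (cc t _ hQ').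
  by apply: filterS => s; apply; rewrite in_itv/=; exact: clamp_itv.
have ct : `[0, T]%classic (clamp T t) by rewrite /= in_itv/=; exact: clamp_itv.
exact: cvg_comp cw (cF _ ct).
Unshelve. all: end_near. Qed.

Let XF a b : 0 <= a -> a <= b -> b <= T -> X a b = F b - F a.
Proof.
move=> a0 ab bT; have b0 := le_trans a0 ab; have aT := le_trans ab bT.
by rewrite /F !clampE// (@Xsplit 0 a b)// addrC addKr.
Qed.

Lemma end_right a b : 0 <= a -> a < b -> b <= T -> exists s h, [/\ a < s < b, good s,
  (b - a) * `|u s| ^+ 2 <= 2 * X a b,
  (forall z, inner h (iota z) = inner (U b) z) & `|h - iota (u s)| ^+ 2 <= 14 * X a b].
Proof.
move=> a0 ab bT; pose l := b - a.
have l0 : 0 < l by rewrite subr_gt0.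
have pk k : (0 : R) < l / 2 ^+ k by rewrite divr_gt0 ?exprn_gt0.
have pS k : l / 2 ^+ k.+1 = l / 2 ^+ k / 2 by rewrite exprS; field; rewrite expf_neq0.
have pl k : l / 2 ^+ k <= l.
  by rewrite ler_pdivrMr ?exprn_gt0// ler_peMr ?(ltW l0)// exprn_ege1// ler1n.
pose c k := b - l / 2 ^+ k.
have cB k : 0 <= c k by have := pl k; rewrite /c /l; lra.
have cb k : c k < b by have := pk k; rewrite /c; lra.
have cS k : c k <= c k.+1 by have := pk k; rewrite /c pS; lra.
have cl : c @ \oo --> b.
  rewrite -[X in _ --> X]subr0; apply: (@cvgB _ R^o); first exact: cvg_cst.
  rewrite -[X in _ --> X](mulr0 l); apply: cvgMr; under eq_fun do rewrite -exprVn; apply: cvg_expr.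
  by rewrite ger0_norm ?invf_lt1// ?ltr1n.
pose Y k := X (c k) b.
have Ye k m : c k <= c m -> X (c k) (c m) = Y k - Y m.
  move=> ckm; rewrite /Y (@Xsplit (c k) (c m) b)// ?addrK//; exact: ltW.
have [|k|k|k|k||||s [h [h1 h2 h3 h4 h5]]] :=
  @chain_itv l b c (fun k => c k.+1) c (fun k => c k.+2) Y l0.
- by move=> k; split => //; [exact: le_trans (ltW (cb _)) bT|rewrite /c pS; field; rewrite expf_neq0].
- by rewrite Ye.
- split; [exact: cB|exact: le_trans (ltW (cb _)) bT| |].
    by rewrite /c !pS; have := pk k; lra.
  by split; [exact: lexx|exact: cS|exact: cS|exact: lexx].
- by rewrite Ye//; apply: le_trans (cS _) (cS _).
- exact: X0.
- rewrite (_ : Y = (fun k => F b - F (c k))).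
    rewrite -[X in _ --> X](subrr (F b)); apply: (@cvgB _ R^o); first exact: cvg_cst.
    by apply: continuous_cvg => //; exact: F_cont.
  by apply/funext => k; rewrite /Y XF//; exact: ltW.
- exact: cl.
- by rewrite (_ : (fun k => c k.+1) = (fun k => c (k + 1)%N)); [rewrite cvg_shiftn|apply/funext => k; rewrite addn1].
have c0 : c 0%N = a by rewrite /c expr0 divr1 /l; lra.
have c1 : c 1%N = b - l / 2 by rewrite /c expr1.
exists s, h; move: h1 h3 h5; rewrite c0 => /andP[as_ sc] h3 h5; split => //.
- by rewrite as_ (lt_trans sc).
- have : X a (c 1%N) <= X a b.
    rewrite (@Xsplit a (c 1%N) b)// ?lerDl//; first by rewrite -c0.
    exact: ltW.
  by move: h3; rewrite c1 /l; set Z := `|u s| ^+ 2; nra.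
- by rewrite /Y c0 in h5.
Qed.

Lemma end_left a b : 0 <= a -> a < b -> b <= T -> exists s h, [/\ a < s < b, good s,
  (b - a) * `|u s| ^+ 2 <= 2 * X a b,
  (forall z, inner h (iota z) = inner (U a) z) & `|h - iota (u s)| ^+ 2 <= 14 * X a b].
Proof.
move=> a0 ab bT; pose l := b - a.
have l0 : 0 < l by rewrite subr_gt0.
have pk k : (0 : R) < l / 2 ^+ k by rewrite divr_gt0 ?exprn_gt0.
have pS k : l / 2 ^+ k.+1 = l / 2 ^+ k / 2 by rewrite exprS; field; rewrite expf_neq0.
have pl k : l / 2 ^+ k <= l.
  by rewrite ler_pdivrMr ?exprn_gt0// ler_peMr ?(ltW l0)// exprn_ege1// ler1n.
pose c k := a + l / 2 ^+ k.
have cB k : c k <= T by have := pl k; rewrite /c /l; lra.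
have ca k : a < c k by have := pk k; rewrite /c; lra.
have c0' k : 0 <= c k by apply: le_trans a0 _; rewrite ltW.
have cS k : c k.+1 <= c k by have := pk k; rewrite /c pS; lra.
have cl : c @ \oo --> a.
  rewrite -[X in _ --> X]addr0; apply: (@cvgD _ R^o); first exact: cvg_cst.
  rewrite -[X in _ --> X](mulr0 l); apply: cvgMr; under eq_fun do rewrite -exprVn; apply: cvg_expr.
  by rewrite ger0_norm ?invf_lt1// ?ltr1n.
pose Y k := X a (c k).
have Ye k m : c m <= c k -> X (c m) (c k) = Y k - Y m.
  move=> ckm; rewrite /Y (@Xsplit a (c m) (c k))// ?(addrC (X a (c m))) ?addrK//; exact: ltW.
have [|k|k|k|k||||s [h [h1 h2 h3 h4 h5]]] :=
  @chain_itv l a (fun k => c k.+1) c (fun k => c k.+2) c Y l0.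
- by move=> k; split => //; rewrite /c pS; field; rewrite expf_neq0.
- by rewrite Ye.
- split; [exact: c0'|exact: cB| |].
    by rewrite /c !pS; have := pk k; lra.
  by split; [exact: cS|exact: lexx|exact: lexx|exact: cS].
- by rewrite Ye//; apply: le_trans (cS _) (cS _).
- exact: X0.
- rewrite (_ : Y = (fun k => F (c k) - F a)).
    rewrite -[X in _ --> X](subrr (F a)); apply: (@cvgB _ R^o); last exact: cvg_cst.
    by apply: continuous_cvg => //; exact: F_cont.
  by apply/funext => k; rewrite /Y XF//; exact: ltW.
- by rewrite (_ : (fun k => c k.+1) = (fun k => c (k + 1)%N)); [rewrite cvg_shiftn|apply/funext => k; rewrite addn1].
- exact: cl.
have c0 : c 0%N = b by rewrite /c expr0 divr1 /l; lra.
have c1 : c 1%N = a + l / 2 by rewrite /c expr1.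
exists s, h; move: h1 h3 h5; rewrite c0 => /andP[as_ sc] h3 h5; split => //.
- by rewrite sc andbT (lt_trans _ as_).
- have : X (c 1%N) b <= X a b.
    rewrite (@Xsplit a (c 1%N) b)// ?lerDr//; first exact: ltW.
    by rewrite -c0.
  by move: h3; rewrite c1 /l; set Z := `|u s| ^+ 2; nra.
- by rewrite /Y c0 in h5.
Qed.

Hypothesis di : dense (range iota).

(** Chains ending at t give the value in H at t, hence the characterization by
    U. Applied at both ends of an interval they also bound the oscillation of
    this function by the integral of |u|^2 + |du|^2, which gives continuity. *)
Lemma rep_exists : exists ub : R -> H, [/\ continuous ub,
  (forall t, t \in `[0, T] -> forall z, inner (ub t) (iota z) = inner (U t) z) &
  (forall a b, 0 <= a -> a < b -> b <= T -> exists s,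
     (b - a) * `|u s| ^+ 2 <= 2 * X a b /\ `|ub b - iota (u s)| ^+ 2 <= 14 * X a b)].
Proof.
have uniq h h' : (forall z, inner h (iota z) = inner h' (iota z)) -> h = h'.
  move=> e; apply/eqP; rewrite -subr_eq0; apply/eqP; apply: (dense_inner0 di) => z.
  by rewrite innerBl e subrr.
have exub t : exists h : H, forall z, inner h (iota z) = inner (U (clamp T t)) z.
  have /andP[t0 tT] := clamp_itv T0 t.
  move: t0; rewrite le_eqVlt => /predU1P[<-|t0].
    by have [s [h [_ _ _ h4 _]]] := end_left (lexx 0) T0 (lexx T); exists h.
  by have [s [h [_ _ _ h4 _]]] := end_right (lexx 0) t0 tT; exists h.
have [ub hub] := choice exub.
have ubE t : t \in `[0, T] -> forall z, inner (ub t) (iota z) = inner (U t) z.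
  by rewrite in_itv/= => /andP[t0 tT] z; rewrite hub clampE.
have ubR a b : 0 <= a -> a < b -> b <= T -> exists s,
     [/\ good s, a < s < b, (b - a) * `|u s| ^+ 2 <= 2 * X a b & `|ub b - iota (u s)| ^+ 2 <= 14 * X a b].
  move=> a0 ab bT; have [s [h [h1 h2 h3 h4 h5]]] := end_right a0 ab bT; exists s.
  suff -> : ub b = h by [].
  by apply: uniq => z; rewrite h4 ubE// in_itv/= bT andbT (le_trans a0)// ltW.
have ubL a b : 0 <= a -> a < b -> b <= T -> exists s,
     [/\ good s, a < s < b, (b - a) * `|u s| ^+ 2 <= 2 * X a b & `|ub a - iota (u s)| ^+ 2 <= 14 * X a b].
  move=> a0 ab bT; have [s [h [h1 h2 h3 h4 h5]]] := end_left a0 ab bT; exists s.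
  suff -> : ub a = h by [].
  by apply: uniq => z; rewrite h4 ubE// in_itv/= a0/=; apply: le_trans bT; rewrite ltW.
(* two chains and the distance of their first points: 28 + 18 + 56 <= 110 *)
have ubX a b : 0 <= a -> a <= b -> b <= T -> `|ub b - ub a| ^+ 2 <= 110 * X a b.
  move=> a0; rewrite le_eqVlt => /predU1P[->|ab] bT.
    by rewrite subrr normr0 expr0n mulr_ge0.
  have [s [gs /andP[as_ sb] us1 us2]] := ubR a b a0 ab bT.
  have [s' [gs' /andP[as' sb'] us1' us2']] := ubL a b a0 ab bT.
  have l0 : 0 < b - a by rewrite subr_gt0.
  have Ul := U_holder a0 bT (ltW as_) (ltW sb) (ltW as') (ltW sb').
  have d1 := good_dist gs gs' l0 Ul.
  have e1 : ub b - ub a = (ub b - iota (u s)) + ((iota (u s) - iota (u s')) + (iota (u s') - ub a)).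
    by rewrite !addrA subrK subrK.
  have n1 := norm_sqrD_le (ub b - iota (u s)) ((iota (u s) - iota (u s')) + (iota (u s') - ub a)).
  have n2 := norm_sqrD_le (iota (u s) - iota (u s')) (iota (u s') - ub a).
  rewrite -e1 in n1; rewrite (distrC (iota (u s'))) in n2.
  have := X0 a b; lra.
exists ub; split => //; last by move=> a b a0 ab bT; have [s [_ _ h1 h2]] := ubR a b a0 ab bT; exists s.
have ubc t : ub (clamp T t) = ub t.
  by apply: uniq => z; rewrite !hub; have /andP[t0 tT] := clamp_itv T0 t; rewrite (clampE t0 tT).
have Fc t : F (clamp T t) = F t.
  by rewrite /F; have /andP[t0 tT] := clamp_itv T0 t; rewrite (clampE t0 tT).
have ubF s t : `|ub t - ub s| ^+ 2 <= 110 * `|F t - F s|.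
  wlog st : s t / clamp T s <= clamp T t.
    move=> Hw; have [/Hw//|/ltW /Hw] := leP (clamp T s) (clamp T t).
    by rewrite (distrC (ub s)) (distrC (F s)).
  have /andP[s0 sT] := clamp_itv T0 s; have /andP[t0 tT] := clamp_itv T0 t.
  rewrite -(ubc t) -(ubc s); apply: le_trans (ubX _ _ s0 st tT) _.
  by rewrite ler_pM2l// XF// !Fc ler_norm.
move=> t; apply/(@cvgrPdist_lt _ H) => e e0; near=> s.
rewrite -ltr_sqr ?nnegrE ?normr_ge0 ?(ltW e0)//.
apply: le_lt_trans (ubF _ _) _.
rewrite mulrC -ltr_pdivlMr//.
by near: s; apply: (@cvgr_dist_lt _ R^o); [exact: F_cont|rewrite divr_gt0// exprn_gt0].
Unshelve. all: end_near. Qed.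

End Representative.
End Trace.

(** * The time-dependent form *)

Section EllipticFamily.
Context {R : realType} {V : hilbertType R}.
Notation mu := (@lebesgue_measure R).
Variables (T M alpha : R) (A : R -> V -> V^dual).
Hypothesis (M0 : 0 < M) (EA : elliptic_family T M alpha A).

Lemma form_lin : {ae mu, forall t, t \in `]0, T[ -> linear (A t)}.
Proof. by case: EA. Qed.

Lemma form_le : {ae mu, forall t, t \in `]0, T[ -> forall w v, `|A t w v| <= M * `|w| * `|v|}.
Proof. by case: EA. Qed.

Lemma form_cvg t (w_ v_ : nat -> V) w v : linear (A t) ->
  (forall w v, `|A t w v| <= M * `|w| * `|v|) -> w_ @ \oo --> w -> v_ @ \oo --> v ->
  A t (w_ n) (v_ n) @[n --> \oo] --> A t w v.
Proof.
move=> lA bA cw cv.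
have nw : `|w_ n - w| @[n --> \oo] --> (0 : R).
  rewrite -(@normr0 _ V) -(subrr w); apply: cvg_norm; apply: (@cvgB _ V) => //.
  exact: cvg_cst.
have nv : `|v_ n - v| @[n --> \oo] --> (0 : R).
  rewrite -(@normr0 _ V) -(subrr v); apply: cvg_norm; apply: (@cvgB _ V) => //.
  exact: cvg_cst.
have nvn := cvg_norm cv.
apply/(@cvgrPdist_le _ R^o) => e e0.
have lim0 : M * `|w_ n - w| * `|v_ n| + M * `|w| * `|v_ n - v| @[n --> \oo] --> (0 : R).
  have -> : (0 : R) = M * 0 * `|v| + M * `|w| * 0 by rewrite !(mulr0, mul0r) addr0.
  apply: (@cvgD _ R^o _ \oo _ (fun n => M * `|w_ n - w| * `|v_ n|) (fun n => M * `|w| * `|v_ n - v|)).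
    apply: (@cvgM _ _ \oo _ (fun n => M * `|w_ n - w|) (fun n => `|v_ n|)).
      exact: (@cvgMr _ _ \oo _ (fun n => `|w_ n - w|)).
    exact: nvn.
  exact: (@cvgMr _ _ \oo _ (fun n => `|v_ n - v|)).
have /(@cvgrPdist_le _ R^o)/(_ e e0) := lim0; apply: filterS => n.
rewrite sub0r normrN; apply: le_trans; apply: le_trans _ (ler_norm _).
have lB x y : A t (x - y) = A t x - A t y.
  by rewrite -scaleN1r addrC lA scaleN1r addrC.
have -> : A t w v - A t (w_ n) (v_ n) = - (A t (w_ n - w) (v_ n) + A t w (v_ n - v)).
  rewrite lB linearB /= opprD !opprB.
  by rewrite [RHS]addrC addrA subrK.
by rewrite normrN; apply: le_trans (ler_normD _ _) (lerD (bA _ _) (bA _ _)).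
Qed.

Lemma LI_form D f h : D `<=` `]0, T[%classic -> L2 D f -> L2 D h ->
  LI D (fun t => A t (f t) (h t)).
Proof.
move=> DT [[f_ sf fl] If] [[h_ sh hl] Ih].
have sub : {ae mu, forall t, D t -> linear (A t) /\ forall w v, `|A t w v| <= M * `|w| * `|v|}.
  by apply: aeS2 _ form_lin form_le => t h1 h2 Dt; split; [apply: h1|apply: h2]; exact: DT.
apply: (@LI_dom _ _ _ (fun t => M * (`|f t| ^+ 2 + `|h t| ^+ 2))); last by apply: LIZ; exact: LID.
  apply: (@aem_lim _ _ (fun k t => A t (f_ k t) (h_ k t))); last first.
    apply: aeS3 _ sub fl hl => t h1 h2 h3 Dt; have [lA bA] := h1 Dt.
    by apply: form_cvg => //; [exact: h2|exact: h3].
  move=> k.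
  apply: (@aem_caratheodory _ _ _ (fun t (x : V * V) => A t x.1 x.2) (fun t => (f_ k t, h_ k t))).
    exact: (simple_map2 (fun x y => (x, y))).
  move=> [w v]; apply: aem_sub (DT) _ => /=.
  by case: EA => _ + _ _; exact.
apply: aeS _ sub => t ht Dt; have [_ bA] := ht Dt.
apply: le_trans (bA _ _) _; rewrite -mulrA ler_pM2l//.
have := sqr_ge0 (`|f t| - `|h t|); have := sqr_ge0 `|f t|; have := sqr_ge0 `|h t|.
by move: `|f t| `|h t| => x y; nra.
Qed.

End EllipticFamily.

(** * Representatives of the solution and of its derivatives *)

Section Setting.
Context {R : realType} {V H : hilbertType R} (iota : blin V H).
Notation mu := (@lebesgue_measure R).
Variable T : R.
Hypothesis T0 : 0 < T.
Hypothesis gt : gelfand_triple iota.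

(** The derivative of the H-valued function ub, as a V'-valued function, has
    the Riesz representative g. *)
Definition pairs_with (g : R -> V) (ub : R -> H) :=
  forall s t v, 0 <= s -> s <= t -> t <= T ->
    inner (ub t) (iota v) - inner (ub s) (iota v) = \int[mu]_(r in `]s, t]) inner (g r) v.

Lemma dense_uniq (h h' : H) : (forall v, inner h (iota v) = inner h' (iota v)) -> h = h'.
Proof.
move=> e; apply/eqP; rewrite -subr_eq0; apply/eqP; apply: (dense_inner0 gt.2) => z.
by rewrite innerBl e subrr.
Qed.

Lemma L2_of (E : normedModType R) (f : R -> E) : in_L2 `]0, T[ f -> L2 `]0, T] f.
Proof. by move=> h; apply: L2_oo_oc; apply/in_L2P. Qed.

(** C0rep picks some continuous representative, and there is only one on [0,
    T]. *)
Lemma C0rep_eq (w : R -> V) (wb : R -> H) : continuous wb ->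
  {ae mu, forall t, `]0, T]%classic t -> wb t = iota (w t)} ->
  forall t, t \in `[0, T] -> C0rep iota T w t = wb t.
Proof.
move=> cwb ewb.
have P : [set wb : R -> H | {within `[0, T], continuous wb} /\
    {ae mu, forall t, t \in `]0, T[ -> wb t = iota (w t)}] wb.
  split; first exact: continuous_subspaceT.
  apply: aeS _ ewb => t h t0T; apply: h.
  by move: t0T; rewrite /= !in_itv/= => /andP[-> /ltW].
have [h1 h2] := xgetPex (cst 0) (ex_intro _ _ P).
apply: (@ae_cont_eq _ H 0 T) => //; first exact: continuous_subspaceT.
apply: aeS2 _ h2 ewb => t h3 h4 t0T; rewrite /C0rep (h3 t0T) h4//.
by move: t0T; rewrite /= !in_itv/= => /andP[-> /ltW].
Qed.

Lemma weak_pair_mass k (u w : R -> V) :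
  weak_derivn T k (VtoV' iota \o u) (VtoV' iota \o w) -> weak_pair iota T k u w.
Proof. by move=> h phi tp v; rewrite -!rint_oo_oc; exact: h tp v. Qed.

(** The weak equation for du says that the H-mass of u has the continuous
    representative C + prim T du, to which [rep_exists] applies. *)
Lemma trace_rep (u : R -> V) (du : R -> V^dual) : in_X iota T u du ->
  exists ub : R -> H, [/\ continuous ub,
    {ae mu, forall t, `]0, T]%classic t -> ub t = iota (u t)},
    pairs_with (fun t => riesz (du t)) ub &
    forall a b, 0 <= a -> a < b -> b <= T -> exists s,
      (b - a) * `|u s| ^+ 2 <= 2 * \int[mu]_(t in `]a, b]) (`|u t| ^+ 2 + `|du t| ^+ 2) /\
      `|ub b - iota (u s)| ^+ 2 <= 14 * \int[mu]_(t in `]a, b]) (`|u t| ^+ 2 + `|du t| ^+ 2)].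
Proof.
move=> [/L2_of lu /L2_of ldu wd].
have lg := L2_riesz ldu.
have wp : weak_pair (@id_blin R V) T 1 (fun t => mass iota (u t)) (fun t => riesz (du t)).
  move=> phi tp v; rewrite -!rint_oo_oc /=.
  under eq_Rintegral do rewrite massE.
  under [in RHS]eq_Rintegral do rewrite rieszE.
  exact: wd.
have [U [C UE] hU] := weak_repr T0 (@id_blin_inj R V) (L2_mass iota lu) lg wp.
have cU : continuous U by rewrite UE; exact: L2_iter.
have UI s t : 0 <= s -> s <= t -> t <= T -> U t - U s = vint `]s, t] (fun t => riesz (du t)).
  by rewrite UE; exact: primC_sub.
have gd : {ae mu, forall t, `]0, T]%classic t -> good iota u U t}.
  by apply: aeS _ hU => t h tT z; rewrite -h// massE.
have [ub [cub ubU ubT]] := rep_exists T0 lu lg cU UI gd gt.2.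
exists ub; split => //.
- apply: aeS _ gd => t h tT; apply: dense_uniq => z.
  by rewrite ubU ?h//; move: tT; rewrite /= !in_itv/= => /andP[/ltW-> ->].
- move=> s t v s0 st tT.
  have lg' : L2 `]s, t] (fun t => riesz (du t)) by apply: L2_sub lg; exact: sub_oc.
  rewrite !ubU ?in_itv/= ?s0 ?tT ?(le_trans st tT) ?(le_trans s0 st)//.
  by rewrite -innerBl UI// vintE//; exact: fin_meas_itv.
move=> a b a0 ab bT; have [s] := ubT a b a0 ab bT.
under eq_Rintegral do rewrite riesz_norm.
by exists s.
Qed.

(** The iterated primitive of w is V-valued and continuous, so it also
    determines the H-valued representative everywhere. *)
Lemma regular_rep (u w : R -> V) (ub : R -> H) k : L2 `]0, T] u -> L2 `]0, T] w ->
  weak_pair iota T k.+1 u w -> continuous ub ->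
  {ae mu, forall t, `]0, T]%classic t -> ub t = iota (u t)} ->
  exists h : R -> V, [/\ continuous h, iter_prim T k.+1 h w,
    {ae mu, forall t, `]0, T]%classic t -> u t = h t} &
    forall t, t \in `[0, T] -> ub t = iota (h t)].
Proof.
move=> lu lw wp cub ubu.
have [h ih uh] := weak_repr T0 gt.1 lu lw wp.
have ch : continuous h by have [C hC] := ih; apply: iter_prim_cont hC => //; exact: L2_iter.
exists h; split => //.
have cih : continuous (fun t => iota (h t)).
  by move=> t; apply: continuous_comp; [exact: ch|exact: blin_continuous].
apply: (@ae_cont_eq _ H 0 T); [exact: T0|exact: continuous_subspaceT|exact: continuous_subspaceT|].
apply: aeS2 _ ubu uh => t h1 h2; rewrite /= in_itv/= => /andP[t0 tT].
have t0T : `]0, T]%classic t by rewrite /= in_itv/= t0 ltW.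
by rewrite h1// h2.
Qed.

(** Differentiating q times and once commute: test the relation between u and
    w with phi', and the definitions of du and dw with the q-th derivative of
    phi and with phi. *)
Lemma weak_pair_deriv (u w : R -> V) (du dw : R -> V^dual) q : in_X iota T u du ->
  in_X iota T w dw -> weak_derivn T q (VtoV' iota \o u) (VtoV' iota \o w) ->
  weak_pair (@id_blin R V) T q (fun t => riesz (du t)) (fun t => riesz (dw t)).
Proof.
move=> [_ _ wu] [_ _ ww] wq phi tp v; rewrite -!rint_oo_oc /=.
under eq_Rintegral do rewrite rieszE.
under [in RHS]eq_Rintegral do rewrite rieszE.
have h1 := wu _ (test_fun_derivn q tp) v; have h2 := ww _ tp v.
have h3 := wq _ (test_fun_deriv tp) v.
have e : derive1n 1 (derive1n q phi) = derive1n q (derive1 phi) by rewrite -derive1nSr.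
rewrite e h3 h2 !expr1 in h1; rewrite !mulN1r mulrN in h1.
by move/oppr_inj : h1 => ->.
Qed.

End Setting.

(** * Partitions and one-sided limits *)

Section Pieces.
Context {R : realType} {V : hilbertType R}.

Lemma lim_right (a b : R) (f p : R -> V) : a < b -> continuous p ->
  (forall s, s \in `]a, b] -> f s = p s) -> lim (f @ a^'+) = p a.
Proof.
move=> ab cp fp; apply: cvg_lim => //.
apply: (@cvg_trans _ (p @ a^'+)); last exact: (cvg_at_right_filter (cp a)).
apply: near_eq_cvg; near=> s; rewrite fp// in_itv/=; apply/andP; split.
  by near: s; exact: nbhs_right_gt.
by near: s; apply: nbhs_right_le.
Unshelve. all: end_near. Qed.

Lemma derive1_piece (a b s : R) (f p : R -> V) (l : V) :
  (forall s, s \in `]a, b] -> f s = p s) -> is_derive s (1 : R) p l -> s \in `]a, b[ ->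
  derive1 f s = l.
Proof.
move=> fp dp; rewrite in_itv/= => /andP[as_ sb]; rewrite derive1E.
rewrite -(@derive_val _ _ _ _ _ _ _ dp); apply: near_eq_derive.
near=> r; rewrite fp// in_itv/=; apply/andP; split.
  by near: r; exact: lt_nbhsr.
by apply: ltW; near: r; exact: lt_nbhsl.
Unshelve. all: end_near. Qed.

Lemma sum_one (n m N : nat) (f : nat -> R) : (m <= n < N)%N ->
  (forall k, (m <= k < N)%N -> k != n -> f k = 0) -> \sum_(m <= k < N) f k = f n.
Proof.
move=> mn f0; rewrite (bigD1_seq n)/= ?mem_index_iota ?iota_uniq//.
rewrite big1_seq ?addr0// => k /andP[kn]; rewrite mem_index_iota => mk; exact: f0.
Qed.

Lemma sum_none (m N : nat) (f : nat -> R) :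
  (forall k, (m <= k < N)%N -> f k = 0) -> \sum_(m <= k < N) f k = 0.
Proof. by move=> f0; rewrite big1_seq// => k /andP[_]; rewrite mem_index_iota; exact: f0. Qed.

End Pieces.

Section Partition.
Context {R : realType}.
Variables (T : R) (N : nat) (t : nat -> R).
Hypothesis pt : is_partition T N t.

Lemma part_lt n : (n < N)%N -> t n < t n.+1. Proof. by case: pt => _ _; exact. Qed.

Lemma part_le m n : (m <= n)%N -> (n <= N)%N -> t m <= t n.
Proof.
move=> /subnK <-; elim: (n - m)%N => [|i IH]; first by rewrite add0n.
by rewrite addSn => h; apply: le_trans (IH (ltnW h)) (ltW (part_lt h)).
Qed.

Lemma part_ge0 n : (n <= N)%N -> 0 <= t n.
Proof. by case: pt => <- _ _; exact: part_le. Qed.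

Lemma part_leT n : (n <= N)%N -> t n <= T.
Proof. by move=> nN; case: pt => _ <- _; exact: part_le. Qed.

Lemma mesh_ge0 : 0 <= mesh N t.
Proof.
rewrite /mesh; elim/big_rec: _ => // i x _ x0.
by rewrite le_max x0 orbT.
Qed.

Lemma step_le_mesh n : (n < N)%N -> t n.+1 - t n <= mesh N t.
Proof. by move=> nN; rewrite /mesh; exact: (@le_bigmax _ R _ 0 (fun i : 'I_N => t i.+1 - t i) (Ordinal nN)). Qed.

Lemma part_disj k n (s : R) : (k < N)%N -> (n < N)%N -> k != n ->
  s \in `]t k, t k.+1] -> s \notin `]t n, t n.+1].
Proof.
move=> kN nN; rewrite neq_ltn => /orP[kn|nk]; rewrite !in_itv/= => /andP[h1 h2]; apply/negP => /andP[h3 h4].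
  by have := part_le kn (ltnW nN); rewrite leNgt (lt_le_trans h3 h2).
by have := part_le nk (ltnW kN); rewrite leNgt (lt_le_trans h1 h4).
Qed.

Lemma rint_part (f : R -> R) n : (n <= N)%N -> LI `]0, T] f ->
  \int[@lebesgue_measure R]_(s in `]0, t n]) f s =
  \sum_(k < n) \int[@lebesgue_measure R]_(s in `]t k, t k.+1]) f s.
Proof.
move=> + If; elim: n => [|n IH] nN.
  by rewrite big_ord0; case: pt => -> _ _; rewrite set_itvoc0 Rintegral_set0.
rewrite big_ord_recr/= -IH ?(ltnW nN)//; apply: rint_split.
- by apply: part_ge0; exact: ltnW.
- by apply: ltW; exact: part_lt.
- by apply: LI_sub If; apply: sub_oc => //; exact: part_leT.
Qed.

Lemma rint_partT (f : R -> R) : LI `]0, T] f ->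
  \int[@lebesgue_measure R]_(s in `]0, T]) f s =
  \sum_(k < N) \int[@lebesgue_measure R]_(s in `]t k, t k.+1]) f s.
Proof. by move=> If; rewrite -rint_part//; case: pt => _ -> _. Qed.

End Partition.

(** * The scheme on one interval *)

Section DG.
Context {R : realType} {V H : hilbertType R} (iota : blin V H).
Notation mu := (@lebesgue_measure R).
Variables (T : R) (A : R -> V -> V^dual) (F : R -> V^dual) (u0 : H) (q N : nat) (t : nat -> R).
Variables (u : R -> V) (du : R -> V^dual) (utau : R -> V).
Hypothesis T0 : 0 < T.
Hypothesis pt : is_partition T N t.
Hypothesis psol : parabolic_solution iota T A F u0 u du.
Hypothesis dg : dg_solution iota T A F u0 q N t utau.

(** Take v1 = 0 in the weak formulation. *)
Lemma initial_value : C0rep iota T u 0 = u0.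
Proof.
apply: riesz_uniq => v.
have L0 : in_L2 `]0, T[ (fun=> 0 : V).
  by apply/in_L2P => //; apply: (L2_cst (E := V)); exact: fin_meas_itv.
have := psol.2 (fun=> 0) v L0.
under eq_Rintegral do rewrite !linear0 addr0.
under [in X in _ = X -> _]eq_Rintegral do rewrite linear0.
by rewrite !rint0// !add0r.
Qed.

Definition on_piece n (z : R -> V) (s : R) : V := if s \in `]t n, t n.+1] then z s else 0.

Lemma on_piece_eq n z s : s \in `]t n, t n.+1] -> on_piece n z s = z s.
Proof. by rewrite /on_piece => ->. Qed.

Lemma on_piece0 k n z s : (k < N)%N -> (n < N)%N -> k != n -> s \in `]t k, t k.+1] ->
  on_piece n z s = 0.
Proof.
by move=> kN nN kn /(part_disj pt kN nN kn); rewrite /on_piece => /negbTE ->.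
Qed.

Lemma on_piece_Stau n z : (n < N)%N -> ispol q.+1 z -> in_Stau q N t (on_piece n z).
Proof.
move=> nN [c zE] k kN; have [->|kn] := eqVneq k n.
  by exists (fun i => c i) => s sn; rewrite on_piece_eq// zE.
exists (fun=> 0) => s sk; rewrite (on_piece0 _ kN nN kn sk).
by rewrite big1// => i _; rewrite scaler0.
Qed.

Lemma on_piece_L2 n z : (n < N)%N -> continuous z -> in_L2 `]0, T[ (on_piece n z).
Proof.
move=> nN cz; apply/in_L2P => //.
rewrite (_ : on_piece n z = fun s => (\1_`]t n, t n.+1] s : R) *: z s).
  apply: (@L2Z _ _ _ _ _ 1).
  - by apply: sm_simple; apply: simple_indic; exact: measurable_itv.
  - by apply: aeW => s _; rewrite indicE; case: (_ \in _); rewrite ?normr1 ?normr0.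
  - by case: (L2_cont 0 T cz).
apply/funext => s; rewrite /on_piece indicE mem_setE /=.
by case: ifP => _; rewrite ?scale1r ?scale0r.
Qed.

Lemma lim_on_piece n z : (n < N)%N -> continuous z ->
  lim (on_piece n z @ (t n)^'+) = z (t n).
Proof.
by move=> nN cz; apply: (lim_right (part_lt pt nN) cz) => s; exact: on_piece_eq.
Qed.

Lemma lim_on_piece0 k n z : (k < N)%N -> (n < N)%N -> k != n ->
  lim (on_piece n z @ (t k)^'+) = 0.
Proof.
move=> kN nN kn; apply: (@lim_right _ _ _ _ _ (fun=> 0) (part_lt pt kN)) => [s|s sk].
  exact: cvg_cst.
exact: on_piece0 sk.
Qed.

Lemma utau_piece n : (n < N)%N -> exists2 P, ispol q.+1 P &
  forall s, s \in `]t n, t n.+1] -> utau s = P s.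
Proof.
move=> /(dg.1) [p hp]; exists (vpol q.+1 (fun i => p (inord i))); first exact: ispol_vpol.
by move=> s /hp ->; apply: eq_bigr => i _; rewrite inord_val.
Qed.

(** The value from which the jump at t_n is measured. *)
Definition incoming n : H := if n is 0 then u0 else iota (utau (t n)).

(** Both problems are tested with z on one interval and 0 on the others. The
    right-hand side F cancels, and of the jump terms only the one at t_n
    remains. *)
Lemma dg_local n z P P' : (n < N)%N -> ispol q.+1 z -> ispol q.+1 P ->
  (forall s, s \in `]t n, t n.+1] -> utau s = P s) ->
  (forall s, is_derive s (1 : R) P (P' s)) ->
  \int[mu]_(s in `]t n, t n.+1]) (inner (iota (P' s)) (iota (z s)) + A s (P s) (z s)) +
    inner (iota (P (t n)) - incoming n) (iota (z (t n))) =
  \int[mu]_(s in `]t n, t n.+1]) (du s (z s) + A s (u s) (z s)).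
Proof.
move=> nN pz pP uP dP.
have cz := ispol_cont pz; have cP := ispol_cont pP.
have tn := part_lt pt nN.
have DGe := dg.2 _ (on_piece_Stau nN pz).
have Pe := psol.2 _ 0 (on_piece_L2 nN cz).
rewrite !inner0r !addr0 in Pe.
have -> : \int[mu]_(s in `]t n, t n.+1]) (du s (z s) + A s (u s) (z s)) =
    \int[mu]_(s in `]0, T[) F s (on_piece n z s).
  rewrite -Pe rint_oo_oc (@rint_mkcond _ `]0, T]); last first.
    by apply: sub_oc; [apply: (part_ge0 pt); exact: ltnW|exact: (part_leT pt)].
  apply: eq_Rintegral => s _; rewrite indicE mem_setE /= /on_piece.
  by case: ifP => _; rewrite ?mul1r// mul0r !linear0 addr0.
have I1 : \sum_(k < N) \int[mu]_(s in `]t k, t k.+1])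
      (inner (iota (derive1 utau s)) (iota (on_piece n z s)) + A s (utau s) (on_piece n z s)) =
    \int[mu]_(s in `]t n, t n.+1]) (inner (iota (P' s)) (iota (z s)) + A s (P s) (z s)).
  rewrite -(big_mkord xpredT (fun k => \int[mu]_(s in `]t k, t k.+1])
      (inner (iota (derive1 utau s)) (iota (on_piece n z s)) + A s (utau s) (on_piece n z s)))).
  rewrite (@sum_one _ n)//.
    rewrite -!rint_oo_oc; apply: eq_Rintegral => s; rewrite inE/= => sn.
    have sn' : s \in `]t n, t n.+1] by move: sn; rewrite !in_itv/= => /andP[-> /ltW].
    by rewrite (derive1_piece uP (dP s) sn) on_piece_eq// uP.
  move=> k kN kn; rewrite -[RHS](@rint0 _ `]t k, t k.+1])//.
  apply: eq_Rintegral => s; rewrite inE/= => sk.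
  by rewrite (on_piece0 _ kN nN kn sk) !linear0 inner0r addr0.
rewrite /Btau I1 in DGe.
case: n nN tn uP DGe {I1 Pe} => [|n] nN tn uP DGe.
  rewrite (lim_on_piece nN cz) (lim_right tn cP uP) in DGe.
  rewrite sum_none in DGe; last first.
    move=> k /andP[k0 kN]; rewrite (lim_on_piece0 _ kN nN) ?linear0 ?inner0r//.
    by rewrite -lt0n.
  by rewrite /incoming innerBl addrA; move: DGe; rewrite addr0 => ->; rewrite addrK.
have N0 : (0 < N)%N by exact: leq_ltn_trans nN.
rewrite (lim_on_piece0 _ N0 nN)// linear0 !inner0r !addr0 in DGe.
rewrite (@sum_one _ n.+1) ?nN// in DGe.
  rewrite (lim_on_piece nN cz) (lim_right tn cP uP) in DGe.
  by rewrite /incoming -linearB.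
move=> k /andP[k0 kN] kn; rewrite (lim_on_piece0 _ kN nN)//.
by rewrite linear0 inner0r.
Qed.

End DG.

(** * The energy estimate on one interval *)

Section Energy.
Context {R : realType} {V H : hilbertType R} (iota : blin V H).
Notation mu := (@lebesgue_measure R).

Lemma vpolB m (c d : nat -> V) s : vpol m (fun i => c i - d i) s = vpol m c s - vpol m d s.
Proof. by rewrite /vpol -sumrB; apply: eq_bigr => i _; rewrite scalerBr. Qed.

Lemma vpol_vder_sum m (c : nat -> V) s :
  vpol m (vder c) s = \sum_(i < m.+1) (('X^i)^`() : {poly R}).[s] *: c i.
Proof.
rewrite big_ord_recl derivXn /= mulr0n horner0 scale0r add0r; apply: eq_bigr => i _.
by rewrite /= /bump/= add1n derivXn hornerMn hornerXn /vder scalerA mulr_natr.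
Qed.

Lemma mass_vpol m (c : nat -> V) (s : R) :
  mass iota (vpol m c s) = vpol m (fun i => mass iota (c i)) s.
Proof. by rewrite /vpol linear_sum; apply: eq_bigr => i _; rewrite linearZ. Qed.

Lemma vpol_cont m (c : nat -> V) : continuous (vpol m c).
Proof. by apply: (@ispol_cont _ _ m); exact: ispol_vpol. Qed.

Lemma iota_cont (f : R -> V) : continuous f -> continuous (fun s => iota (f s)).
Proof. by move=> cf s; apply: continuous_comp; [exact: cf|exact: blin_continuous]. Qed.

Lemma LI_inner_cont (a b : R) (f g : R -> H) : continuous f -> continuous g ->
  LI `]a, b] (fun s => inner (f s) (g s)).
Proof. by move=> cf cg; apply: LI_cont => s; apply: cvg_inner; [exact: cf|exact: cg]. Qed.

(** Integration by parts monomial by monomial. *)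
Lemma ibp_pol T (a b : R) m (c : nat -> V) (g : R -> V) (ub : R -> H) :
  0 <= a -> a <= b -> b <= T -> L2 `]a, b] g -> continuous ub -> pairs_with iota T g ub ->
  \int[mu]_(s in `]a, b]) inner (g s) (vpol m.+1 c s) =
  inner (ub b) (iota (vpol m.+1 c b)) - inner (ub a) (iota (vpol m.+1 c a)) -
  \int[mu]_(s in `]a, b]) inner (ub s) (iota (vpol m (vder c) s)).
Proof.
move=> a0 ab bT lg cub pw.
have fM := fin_meas_itv false false a b.
have cX (i : nat) : continuous (fun s : R => s ^+ i) by exact: exprn_continuous.
have cU (v : V) : continuous (fun s => inner (ub s) (iota v)).
  by move=> s; apply: cvg_inner; [exact: cub|exact: cvg_cst].
have -> : (fun s => inner (g s) (vpol m.+1 c s)) =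
    (fun s => \sum_(i < m.+1) s ^+ i * inner (g s) (c i)).
  by apply/funext => s; rewrite inner_sumr; apply: eq_bigr => i _; rewrite innerZr.
have -> : (fun s => inner (ub s) (iota (vpol m (vder c) s))) =
    (fun s => \sum_(i < m.+1) (('X^i)^`() : {poly R}).[s] * inner (ub s) (iota (c i))).
  apply/funext => s; rewrite vpol_vder_sum linear_sum inner_sumr.
  by apply: eq_bigr => i _; rewrite linearZ innerZr.
have LI1 (i : 'I_m.+1) : LI `]a, b] (fun s => s ^+ i * inner (g s) (c i)).
  by apply: LI_mulcont; [exact: cX|exact: L2_inner].
have LI2 (i : 'I_m.+1) : LI `]a, b] (fun s => (('X^i)^`() : {poly R}).[s] * inner (ub s) (iota (c i))).
  by apply: LI_mulcont; [exact: continuous_horner|exact: LI_cont].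
rewrite !rint_sum//.
rewrite /vpol !linear_sum /= !inner_sumr.
rewrite -!sumrB -big_split/=; apply: eq_bigr => i _.
have dX (s : R) : is_derive s (1 : R) (fun s : R => s ^+ i) (('X^i)^`() : {poly R}).[s].
  rewrite (_ : (fun s => s ^+ i) = horner 'X^i); first exact: is_derive_horner.
  by apply/funext => r; rewrite hornerXn.
have pU : primitive_on a b (fun s => inner (ub s) (iota (c i))) (fun s => inner (g s) (c i)).
  by move=> s r as_ sr rb; apply: pw => //; [exact: le_trans as_|exact: le_trans rb bT].
rewrite (ibp ab (L2_inner (c i) fM lg) (cU (c i)) pU dX (@continuous_horner _ _)).
have iZ (x : R) (v : V) : iota (x *: v) = x *: iota v by exact: linearZ.
by rewrite !iZ !innerZr.
Qed.

(** A V-valued polynomial pairs with the mass of its derivative, so that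
    [ibp_pol] applies to it as well as to u. *)
Lemma pairs_with_pol T m (c : nat -> V) :
  pairs_with iota T (fun s => mass iota (vpol m (vder c) s)) (fun s => iota (vpol m.+1 c s)).
Proof.
move=> s r v s0 sr rT.
pose x := mass iota v; have hx y : inner (iota y) (iota v) = inner y x := mass_sym iota y v.
rewrite !hx -innerBl -(FTC_vec x sr (fun t => vpol_derive m c t) (@vpol_cont _ _)).
by apply: eq_Rintegral => t _; rewrite massE hx.
Qed.

Variables (T M alpha : R) (A : R -> V -> V^dual).
Hypothesis (M0 : 0 < M) (al0 : 0 < alpha) (EA : elliptic_family T M alpha A).

Lemma form_oc (a b : R) (f h : R -> V) : 0 <= a -> b <= T -> L2 `]a, b] f -> L2 `]a, b] h ->
  LI `]a, b] (fun s => A s (f s) (h s)).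
Proof.
move=> a0 bT lf lh; apply: LI_oo_oc.
have sub : `]a, b[%classic `<=` `]a, b]%classic by apply: subset_itvl; rewrite bnd_simp.
apply: (LI_form M0 EA); [|exact: L2_sub lf|exact: L2_sub lh].
by apply: subset_itv; rewrite bnd_simp.
Qed.

Lemma form_ae (a b : R) : 0 <= a -> b <= T -> {ae mu, forall s, `]a, b]%classic s ->
  [/\ linear (A s), forall w v, `|A s w v| <= M * `|w| * `|v| &
      forall v, alpha * `|v| ^+ 2 <= A s v v]}.
Proof.
move=> a0 bT; apply: ae_oo_oc; case: EA => h1 _ h2 h3.
apply: aeS3 _ h1 h2 h3 => s k1 k2 k3 sab.
have s0T : s \in `]0, T[.
  by move: sab; rewrite /= !in_itv/= => /andP[h4 h5]; rewrite (le_lt_trans a0 h4) (lt_le_trans h5 bT).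
by split; [exact: k1|exact: k2|exact: k3].
Qed.

Lemma lin_formB s w w' v : linear (A s) -> A s (w - w') v = A s w v - A s w' v.
Proof.
move=> lA; have -> : A s (w - w') = A s w - A s w' by rewrite -scaleN1r addrC lA scaleN1r addrC.
by [].
Qed.

Variables (u g : R -> V) (ub : R -> H).
Hypothesis lu : L2 `]0, T] u.
Hypothesis lg : L2 `]0, T] g.
Hypothesis cub : continuous ub.
Hypothesis pw : pairs_with iota T g ub.

Lemma form_young (al m X Y x r : R) : 0 < al -> `|Y| <= m * r * x -> al * x ^+ 2 <= X ->
  al / 2 * x ^+ 2 - m ^+ 2 / (2 * al) * r ^+ 2 <= X - Y.
Proof.
move=> al_gt0 hY hX; have h1 : Y <= m * r * x by exact: le_trans (ler_norm _) hY.
have : 0 <= (m * r - al * x) ^+ 2 / (2 * al) by rewrite divr_ge0 ?sqr_ge0// ltW// mulr_gt0.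
have -> : (m * r - al * x) ^+ 2 / (2 * al) =
    m ^+ 2 / (2 * al) * r ^+ 2 + al / 2 * x ^+ 2 - m * r * x by field; rewrite gt_eqF.
lra.
Qed.

(** Test the local equation with theta = p - u_tau, where P is u_tau on this
    interval. Integrating by parts, the derivative terms become boundary terms
    and the integral of (ub - p, theta'), which vanishes by the choice of p.
    The boundary terms at b and a complete the squares of ub - P at b and of
    ub - y at a, and coercivity leaves alpha |theta|^2 on the left. *)
Lemma energy_step (a b : R) q (p P z : nat -> V) (y : H) : 0 <= a -> a < b -> b <= T ->
  z = (fun i => p i - P i) ->
  \int[mu]_(s in `]a, b]) (inner (iota (vpol q (vder P) s)) (iota (vpol q.+1 z s)) +
      A s (vpol q.+1 P s) (vpol q.+1 z s)) +
    inner (iota (vpol q.+1 P a) - y) (iota (vpol q.+1 z a)) =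
  \int[mu]_(s in `]a, b]) (inner (g s) (vpol q.+1 z s) + A s (u s) (vpol q.+1 z s)) ->
  \int[mu]_(s in `]a, b]) inner (ub s - iota (vpol q.+1 p s)) (iota (vpol q (vder z) s)) = 0 ->
  `|ub b - iota (vpol q.+1 P b)| ^+ 2 +
    alpha * \int[mu]_(s in `]a, b]) (`|vpol q.+1 z s| ^+ 2) <=
  `|ub a - y| ^+ 2 +
    M ^+ 2 / alpha * \int[mu]_(s in `]a, b]) (`|u s - vpol q.+1 p s| ^+ 2) +
    `|ub b - iota (vpol q.+1 p b)| ^+ 2.
Proof.
move=> a0 ab bT ze En orth.
have ab' := ltW ab.
have mD : measurable `]a, b]%classic by exact: measurable_itv.
have lu' : L2 `]a, b] u by apply: L2_sub lu; exact: sub_oc.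
have lg' : L2 `]a, b] g by apply: L2_sub lg; exact: sub_oc.
have lp (m : nat) (c : nat -> V) : L2 `]a, b] (vpol m c) by case: (L2_cont a b (vpol_cont (m := m) (c := c))).
have Li c := iota_cont (vpol_cont (m := q.+1) (c := c)).
have Ld c := iota_cont (vpol_cont (m := q) (c := vder c)).
pose th := vpol q.+1 z; pose th' := vpol q (vder z).
have thE s : th s = vpol q.+1 p s - vpol q.+1 P s by rewrite /th ze vpolB.
have I1 := @ibp_pol T a b q z g ub a0 ab' bT lg' cub pw.
have lmP : L2 `]a, b] (fun s => mass iota (vpol q (vder P) s)) by apply: L2_mass.
have I2 := @ibp_pol T a b q z _ _ a0 ab' bT lmP (Li P) (pairs_with_pol (T := T) q P).
have lmz : L2 `]a, b] (fun s => mass iota (vpol q (vder z) s)) by apply: L2_mass.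
have I3 := @ibp_pol T a b q z _ _ a0 ab' bT lmz (Li z) (pairs_with_pol (T := T) q z).
rewrite -/th -/th' in I1 I2 I3 En orth *.
have sq3 : \int[mu]_(s in `]a, b]) inner (iota (th s)) (iota (th' s)) =
    (`|iota (th b)| ^+ 2 - `|iota (th a)| ^+ 2) / 2.
  move: I3; under eq_Rintegral do rewrite massE innerC.
  by rewrite !innerxx; lra.
have I4 : \int[mu]_(s in `]a, b]) inner (ub s) (iota (th' s)) =
    \int[mu]_(s in `]a, b]) inner (iota (vpol q.+1 P s)) (iota (th' s)) +
    \int[mu]_(s in `]a, b]) inner (iota (th s)) (iota (th' s)).
  have l1 := LI_inner_cont a b (Li P) (Ld z); have l2 := LI_inner_cont a b (Li z) (Ld z).
  have l3 := LI_inner_cont a b cub (Ld z).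
  rewrite -(rintD mD l1 l2); apply/eqP; rewrite -subr_eq0 -(rintB mD l3 (LID l1 l2)) -orth.
  apply/eqP; apply: eq_Rintegral => s _.
  rewrite -innerDl -innerBl -linearD -[vpol q.+1 z s]/(th s) thE.
  by rewrite (addrC (vpol q.+1 P s)) subrK.
have e2 : \int[mu]_(s in `]a, b]) inner (mass iota (vpol q (vder P) s)) (th s) =
  \int[mu]_(s in `]a, b]) inner (iota (vpol q (vder P) s)) (iota (th s)).
  by apply: eq_Rintegral => s _; rewrite massE.
have LAP : LI `]a, b] (fun s => A s (vpol q.+1 P s) (th s)) := form_oc a0 bT (lp q.+1 P) (lp q.+1 z).
have LAu : LI `]a, b] (fun s => A s (u s) (th s)) := form_oc a0 bT lu' (lp q.+1 z).
have lgz : LI `]a, b] (fun s => inner (g s) (th s)) := LI_inner lg' (lp q.+1 z).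
rewrite (rintD mD (LI_inner_cont a b (Ld P) (Li z)) LAP) (rintD mD lgz LAu) in En.
have lrho : L2 `]a, b] (fun s => u s - vpol q.+1 p s) := L2B lu' (lp q.+1 p).
have lth : LI `]a, b] (fun s => `|th s| ^+ 2) := (lp q.+1 z).2.
have Ar : \int[mu]_(s in `]a, b]) A s (u s) (th s) - \int[mu]_(s in `]a, b]) A s (vpol q.+1 P s) (th s)
    >= alpha / 2 * \int[mu]_(s in `]a, b]) (`|th s| ^+ 2) -
     M ^+ 2 / (2 * alpha) * \int[mu]_(s in `]a, b]) (`|u s - vpol q.+1 p s| ^+ 2).
  have l1 := @LIZ _ _ _ (alpha / 2) lth; have l2 := @LIZ _ _ _ (M ^+ 2 / (2 * alpha)) lrho.2.
  rewrite -(rintB mD LAu LAP) -(rintZ mD _ lth) -(rintZ mD _ lrho.2) -(rintB mD l1 l2).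
  apply: (rint_le mD (LIB l1 l2) (LIB LAu LAP)).
  apply: aeS _ (form_ae a0 bT) => s hs /hs[lA bA cA].
  rewrite -lin_formB//.
  have -> : u s - vpol q.+1 P s = th s - (vpol q.+1 p s - u s).
    by rewrite thE opprB [RHS]addrC addrA subrK.
  rewrite lin_formB// (distrC (u s)).
  have := cA (th s); have := bA (vpol q.+1 p s - u s) (th s).
  exact: form_young.
have Eb : ub b - iota (vpol q.+1 P b) = (ub b - iota (vpol q.+1 p b)) + iota (th b).
  by rewrite thE linearB addrA subrK.
rewrite Eb normD_sqr innerBl.
have Ea : 0 <= `|ub a - y - iota (th a)| ^+ 2 by exact: sqr_ge0.
rewrite normB_sqr innerBl in Ea.
rewrite innerBl in En.
have Eb2 : inner (iota (vpol q.+1 P b)) (iota (th b)) =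
    inner (iota (vpol q.+1 p b)) (iota (th b)) - `|iota (th b)| ^+ 2.
  by rewrite -innerxx -innerBl -linearB thE subKr.
have -> : M ^+ 2 / alpha = 2 * (M ^+ 2 / (2 * alpha)) by field; rewrite gt_eqF.
move: (M ^+ 2 / (2 * alpha)) Ar => c Ar.
rewrite I1 -e2 I2 I4 sq3 Eb2 in En.
move: En Ar Ea; set i1 := \int[mu]_(s in _) A s (u s) (th s).
set i2 := \int[mu]_(s in _) A s (vpol q.+1 P s) (th s).
set i3 := \int[mu]_(s in _) inner (iota _) (iota (th' s)).
set i4 := \int[mu]_(s in _) (`|th s| ^+ 2).
set i5 := \int[mu]_(s in _) (`|_| ^+ 2).
lra.
Qed.

End Energy.

(** * Summation over the intervals *)

Lemma LI_glue (R : realType) (T : R) N (t : nat -> R) (f : R -> R) : is_partition T N t ->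
  (forall n, (n < N)%N -> LI `]t n, t n.+1] f) -> LI `]0, T] f.
Proof.
move=> pt If; suff : forall n, (n <= N)%N -> LI `]0, t n] f.
  by move=> /(_ N (leqnn _)); case: pt => _ ->.
elim=> [_|n IH nN].
  by case: pt => -> _ _; apply: LI_ae (LI0 _); apply: aeW => s; rewrite /= in_itv/= lt_le_asym.
have n0 := part_ge0 pt (ltnW nN); have ltn := part_lt pt nN.
have h1 : LI `]0, t n.+1] (fun s => \1_`]0, t n] s * f s).
  by apply: LI_indic => //; [apply: sub_oc => //; exact: ltW|exact: IH (ltnW nN)].
have h2 : LI `]0, t n.+1] (fun s => \1_`]t n, t n.+1] s * f s).
  by apply: LI_indic => //; [exact: sub_oc|exact: If].
apply: LI_ae (LID h1 h2); apply: aeW => s; rewrite /= !indicE !mem_setE /= !in_itv/= => /andP[s0 sn].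
by rewrite s0 sn andbT/=; case: leP => h; rewrite ?mul1r ?mul0r ?addr0 ?add0r.
Qed.

Section Stability.
Context {R : realType} {V H : hilbertType R} (iota : blin V H).
Notation mu := (@lebesgue_measure R).
Variables (T M alpha : R) (A : R -> V -> V^dual) (F : R -> V^dual) (u0 : H).
Variables (q N : nat) (t : nat -> R) (u : R -> V) (du : R -> V^dual) (utau : R -> V).
Variable (ub : R -> H).
Hypotheses (T0 : 0 < T) (M0 : 0 < M) (al0 : 0 < alpha) (EA : elliptic_family T M alpha A).
Hypothesis pt : is_partition T N t.
Hypothesis psol : parabolic_solution iota T A F u0 u du.
Hypothesis dg : dg_solution iota T A F u0 q N t utau.
Hypothesis cub : continuous ub.
Hypothesis pw : pairs_with iota T (fun s => riesz (du s)) ub.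
Hypothesis ub0 : ub 0 = u0.

Let lu : L2 `]0, T] u. Proof. by case: psol.1 => /L2_of. Qed.
Let lg : L2 `]0, T] (fun s => riesz (du s)).
Proof. by apply: L2_riesz; case: psol.1 => _ /L2_of. Qed.

Let err n := `|ub (t n) - incoming iota u0 t utau n| ^+ 2.

Lemma L2_piece (E : normedModType R) n (f : R -> E) : (n < N)%N -> L2 `]0, T] f ->
  L2 `]t n, t n.+1] f.
Proof.
move=> nN; apply: L2_sub; apply: sub_oc; last exact: part_leT pt _ nN.
by apply: (part_ge0 pt); exact: ltnW.
Qed.

Lemma utau_vpol n : (n < N)%N -> exists P : nat -> V,
  forall s, s \in `]t n, t n.+1] -> utau s = vpol q.+1 P s.
Proof.
by move=> /(utau_piece dg)[P [c PE] hP]; exists c => s sn; rewrite hP// PE.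
Qed.

Lemma end_in n : (n < N)%N -> t n.+1 \in `]t n, t n.+1].
Proof. by move=> nN; rewrite in_itv/= lexx andbT; exact: part_lt pt _ nN. Qed.

Lemma dg_local_vpol n (z P : nat -> V) : (n < N)%N ->
  (forall s, s \in `]t n, t n.+1] -> utau s = vpol q.+1 P s) ->
  \int[mu]_(s in `]t n, t n.+1]) (inner (iota (vpol q (vder P) s)) (iota (vpol q.+1 z s)) +
      A s (vpol q.+1 P s) (vpol q.+1 z s)) +
    inner (iota (vpol q.+1 P (t n)) - incoming iota u0 t utau n) (iota (vpol q.+1 z (t n))) =
  \int[mu]_(s in `]t n, t n.+1]) (inner (riesz (du s)) (vpol q.+1 z s) + A s (u s) (vpol q.+1 z s)).
Proof.
move=> nN uP.
rewrite (dg_local pt psol dg nN (ispol_vpol _ z) (ispol_vpol _ P) uP (fun s => vpol_derive q P s)).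
by apply: eq_Rintegral => s _; rewrite rieszE.
Qed.

Lemma L2_err n : (n < N)%N -> L2 `]t n, t n.+1] (fun s => u s - utau s).
Proof.
move=> nN; have [P uP] := utau_vpol nN.
apply: (@L2_ae _ _ _ _ (fun s => u s - vpol q.+1 P s)).
  by apply: aeW => s sn; rewrite uP.
apply: L2B; first exact: L2_piece.
by case: (L2_cont (t n) (t n.+1) (vpol_cont (m := q.+1) (c := P))).
Qed.

(** From theta to the error itself: u - u_tau = (u - p) + theta. *)
Lemma stability_step n (p : nat -> V) (E : R) : (n < N)%N ->
  (forall z, \int[mu]_(s in `]t n, t n.+1])
     inner (ub s - iota (vpol q.+1 p s)) (iota (vpol q (vder z) s)) = 0) ->
  \int[mu]_(s in `]t n, t n.+1]) (`|u s - vpol q.+1 p s| ^+ 2) +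
    `|ub (t n.+1) - iota (vpol q.+1 p (t n.+1))| ^+ 2 <= E ->
  err n.+1 + alpha / 2 * \int[mu]_(s in `]t n, t n.+1]) (`|u s - utau s| ^+ 2) <=
  err n + (M ^+ 2 / alpha + 1 + alpha) * E.
Proof.
move=> nN orth hE; have [P uP] := utau_vpol nN.
have n0 := part_ge0 pt (ltnW nN); have nT := part_leT pt nN; have ltn := part_lt pt nN.
pose z := fun i => p i - P i.
have := energy_step M0 al0 EA lu lg cub pw n0 ltn nT (erefl z) (dg_local_vpol z nN uP) (orth z).
rewrite /err /= -uP ?end_in//.
have LP (c : nat -> V) : L2 `]t n, t n.+1] (vpol q.+1 c).
  by case: (L2_cont (t n) (t n.+1) (vpol_cont (m := q.+1) (c := c))).
have lr := L2B (L2_piece nN lu) (LP p).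
have D : \int[mu]_(s in `]t n, t n.+1]) (`|u s - utau s| ^+ 2) <=
    2 * \int[mu]_(s in `]t n, t n.+1]) (`|u s - vpol q.+1 p s| ^+ 2) +
    2 * \int[mu]_(s in `]t n, t n.+1]) (`|vpol q.+1 z s| ^+ 2).
  have mD : measurable `]t n, t n.+1]%classic by exact: measurable_itv.
  have l1 := @LIZ _ _ _ 2 lr.2; have l2 := @LIZ _ _ _ 2 (LP z).2.
  rewrite -(rintZ mD _ lr.2) -(rintZ mD _ (LP z).2) -(rintD mD l1 l2).
  apply: (rint_le mD (L2_err nN).2 (LID l1 l2)); apply: aeW => s sn.
  have -> : u s - utau s = (u s - vpol q.+1 p s) + vpol q.+1 z s.
    by rewrite uP// vpolB addrA subrK.
  exact: norm_sqrD_le.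
have c0 : 0 <= M ^+ 2 / alpha by rewrite divr_ge0 ?sqr_ge0// ltW.
move: (M ^+ 2 / alpha) c0 D hE => c c0.
set r2 := `|ub (t n.+1) - iota (vpol _ _ _)| ^+ 2.
have r20 : 0 <= r2 by exact: sqr_ge0.
set i1 := \int[mu]_(s in _) (`|u s - utau s| ^+ 2).
set i2 := \int[mu]_(s in _) (`|u s - vpol _ _ _| ^+ 2).
have i20 : 0 <= i2 by apply: rint_ge0 => //; apply: aeW => s _; exact: sqr_ge0.
set i3 := \int[mu]_(s in _) (`|vpol _ _ _| ^+ 2).
move=> D hE En.
have h1 : c * i2 <= c * E by apply: ler_wpM2l => //; lra.
have h2 : alpha / 2 * i1 <= alpha / 2 * (2 * i2 + 2 * i3) by apply: ler_wpM2l => //; rewrite divr_ge0// ltW.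
have h3 : alpha * i2 <= alpha * E by apply: ler_wpM2l; [exact: ltW|lra].
lra.
Qed.

(** The nodal terms telescope, and the first one vanishes as ub(0) = u0. *)
Lemma stability (K : R) (x : R -> R) : LI `]0, T] x ->
  (forall n, (n < N)%N -> exists p : nat -> V,
     (forall z, \int[mu]_(s in `]t n, t n.+1])
       inner (ub s - iota (vpol q.+1 p s)) (iota (vpol q (vder z) s)) = 0) /\
     \int[mu]_(s in `]t n, t n.+1]) (`|u s - vpol q.+1 p s| ^+ 2) +
       `|ub (t n.+1) - iota (vpol q.+1 p (t n.+1))| ^+ 2 <=
     K * \int[mu]_(s in `]t n, t n.+1]) x s) ->
  (forall s, 0 <= x s) -> 0 <= K ->
  (forall n, (n <= N)%N -> err n <=
     (M ^+ 2 / alpha + 1 + alpha) * (K * \int[mu]_(s in `]0, T]) x s)) /\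
  \int[mu]_(s in `]0, T]) (`|u s - utau s| ^+ 2) <=
     2 / alpha * (M ^+ 2 / alpha + 1 + alpha) * (K * \int[mu]_(s in `]0, T]) x s).
Proof.
move=> Lx hp x0 K0.
set c := M ^+ 2 / alpha + 1 + alpha.
have c0 : 0 <= c.
  by rewrite /c !addr_ge0 ?divr_ge0 ?sqr_ge0// (ltW al0).
pose e s := `|u s - utau s| ^+ 2.
have Le : LI `]0, T] e by apply: (LI_glue pt) => n nN; exact: (L2_err nN).2.
have main n : (n <= N)%N -> err n + alpha / 2 * \int[mu]_(s in `]0, t n]) e s <=
    c * (K * \int[mu]_(s in `]0, t n]) x s).
  move=> nN; rewrite (rint_part pt nN Le) (rint_part pt nN Lx).
  elim: n nN => [|n IH] nN.
    by rewrite !big_ord0 /err/=; case: (pt) => -> _ _; rewrite ub0 subrr normr0 expr0n !mulr0 addr0.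
  have [p [orth hE]] := hp n nN.
  have := stability_step nN orth hE; have := IH (ltnW nN).
  rewrite !big_ord_recr/= -/(e _).
  rewrite !mulrDr -/c.
  set a1 := \sum_(i < n) _; set a2 := \sum_(i < n) _.
  by rewrite -[\int[mu]_(s in `]t n, t n.+1]) (`|_| ^+ 2)]/(\int[mu]_(s in `]t n, t n.+1]) e s); lra.
have xm n : (n <= N)%N -> \int[mu]_(s in `]0, t n]) x s <= \int[mu]_(s in `]0, T]) x s.
  by move=> nN; apply: rint_subset => //; [exact: (part_ge0 pt)|exact: (part_leT pt)].
have ig n : 0 <= \int[mu]_(s in `]0, t n]) e s.
  by apply: rint_ge0 => //; apply: aeW => s _; exact: sqr_ge0.
split.
  move=> n nN; have h := main n nN.
  have h1 : 0 <= alpha / 2 * \int[mu]_(s in `]0, t n]) e s by rewrite mulr_ge0// divr_ge0// ltW.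
  have h2 : c * (K * \int[mu]_(s in `]0, t n]) x s) <= c * (K * \int[mu]_(s in `]0, T]) x s).
    by do 2![apply: ler_wpM2l => //]; exact: xm.
  lra.
have := main N (leqnn _); have -> : t N = T by case: pt.
have e0 : 0 <= err N by exact: sqr_ge0.
rewrite -/(e _) => h.
have {h}h : alpha / 2 * \int[mu]_(s in `]0, T]) e s <= c * (K * \int[mu]_(s in `]0, T]) x s) by lra.
rewrite -mulrA -ler_pdivrMl ?divr_gt0// invf_div; exact: h.
Qed.

End Stability.

(** * Approximation on one interval *)

Section LocalApproximation.
Context {R : realType}.
Notation mu := (@lebesgue_measure R).

Lemma rint_norm_cst (E : normedModType R) (a b e : R) (f : R -> E) : a <= b ->
  {ae mu, forall s, `]a, b]%classic s -> `|f s| <= e} ->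
  \int[mu]_(s in `]a, b]) (`|f s| ^+ 2) <= (b - a) * e ^+ 2.
Proof.
move=> ab fe; rewrite mulrC -rint_cst//; apply: rint_le_dom => //.
  apply: aeS _ fe => s h sab; rewrite sqr_ge0/= ler_sqr ?nnegrE//; first exact: h.
  exact: le_trans (normr_ge0 _) (h sab).
by apply: LI_cst; exact: fin_meas_itv.
Qed.

(** The property of the constant in [interp_regular], as a predicate because
    the constant has to be chosen before the spaces. *)
Definition interp_bound (q : nat) (C : R) :=
  forall (V H : hilbertType R) (iota : blin V H) (T : R) k (h w : R -> V) (a b : R),
  0 < T -> 0 <= a -> a < b -> b <= T -> (k <= q)%N -> L2 `]0, T] w ->
  iter_prim T k.+1 h w -> continuous h ->
  exists p : nat -> V, [/\ vpol q.+1 p b = h b,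
    forall z, \int[mu]_(s in `]a, b])
       inner (iota (h s) - iota (vpol q.+1 p s)) (iota (vpol q (vder z) s)) = 0 &
    \int[mu]_(s in `]a, b]) (`|h s - vpol q.+1 p s| ^+ 2) <=
      C * (b - a) ^+ (2 * k.+1) * \int[mu]_(s in `]a, b]) (`|w s| ^+ 2)].

(** The Taylor error is at most the integral of |w| times (b - a)^k, hence at
    most (b - a)^(k + 1/2) times the L^2 norm of w; [thomee] keeps this order. *)
Lemma interp_regular (q : nat) : exists2 C : R, 0 <= C & interp_bound q C.
Proof.
have [Cq Cq1 th] := @thomee R q.
exists (Cq ^+ 2); first exact: sqr_ge0.
move=> V H iota T k h w a b T0 a0 ab bT kq lw ih ch.
have ab' := ltW ab; have ba0 : 0 <= b - a by rewrite subr_ge0.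
have [p0 [pp0 p0b p0e]] := taylor T0 a0 ab' bT lw ih.
have [r [[p rE] rb re orth]] := th V h p0 a b _ k.+1 ab kq ch pp0 p0b p0e.
exists p; split.
- by rewrite -rE.
- move=> z.
  have chr : continuous (fun s => h s - r s).
    by move=> s; apply: (@cvgB _ V); [exact: ch|apply: (@ispol_cont _ _ q.+1); exists p].
  have -> : (fun s => inner (iota (h s) - iota (vpol q.+1 p s)) (iota (vpol q (vder z) s))) =
      (fun s => \sum_(i < q) ('X^i : {poly R}).[s] * inner (h s - r s) (mass iota (vder z i))).
    apply/funext => s; rewrite -rE -linearB mass_sym /vpol linear_sum inner_sumr.
    by apply: eq_bigr => i _; rewrite linearZ innerZr hornerXn.
  rewrite rint_sum//.
    by rewrite big1// => i _; apply: orth; rewrite size_polyXn.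
  move=> i; apply: LI_cont => s; apply: cvgM; first exact: continuous_horner.
  by apply: cvg_inner; [exact: chr|exact: cvg_cst].
have lw' : L2 `]a, b] w by apply: L2_sub lw; exact: sub_oc.
set e := \int[mu]_(s in `]a, b]) `|w s| * (b - a) ^+ k in re.
apply: (@le_trans _ _ ((b - a) * (Cq * e) ^+ 2)).
  apply: rint_norm_cst => //; apply: aeW => s; rewrite /= in_itv/= => /andP[as_ sb].
  by rewrite -rE; apply: re; rewrite in_itv/= sb ltW.
rewrite /e; have := rint_norm_sqr_itv ab' lw'.
set I1 := \int[mu]_(s in _) `|w s|; set I2 := \int[mu]_(s in _) (`|w s| ^+ 2) => hI.
have -> : (b - a) * (Cq * (I1 * (b - a) ^+ k)) ^+ 2 = (Cq ^+ 2 * (b - a) ^+ (2 * k).+1) * I1 ^+ 2.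
  have -> : (b - a) ^+ (2 * k).+1 = (b - a) * ((b - a) ^+ k) ^+ 2 by rewrite exprS mulnC exprM.
  by ring.
have -> : Cq ^+ 2 * (b - a) ^+ (2 * k.+1) * I2 = (Cq ^+ 2 * (b - a) ^+ (2 * k).+1) * ((b - a) * I2).
  have -> : (b - a) ^+ (2 * k.+1) = (b - a) * (b - a) ^+ (2 * k).+1 by rewrite -exprS mulnS.
  by ring.
by apply: ler_wpM2l => //; rewrite mulr_ge0 ?sqr_ge0// exprn_ge0.
Qed.

(** In the application G and vpol q d are the Riesz representatives of du and
    u_tau', p is a Taylor polynomial of G and e is the error u - u_tau. *)
Definition coef_bound (q : nat) (C : R) :=
  forall (V : hilbertType R) (G p : R -> V) (d : nat -> V) (e : R -> V) (a b eps M : R),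
  a < b -> 0 <= M -> L2 `]a, b] G -> L2 `]a, b] e -> ispol q p ->
  {ae mu, forall s, `]a, b]%classic s -> `|G s - p s| <= eps} ->
  (forall z, vpol q.+1 z a = 0 ->
     `|\int[mu]_(s in `]a, b]) inner (G s - vpol q d s) (vpol q.+1 z s)| <=
     \int[mu]_(s in `]a, b]) (M * (`|e s| * `|vpol q.+1 z s|))) ->
  \int[mu]_(s in `]a, b]) (`|G s - vpol q d s| ^+ 2) <=
    C * ((b - a) * eps ^+ 2 + M ^+ 2 * \int[mu]_(s in `]a, b]) (`|e s| ^+ 2)).

(** D = p - vpol q d has degree < q. Testing with sigma^(l+1) x, where sigma =
    (s - a) / (b - a), bounds its moments for the weight sigma by those of p -
    G and by e; as the Gram matrix of [dual_weights] is invertible, these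
    moments control the coefficients of D in powers of sigma. *)
Lemma derivative_local (q : nat) : exists2 C : R, 0 <= C & coef_bound q C.
Proof.
have [W [_ W2]] := @dual_weights R q.
pose S := \sum_(k < q) \sum_(l < q) `|W k l|.
have S0 : 0 <= S by apply: sumr_ge0 => l _; apply: sumr_ge0.
exists (2 * (1 + S) ^+ 2); first by rewrite mulr_ge0// sqr_ge0.
move=> V G p d e a b eps M ab M0 lG le pp Gp weak.
have ab' := ltW ab; have l0 : 0 < b - a by rewrite subr_gt0.
have mD : measurable `]a, b]%classic by exact: measurable_itv.
have fM := fin_meas_itv false false a b.
have eps0 : 0 <= eps.
  have Gp' : {ae mu, forall s, `]a, b[%classic s -> `|G s - p s| <= eps}.
    by apply: aeS _ Gp => s h sab; apply: h; move: sab; rewrite /= !in_itv/= => /andP[-> /ltW].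
  have [s _ h] := ae_dense ab Gp' (@subset_refl _ _).
  exact: le_trans (normr_ge0 _) h.
pose D s := p s - vpol q d s.
have pD : ispol q D by apply: ispolB => //; exact: ispol_vpol.
have [c cE] := ispol_affine (b - a) a pD.
pose sg s := (s - a) / (b - a).
have sgE s : sg s = (b - a)^-1 * s + - a / (b - a) by rewrite /sg; field; rewrite gt_eqF.
have DE s : D s = vpol q c (sg s).
  by rewrite -cE /sg; congr D; field; rewrite gt_eqF.
have sg01 s : s \in `]a, b] -> 0 <= sg s <= 1.
  rewrite in_itv/= => /andP[as_ sb]; rewrite /sg divr_ge0 ?subr_ge0 ?(ltW as_) ?ab'//=.
  by rewrite ler_pdivrMr// mul1r lerD2r.
have csg (i : nat) : continuous (fun s => sg s ^+ i).
  move=> s; apply: (@continuous_comp R R R sg (fun x => x ^+ i)); last exact: exprn_continuous.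
  rewrite (funext sgE); apply: (@cvgD _ R^o); [apply: cvgMr; exact: cvg_id|exact: cvg_cst].
pose B := (b - a) * eps + M * \int[mu]_(s in `]a, b]) `|e s|.
pose m (l : nat) := \sum_(k < q) (l + k).+2%:R^-1 *: c k.
have key (l : nat) x : (l < q)%N -> (b - a) * inner (m l) x <= B * `|x|.
  move=> lq.
  have pz : ispol q.+1 (fun s => sg s ^+ l.+1 *: x).
    rewrite (funext sgE); apply: (@ispol_affine _ _ _ (fun s => s ^+ l.+1 *: x)).
    have -> : (fun s : R => s ^+ l.+1 *: x) = (fun s => ('X^(l.+1)).[s] *: x).
      by apply/funext => s; rewrite hornerXn.
    by apply: ispol_horner; rewrite size_polyXn ltnS.
  have cz := ispol_cont pz; have [z zE] := pz.
  have z0 : vpol q.+1 z a = 0 by rewrite -zE /sg subrr mul0r expr0n scale0r.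
  have zn s : s \in `]a, b] -> `|vpol q.+1 z s| <= `|x|.
    move=> /sg01/andP[s0 s1]; rewrite -zE normrZ ger0_norm ?exprn_ge0//.
    by rewrite ler_piMl// exprn_ile1.
  have lz : L2 `]a, b] (vpol q.+1 z) by case: (L2_cont a b (vpol_cont (m := q.+1) (c := z))).
  have lp : L2 `]a, b] p by case: (L2_cont a b (ispol_cont pp)).
  have ld : L2 `]a, b] (vpol q d) by case: (L2_cont a b (vpol_cont (m := q) (c := d))).
  have lGp := L2B lG lp; have lGd := L2B lG ld.
  have lne := LI_norm fM le.
  have -> : (b - a) * inner (m l) x = \int[mu]_(s in `]a, b]) inner (D s) (vpol q.+1 z s).
    transitivity (\int[mu]_(s in `]a, b]) \sum_(k < q) inner (c k) x * sg s ^+ (l + k).+1).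
      have LX (k : 'I_q) : LI `]a, b] (fun s => inner (c k) x * sg s ^+ (l + k).+1).
        by apply: LIZ; exact: LI_cont.
      rewrite rint_sum// inner_suml mulr_sumr; apply: eq_bigr => k _.
      rewrite rintZ//; last exact: LI_cont.
      by rewrite moment_up// innerZl; ring.
    apply: eq_Rintegral => s _; rewrite DE -zE innerZr inner_suml mulr_sumr.
    by apply: eq_bigr => k _; rewrite innerZl addnC -addnS exprD; ring.
  have -> : \int[mu]_(s in `]a, b]) inner (D s) (vpol q.+1 z s) =
      \int[mu]_(s in `]a, b]) inner (G s - vpol q d s) (vpol q.+1 z s) -
      \int[mu]_(s in `]a, b]) inner (G s - p s) (vpol q.+1 z s).
    rewrite -(rintB mD (LI_inner lGd lz) (LI_inner lGp lz)); apply: eq_Rintegral => s _.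
    by rewrite -innerBl opprB addrC addrA subrK.
  rewrite /B mulrDl [leRHS]addrC; apply: le_trans (ler_norm _) _; apply: le_trans (ler_normB _ _) _.
  apply: lerD.
    apply: le_trans (weak z z0) _; rewrite mulrAC -rintZ//.
    apply: rint_le_dom => //; last exact: LIZ.
    apply: aeW => s sab; rewrite !mulr_ge0//= mulrAC -mulrA.
    by apply: ler_wpM2l => //; apply: ler_wpM2l => //; exact: zn.
  apply: le_trans (rint_abs mD (LI_inner lGp lz)) _.
  have -> : (b - a) * eps * `|x| = (`|x| * eps) * (b - a) by ring.
  rewrite -rint_cst//; apply: rint_le_dom => //; last exact: LI_cst.
  apply: aeS _ Gp => s h sab; rewrite normr_ge0/=.
  by apply: le_trans (inner_CS _ _) _; rewrite mulrC; apply: ler_pM => //; [exact: zn|exact: h].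
have mB (l : nat) : (l < q)%N -> `|m l| <= B / (b - a).
  move=> lq; have [->|m0] := eqVneq (m l) 0.
    rewrite normr0 divr_ge0 ?(ltW l0)// addr_ge0 ?mulr_ge0 ?(ltW l0)//.
    by apply: rint_ge0 => //; apply: aeW.
  have m1 : 0 < `|m l| by rewrite normr_gt0.
  have := key l (m l) lq; rewrite innerxx expr2 mulrA ler_pM2r// => h.
  by rewrite ler_pdivlMr// mulrC.
have cW (k : 'I_q) : c k = \sum_(l < q) W k l *: m l.
  transitivity (\sum_(j < q) (k == j)%:R *: c j).
    rewrite (bigD1 k)//= eqxx scale1r big1 ?addr0// => j jk.
    by rewrite eq_sym (negbTE jk) scale0r.
  transitivity (\sum_(j < q) (\sum_(l < q) W k l * (l + j).+2%:R^-1) *: c j).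
    by apply: eq_bigr => j _; rewrite W2.
  transitivity (\sum_(j < q) \sum_(l < q) (W k l * (l + j).+2%:R^-1) *: c j).
    by apply: eq_bigr => j _; rewrite scaler_suml.
  rewrite exchange_big; apply: eq_bigr => l _.
  by rewrite /m scaler_sumr; apply: eq_bigr => j _; rewrite scalerA.
have Db s : s \in `]a, b] -> `|D s| <= S * (B / (b - a)).
  move=> /sg01/andP[s0 s1]; rewrite DE /S mulr_suml; apply: le_trans (ler_norm_sum _ _ _) _.
  apply: ler_sum => k _; rewrite normrZ ger0_norm ?exprn_ge0// -[leRHS]mul1r.
  apply: ler_pM => //; [exact: exprn_ge0|exact: exprn_ile1|].
  rewrite cW; apply: le_trans (ler_norm_sum _ _ _) _; rewrite mulr_suml; apply: ler_sum => l _.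
  by rewrite normrZ ler_wpM2l// mB.
pose Z := (1 + S) * (eps + M * \int[mu]_(s in `]a, b]) `|e s| / (b - a)).
have I0 : 0 <= \int[mu]_(s in `]a, b]) `|e s| by apply: rint_ge0 => //; apply: aeW.
apply: (@le_trans _ _ ((b - a) * Z ^+ 2)).
  apply: rint_norm_cst => //; apply: aeS _ Gp => s h sab.
  have -> : G s - vpol q d s = (G s - p s) + D s by rewrite /D addrA subrK.
  apply: le_trans (ler_normD _ _) _; apply: le_trans (lerD (h sab) (Db s sab)) _.
  have -> : B / (b - a) = eps + M * \int[mu]_(s in `]a, b]) `|e s| / (b - a).
    by rewrite /B; field; rewrite gt_eqF.
  rewrite /Z mulrDl mul1r lerD2r lerDl divr_ge0 ?(ltW l0)// mulr_ge0//.
have := rint_norm_sqr_itv ab' le; rewrite /Z.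
move: (\int[mu]_(s in _) `|e s|) I0 => I1 I10.
move: (\int[mu]_(s in _) (`|e s| ^+ 2)) => I2 hI.
rewrite exprMn (mulrCA (b - a)).
set x := eps + M * I1 / (b - a).
have h1 : (b - a) * x ^+ 2 <= 2 * ((b - a) * eps ^+ 2 + M ^+ 2 * I2).
  have -> : x ^+ 2 = 2 * eps ^+ 2 + 2 * (M * I1 / (b - a)) ^+ 2 - (eps - M * I1 / (b - a)) ^+ 2.
    by rewrite /x; ring.
  rewrite !mulrDr.
  have -> : (b - a) * (2 * (M * I1 / (b - a)) ^+ 2) = 2 * (M ^+ 2 * (I1 ^+ 2 / (b - a))).
    by field; rewrite gt_eqF.
  have h2 : M ^+ 2 * (I1 ^+ 2 / (b - a)) <= M ^+ 2 * I2.
    by apply: ler_wpM2l; [exact: sqr_ge0|rewrite ler_pdivrMr// mulrC].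
  have h3 : 0 <= (b - a) * (eps - M * I1 / (b - a)) ^+ 2 by rewrite mulr_ge0 ?sqr_ge0// ltW.
  rewrite mulrN; lra.
rewrite [leRHS](_ : _ = (1 + S) ^+ 2 * (2 * ((b - a) * eps ^+ 2 + M ^+ 2 * I2))); last by ring.
by apply: ler_wpM2l => //; exact: sqr_ge0.
Qed.

End LocalApproximation.

(** * Squared error bounds *)

Section ErrorBounds.
Context {R : realType} {V H : hilbertType R} (iota : blin V H).
Notation mu := (@lebesgue_measure R).
Variables (T M alpha : R) (A : R -> V -> V^dual) (F : R -> V^dual) (u0 : H).
Variables (q N : nat) (t : nat -> R) (u : R -> V) (du : R -> V^dual) (utau : R -> V).
Variable (ub : R -> H).
Hypotheses (gt : gelfand_triple iota) (T0 : 0 < T) (M0 : 0 < M) (al0 : 0 < alpha).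
Hypothesis EA : elliptic_family T M alpha A.
Hypothesis pt : is_partition T N t.
Hypothesis psol : parabolic_solution iota T A F u0 u du.
Hypothesis dg : dg_solution iota T A F u0 q N t utau.
Hypothesis cub : continuous ub.
Hypothesis ubu : {ae mu, forall s, `]0, T]%classic s -> ub s = iota (u s)}.
Hypothesis pw : pairs_with iota T (fun s => riesz (du s)) ub.
Hypothesis ub0 : ub 0 = u0.

Let lu : L2 `]0, T] u. Proof. by case: psol.1 => /L2_of. Qed.
Let ldu : L2 `]0, T] du. Proof. by case: psol.1 => _ /L2_of. Qed.

Let err n := `|ub (t n) - incoming iota u0 t utau n| ^+ 2.

Definition stab_cst := (1 + 2 / alpha) * (M ^+ 2 / alpha + 1 + alpha).

Lemma stab_cst_ge0 : 0 <= stab_cst.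
Proof.
by rewrite mulr_ge0 ?addr_ge0 ?divr_ge0 ?sqr_ge0 ?(ltW al0).
Qed.

Lemma stability_cst (K : R) (x : R -> R) : LI `]0, T] x ->
  (forall n, (n < N)%N -> exists p : nat -> V,
     (forall z, \int[mu]_(s in `]t n, t n.+1])
       inner (ub s - iota (vpol q.+1 p s)) (iota (vpol q (vder z) s)) = 0) /\
     \int[mu]_(s in `]t n, t n.+1]) (`|u s - vpol q.+1 p s| ^+ 2) +
       `|ub (t n.+1) - iota (vpol q.+1 p (t n.+1))| ^+ 2 <=
     K * \int[mu]_(s in `]t n, t n.+1]) x s) ->
  (forall s, 0 <= x s) -> 0 <= K ->
  (forall n, (n <= N)%N -> err n <= stab_cst * K * \int[mu]_(s in `]0, T]) x s) /\
  \int[mu]_(s in `]0, T]) (`|u s - utau s| ^+ 2) <=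
     stab_cst * K * \int[mu]_(s in `]0, T]) x s.
Proof.
move=> Lx hp x0 K0.
have [h1 h2] := stability M0 al0 EA pt psol dg cub pw ub0 Lx hp x0 K0.
have I0 : 0 <= K * \int[mu]_(s in `]0, T]) x s.
  by rewrite mulr_ge0//; apply: rint_ge0 => //; apply: aeW.
rewrite /stab_cst -mulrA; move: (K * _) I0 h1 h2 => Y Y0 h1 h2.
have a0 : 0 <= 2 / alpha by rewrite divr_ge0// ltW.
have c0 : 0 <= M ^+ 2 / alpha + 1 + alpha by rewrite !addr_ge0 ?divr_ge0 ?sqr_ge0 ?(ltW al0).
have cY := mulr_ge0 c0 Y0; have acY := mulr_ge0 a0 cY.
rewrite -mulrA in h2.
have -> : (1 + 2 / alpha) * (M ^+ 2 / alpha + 1 + alpha) * Y =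
    (M ^+ 2 / alpha + 1 + alpha) * Y + 2 / alpha * ((M ^+ 2 / alpha + 1 + alpha) * Y) by ring.
split=> [n /h1 h|]; first by apply: le_trans h _; rewrite lerDl.
by apply: le_trans h2 _; rewrite lerDr.
Qed.

Lemma mesh_exp n j : (n < N)%N -> (t n.+1 - t n) ^+ j <= mesh N t ^+ j.
Proof.
move=> nN; apply: lerXn2r; rewrite ?nnegrE ?mesh_ge0//.
  by rewrite subr_ge0; apply: ltW; exact: part_lt pt _ nN.
exact: step_le_mesh.
Qed.

(** The interpolants of [interp_regular] agree with u at the right endpoints,
    so only the L^2 error enters. *)
Lemma regular_error (C : R) (k : nat) (w : R -> V) : 0 <= C -> interp_bound q C -> (k <= q)%N ->
  weak_derivn T k.+1 (VtoV' iota \o u) (VtoV' iota \o w) -> L2 `]0, T] w ->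
  (forall n, (n <= N)%N -> err n <=
    stab_cst * C * mesh N t ^+ (2 * k.+1) * \int[mu]_(s in `]0, T]) (`|w s| ^+ 2)) /\
  \int[mu]_(s in `]0, T]) (`|u s - utau s| ^+ 2) <=
    stab_cst * C * mesh N t ^+ (2 * k.+1) * \int[mu]_(s in `]0, T]) (`|w s| ^+ 2).
Proof.
move=> C0 interp kq wd lw.
have [h [ch ih uh ubh]] := regular_rep T0 gt lu lw (weak_pair_mass wd) cub ubu.
have := @stability_cst (C * mesh N t ^+ (2 * k.+1)) (fun s => `|w s| ^+ 2) lw.2 _ _ _.
rewrite mulrA; apply.
- move=> n nN; have n0 := part_ge0 pt (ltnW nN); have nT := part_leT pt nN.
  have ltn := part_lt pt nN.
  have [p [pb orth pe]] := interp V H iota T k h w _ _ T0 n0 ltn nT kq lw ih ch.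
  exists p; split.
    move=> z; rewrite -[RHS](orth z); apply: eq_Rintegral => s; rewrite inE/= in_itv/= => /andP[h1 h2].
    by rewrite ubh// in_itv/= (le_trans n0 (ltW h1)) (le_trans h2 nT).
  rewrite ubh; last by rewrite in_itv/= nT (le_trans n0 (ltW ltn)).
  rewrite pb subrr normr0 expr0n addr0.
  rewrite (_ : \int[mu]_(s in _) (`|u s - vpol q.+1 p s| ^+ 2) =
    \int[mu]_(s in `]t n, t n.+1]) (`|h s - vpol q.+1 p s| ^+ 2)); last first.
    apply: rint_ae; apply: aeS _ uh => s hs sn; rewrite hs//.
    by move: s sn {hs}; exact: sub_oc.
  apply: le_trans pe _; apply: ler_wpM2r.
    by apply: rint_ge0 => //; apply: aeW => s _; exact: sqr_ge0.
  by apply: ler_wpM2l => //; exact: mesh_exp.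
- by move=> s; exact: sqr_ge0.
- by rewrite mulr_ge0// exprn_ge0// mesh_ge0.
Qed.

(** For q = 0 and no further regularity, the interpolant on an interval is the
    constant u(s) for a point s of this interval at which u is controlled by
    [trace_rep]. *)
Lemma constant_error : q = 0%N ->
  (forall a b, 0 <= a -> a < b -> b <= T -> exists s,
      (b - a) * `|u s| ^+ 2 <= 2 * \int[mu]_(t in `]a, b]) (`|u t| ^+ 2 + `|du t| ^+ 2) /\
      `|ub b - iota (u s)| ^+ 2 <= 14 * \int[mu]_(t in `]a, b]) (`|u t| ^+ 2 + `|du t| ^+ 2)) ->
  \int[mu]_(s in `]0, T]) (`|u s - utau s| ^+ 2) <=
    stab_cst * 20 * \int[mu]_(s in `]0, T]) (`|u s| ^+ 2 + `|du s| ^+ 2).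
Proof.
move=> q0 tr.
(* 20 = 6 + 14: 2 for u and 4 for the constant in the L^2 error, 14 at the endpoint *)
apply: (@stability_cst 20 (fun s => `|u s| ^+ 2 + `|du s| ^+ 2) (LID lu.2 ldu.2) _ _ _).2 => //.
  move=> n nN; have n0 := part_ge0 pt (ltnW nN); have nT := part_leT pt nN.
  have ltn := part_lt pt nN; have [s0 [h1 h2]] := tr _ _ n0 ltn nT.
  have pE s : vpol q.+1 (fun=> u s0) s = u s0 by rewrite q0 /vpol big_ord1 expr0 scale1r.
  exists (fun=> u s0); split.
    move=> z; rewrite -[RHS](@rint0 _ `]t n, t n.+1])//; apply: eq_Rintegral => s _.
    by rewrite q0 /vpol big_ord0 linear0 inner0r.
  rewrite pE; under eq_Rintegral do rewrite pE.
  have lu' := L2_piece pt nN lu; have ldu' := L2_piece pt nN ldu.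
  have mD : measurable `]t n, t n.+1]%classic by exact: measurable_itv.
  have fM := fin_meas_itv false false (t n) (t n.+1).
  have lc := LI_cst (2 * `|u s0| ^+ 2) fM.
  have h3 : \int[mu]_(s in `]t n, t n.+1]) (`|u s - u s0| ^+ 2) <=
      2 * \int[mu]_(s in `]t n, t n.+1]) (`|u s| ^+ 2) + 2 * ((t n.+1 - t n) * `|u s0| ^+ 2).
    have -> : 2 * ((t n.+1 - t n) * `|u s0| ^+ 2) = 2 * `|u s0| ^+ 2 * (t n.+1 - t n) by ring.
    rewrite -(rint_cst _ (ltW ltn)) -(rintZ mD _ lu'.2) -(rintD mD (@LIZ _ _ _ 2 lu'.2) lc).
    apply: rint_le_dom => //; last exact: LID (@LIZ _ _ _ 2 lu'.2) lc.
    apply: aeW => s _; rewrite sqr_ge0/=.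
    by have := norm_sqrD_le (u s) (- u s0); rewrite normrN.
  have h4 : \int[mu]_(s in `]t n, t n.+1]) (`|u s| ^+ 2) <=
      \int[mu]_(s in `]t n, t n.+1]) (`|u s| ^+ 2 + `|du s| ^+ 2).
    apply: (rint_le mD lu'.2 (LID lu'.2 ldu'.2)); apply: aeW => s _.
    by rewrite lerDl sqr_ge0.
  move: h1 h2 h3 h4; set X := \int[mu]_(s in _) (_ + _).
  set i1 := \int[mu]_(s in _) (`|u s| ^+ 2); set i2 := \int[mu]_(s in _) _.
  lra.
Qed.

Lemma derivative_error_piece n (P : nat -> V) : (n < N)%N ->
  (forall s, s \in `]t n, t n.+1] -> utau s = vpol q.+1 P s) ->
  L2norm `]t n, t n.+1] (fun s => du s - VtoV' iota (derive1 utau s)) ^+ 2 =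
  \int[mu]_(s in `]t n, t n.+1])
     (`|riesz (du s) - vpol q (fun i => mass iota (vder P i)) s| ^+ 2).
Proof.
move=> nN uP; rewrite /L2norm sqr_sqrtr; last first.
  by apply: rint_ge0 => //; apply: aeW => s _; exact: sqr_ge0.
rewrite -!rint_oo_oc; apply: eq_Rintegral => s; rewrite inE/= => sn.
rewrite (derive1_piece uP (vpol_derive q P s) sn) -riesz_norm rieszB.
congr (`|_ - _| ^+ 2).
exact: mass_vpol.
Qed.

(** Test functions that vanish at t_n remove the jump from the local equation,
    which then bounds the moments of du - u_tau' by M and the error in
    L^2(J_n; V). *)
Lemma derivative_error (C : R) (k : nat) (dw : R -> V^dual) : q = k.+1 -> 0 <= C ->
  coef_bound q C ->
  L2 `]0, T] dw ->
  weak_pair (@id_blin R V) T q (fun s => riesz (du s)) (fun s => riesz (dw s)) ->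
  \sum_(n < N) L2norm `]t n, t n.+1] (fun s => du s - VtoV' iota (derive1 utau s)) ^+ 2 <=
  C * (mesh N t ^+ (2 * q) * \int[mu]_(s in `]0, T]) (`|dw s| ^+ 2) +
       M ^+ 2 * \int[mu]_(s in `]0, T]) (`|u s - utau s| ^+ 2)).
Proof.
move=> qk C0 loc ldw wp.
have lg : L2 `]0, T] (fun s => riesz (du s)) := L2_riesz ldu.
have lrw : L2 `]0, T] (fun s => riesz (dw s)) := L2_riesz ldw.
have [h ih gh] := weak_repr T0 (@id_blin_inj R V) lg lrw wp.
rewrite (rint_partT pt ldw.2) (rint_partT pt); last first.
  by apply: (LI_glue pt) => n nN; exact: (L2_err pt psol dg nN).2.
rewrite !mulr_sumr -big_split/= mulr_sumr; apply: ler_sum => -[n nN] _ /=.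
have [P uP] := utau_vpol dg nN.
rewrite (derivative_error_piece nN uP).
have n0 := part_ge0 pt (ltnW nN); have nT := part_leT pt nN; have ltn := part_lt pt nN.
have [p [pp _ pe]] : exists p, [/\ ispol q p, p (t n.+1) = h (t n.+1) &
    forall s, s \in `[t n, t n.+1] -> `|h s - p s| <=
      \int[mu]_(s in `]t n, t n.+1]) `|dw s| * (t n.+1 - t n) ^+ k].
  rewrite qk in ih *; have [p [h1 h2 h3]] := taylor T0 n0 (ltW ltn) nT lrw ih.
  exists p; split => // s /h3; under eq_Rintegral do rewrite riesz_norm.
  by [].
have lu' := L2_piece pt nN lu; have ldu' := L2_piece pt nN ldu.
have lg' : L2 `]t n, t n.+1] (fun s => riesz (du s)) := L2_piece pt nN lg.
have mD : measurable `]t n, t n.+1]%classic by exact: measurable_itv.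
have Ln := L2_err pt psol dg nN.
have Gp : {ae mu, forall s, `]t n, t n.+1]%classic s -> `|riesz (du s) - p s| <=
    \int[mu]_(s in `]t n, t n.+1]) `|dw s| * (t n.+1 - t n) ^+ k}.
  apply: aeS _ gh => s hs sn; rewrite hs.
    by apply: pe; move: sn; rewrite /= !in_itv/= => /andP[/ltW-> ->].
  by move: s sn {hs}; exact: sub_oc.
apply: le_trans (loc V _ p _ (fun s => u s - utau s) _ _ _ M ltn (ltW M0) lg' Ln pp Gp _) _.
  move=> z z0.
  have E := dg_local_vpol pt psol dg z nN uP.
  rewrite z0 linear0 inner0r addr0 in E.
  have lc m (c : nat -> V) : L2 `]t n, t n.+1] (vpol m c).
    by case: (L2_cont (t n) (t n.+1) (vpol_cont (m := m) (c := c))).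
  have LAP := form_oc M0 EA n0 nT (lc q.+1 P) (lc q.+1 z).
  have LAu := form_oc M0 EA n0 nT lu' (lc q.+1 z).
  have Li (c : nat -> V) m : continuous (fun s => iota (vpol m c s)).
    by apply: iota_cont; exact: vpol_cont.
  have Lm : LI `]t n, t n.+1] (fun s => inner (iota (vpol q (vder P) s)) (iota (vpol q.+1 z s))).
    exact: LI_inner_cont.
  have Lgz := LI_inner lg' (lc q.+1 z).
  rewrite (rintD mD Lm LAP) (rintD mD Lgz LAu) in E.
  have -> : \int[mu]_(s in `]t n, t n.+1])
       inner (riesz (du s) - vpol q (fun i => mass iota (vder P i)) s) (vpol q.+1 z s) =
     \int[mu]_(s in `]t n, t n.+1]) (A s (vpol q.+1 P s) (vpol q.+1 z s) - A s (u s) (vpol q.+1 z s)).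
    rewrite (rintB mD LAP LAu).
    transitivity (\int[mu]_(s in `]t n, t n.+1])
      (inner (riesz (du s)) (vpol q.+1 z s) - inner (iota (vpol q (vder P) s)) (iota (vpol q.+1 z s)))).
      apply: eq_Rintegral => s _; rewrite innerBl -massE; congr (_ - inner _ _).
      by rewrite mass_vpol.
    by rewrite (rintB mD Lgz Lm); lra.
  have lAB := LIB LAP LAu.
  apply: le_trans (rint_abs mD lAB) _; apply: (rint_le mD (LI_abs lAB)).
    apply: LIZ; have -> : (fun s => `|u s - utau s| * `|vpol q.+1 z s|) =
      (fun s => `|vpol q.+1 z s| * `|u s - utau s|) by apply/funext => s; rewrite mulrC.
    apply: LI_mulcont; last exact: LI_norm (fin_meas_itv _ _ _ _) Ln.
    by move=> s; apply: cvg_norm; exact: vpol_cont.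
  apply: aeS _ (form_ae EA n0 nT) => s hs sn; have [lA bA _] := hs sn.
  by rewrite -lin_formB// mulrA -(uP s sn) distrC; apply: le_trans (bA _ _) _; rewrite distrC.
apply: ler_wpM2l => //; rewrite lerD2r.
have := rint_norm_sqr_itv (ltW ltn) (L2_piece pt nN ldw).
set I1 := \int[mu]_(s in _) `|dw s|; set I2 := \int[mu]_(s in _) (`|dw s| ^+ 2) => hI.
have I20 : 0 <= I2 by apply: rint_ge0 => //; apply: aeW => s _; exact: sqr_ge0.
have l0 : 0 <= t n.+1 - t n by rewrite subr_ge0 ltW.
apply: (@le_trans _ _ ((t n.+1 - t n) ^+ (2 * q) * I2)); last by apply: ler_wpM2r => //; exact: mesh_exp.
have -> : (t n.+1 - t n) * (I1 * (t n.+1 - t n) ^+ k) ^+ 2 = (t n.+1 - t n) ^+ (2 * k).+1 * I1 ^+ 2.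
  have -> : (t n.+1 - t n) ^+ (2 * k).+1 = (t n.+1 - t n) * ((t n.+1 - t n) ^+ k) ^+ 2 by rewrite exprS mulnC exprM.
  by ring.
have -> : (t n.+1 - t n) ^+ (2 * q) * I2 = (t n.+1 - t n) ^+ (2 * k).+1 * ((t n.+1 - t n) * I2).
  have -> : (t n.+1 - t n) ^+ (2 * q) = (t n.+1 - t n) * (t n.+1 - t n) ^+ (2 * k).+1.
    by rewrite -exprS qk mulnS.
  by ring.
by apply: ler_wpM2l => //; rewrite exprn_ge0.
Qed.

Lemma derivative_error0 : q = 0%N ->
  \sum_(n < N) L2norm `]t n, t n.+1] (fun s => du s - VtoV' iota (derive1 utau s)) ^+ 2 =
  \int[mu]_(s in `]0, T]) (`|du s| ^+ 2).
Proof.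
move=> q0; rewrite (rint_partT pt ldu.2); apply: eq_bigr => -[n nN] _ /=.
have [P uP] := utau_vpol dg nN.
rewrite (derivative_error_piece nN uP); apply: eq_Rintegral => s _.
by rewrite q0 /vpol big_ord0 subr0 riesz_norm.
Qed.

End ErrorBounds.

(** * The error estimates *)

Section Conclusion.
Context {R : realType}.
Notation mu := (@lebesgue_measure R).

Lemma sqrt_bound (a C x X : R) j : 0 <= C -> 0 <= x ->
  a <= C * x ^+ (2 * j) * X -> Num.sqrt a <= Num.sqrt C * x ^+ j * Num.sqrt X.
Proof.
move=> C0 x0 h; have xj : 0 <= x ^+ j by exact: exprn_ge0.
rewrite -[x ^+ j]ger0_norm// -sqrtr_sqr -!sqrtrM ?mulr_ge0 ?sqr_ge0//.
by apply: ler_wsqrtr; rewrite -exprM mulnC.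
Qed.

Lemma L2norm_oc (E : normedModType R) (T : R) (f : R -> E) :
  L2norm `]0, T[ f = Num.sqrt (\int[mu]_(s in `]0, T]) (`|f s| ^+ 2)).
Proof. by rewrite /L2norm rint_oo_oc. Qed.

Lemma Xnorm_oc (V : hilbertType R) (T : R) (w : R -> V) (dw : R -> V^dual) :
  Xnorm T w dw = Num.sqrt (\int[mu]_(s in `]0, T]) (`|w s| ^+ 2) +
                          \int[mu]_(s in `]0, T]) (`|dw s| ^+ 2)).
Proof.
by rewrite /Xnorm !L2norm_oc !sqr_sqrtr// rint_ge0//; apply: aeW => s _; exact: sqr_ge0.
Qed.

Lemma nodal_le (V H : hilbertType R) (iota : blin V H) (T : R) N (t : nat -> R) (u utau : R -> V)
    (ub : R -> H) (u0 : H) (B : R) : is_partition T N t -> 0 <= B ->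
  (forall s, s \in `[0, T] -> C0rep iota T u s = ub s) ->
  (forall n, (n <= N)%N -> `|ub (t n) - incoming iota u0 t utau n| <= B) ->
  nodal_error iota T N t u utau <= B.
Proof.
move=> pt B0 ubE hB; rewrite /nodal_error big_seq.
apply: (big_ind (fun x => x <= B)) => // [x y xB yB|n].
  by rewrite ge_max xB.
rewrite mem_index_iota ltnS => /andP[n1 nN].
rewrite ubE; last by rewrite in_itv/= (part_ge0 pt nN) (part_leT pt nN).
by have := hB n nN; case: n n1 {nN}.
Qed.

End Conclusion.

Theorem theorem6 (R : realType) (alpha M : R) (q : nat)
    (alpha_gt0 : 0 < alpha) (M_gt0 : 0 < M) :
  exists c3 c4 : R, [/\ 0 < c3, 0 < c4 &
  forall (V H : hilbertType R) (iota : blin V H) (T : R)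
    (A : R -> V -> V^dual) (F : R -> V^dual) (u0 : H)
    (N : nat) (t : nat -> R)
    (u : R -> V) (du : R -> V^dual) (utau : R -> V),
  gelfand_triple iota -> 0 < T -> elliptic_family T M alpha A ->
  in_L2 `]0, T[ F ->
  is_partition T N t -> mesh N t <= 1 ->
  parabolic_solution iota T A F u0 u du ->
  dg_solution iota T A F u0 q N t utau ->
  [/\ (* u^(q) = w in X, with w' = dw *)
      forall (w : R -> V) (dw : R -> V^dual),
        weak_derivn T q (VtoV' iota \o u) (VtoV' iota \o w) ->
        in_X iota T w dw ->
        Num.sqrt (\sum_(n < N) L2norm `]t n, t n.+1]
            (fun s => du s - VtoV' iota (derive1 utau s)) ^+ 2)
          + L2norm `]0, T[ (fun s => u s - utau s)
        <= c3 * mesh N t ^+ q * Xnorm T w dw,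
      (* u^(q+1) = w in L^2(J; V) *)
      (1 <= q)%N -> forall w : R -> V,
        weak_derivn T q.+1 (VtoV' iota \o u) (VtoV' iota \o w) ->
        in_L2 `]0, T[ w ->
        nodal_error iota T N t u utau
          + L2norm `]0, T[ (fun s => u s - utau s)
        <= c4 * mesh N t ^+ q.+1 * L2norm `]0, T[ w &
      (* u' = w in X, with w' = dw *)
      q = 0%N -> forall (w : R -> V) (dw : R -> V^dual),
        weak_derivn T 1 (VtoV' iota \o u) (VtoV' iota \o w) ->
        in_X iota T w dw ->
        nodal_error iota T N t u utau
          + L2norm `]0, T[ (fun s => u s - utau s)
        <= c4 * mesh N t * Xnorm T w dw]].
Proof.
have [Ci Ci0 interp] := @interp_regular R q.
have [Cd Cd0 deriv] := @derivative_local R q.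
pose K := stab_cst M alpha.
have K0 : 0 <= K by exact: stab_cst_ge0.
pose c1 := K * Ci.
have c10 : 0 <= c1 by exact: mulr_ge0.
pose c2 := K * 20 + c1.
have c20 : 0 <= c2 by rewrite addr_ge0// mulr_ge0.
(* D bounds the squared error of the derivative, which involves that of u through Cd *)
pose D := 1 + Cd * (1 + M ^+ 2 * c2).
have CM : 0 <= Cd * (1 + M ^+ 2 * c2).
  by apply: mulr_ge0 => //; rewrite addr_ge0// mulr_ge0// sqr_ge0.
have D0 : 0 <= D by exact: addr_ge0.
exists (Num.sqrt D + Num.sqrt c2 + 1), (2 * Num.sqrt c1 + 1); split.
- by rewrite ltr_wpDl// addr_ge0 ?sqrtr_ge0.
- by rewrite ltr_wpDl// mulr_ge0 ?sqrtr_ge0.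
move=> V H iota T A F u0 N t u du utau gt T0 EA _ pt _ psol dg.
have [ub [cub ubu pw tr]] := trace_rep T0 gt psol.1.
have ubE := C0rep_eq T0 cub ubu.
have ub0 : ub 0 = u0.
  have <- : C0rep iota T u 0 = ub 0 by apply: ubE; rewrite in_itv/= lexx ltW.
  exact: initial_value psol.
have m0 : 0 <= mesh N t by exact: mesh_ge0.
have reg k (w : R -> V) : (k <= q)%N -> weak_derivn T k.+1 (VtoV' iota \o u) (VtoV' iota \o w) ->
    in_L2 `]0, T[ w ->
    (forall n, (n <= N)%N -> `|ub (t n) - incoming iota u0 t utau n| ^+ 2 <=
      c1 * mesh N t ^+ (2 * k.+1) * \int[lebesgue_measure]_(s in `]0, T]) (`|w s| ^+ 2)) /\
    \int[lebesgue_measure]_(s in `]0, T]) (`|u s - utau s| ^+ 2) <=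
      c1 * mesh N t ^+ (2 * k.+1) * \int[lebesgue_measure]_(s in `]0, T]) (`|w s| ^+ 2).
  move=> kq wd /L2_of lw.
  exact: (regular_error gt T0 M_gt0 alpha_gt0 EA pt psol dg cub ubu pw ub0 Ci0 interp kq wd lw).
have nodal k (w : R -> V) : (k <= q)%N -> weak_derivn T k.+1 (VtoV' iota \o u) (VtoV' iota \o w) ->
    in_L2 `]0, T[ w ->
    nodal_error iota T N t u utau + L2norm `]0, T[ (fun s => u s - utau s) <=
    (2 * Num.sqrt c1 + 1) * mesh N t ^+ k.+1 * L2norm `]0, T[ w.
  move=> kq wd lw; have [h1 h2] := reg k w kq wd lw.
  rewrite !L2norm_oc; have := sqrt_bound c10 m0 h2.
  set X := Num.sqrt _; set Y := Num.sqrt (\int[lebesgue_measure]_(s in `]0, T]) (`|w s| ^+ 2)) => hX.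
  have B0 : 0 <= mesh N t ^+ k.+1 * Y by rewrite mulr_ge0 ?exprn_ge0 ?sqrtr_ge0.
  have : nodal_error iota T N t u utau <= Num.sqrt c1 * mesh N t ^+ k.+1 * Y.
    apply: (nodal_le pt _ ubE) => [|n nN].
      by rewrite -mulrA mulr_ge0 ?sqrtr_ge0.
    rewrite -[leLHS]ger0_norm// -sqrtr_sqr; apply: sqrt_bound => //; exact: h1.
  move: hX; rewrite -!mulrA; move: (mesh N t ^+ k.+1 * Y) B0 => Z Z0.
  by move: (nodal_error iota T N t u utau) (Num.sqrt c1) => e c; rewrite mulrDl mul1r -mulrA; lra.
split.
- move=> w dw wq wX; have [lw ldw _] := wX.
  have lw' := L2_of lw; have ldw' := L2_of ldw; have lu' : L2 `]0, T] u by case: psol.1 => /L2_of.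
  have ldu' : L2 `]0, T] du by case: psol.1 => _ /L2_of.
  have wp := weak_pair_deriv psol.1 wX wq.
  rewrite L2norm_oc Xnorm_oc.
  set I1 := \int[lebesgue_measure]_(s in `]0, T]) (`|u s - utau s| ^+ 2).
  set I2 := \int[lebesgue_measure]_(s in `]0, T]) (`|w s| ^+ 2); set I3 := \int[lebesgue_measure]_(s in `]0, T]) (`|dw s| ^+ 2).
  set S := \sum_(n < N) _.
  have I20 : 0 <= I2 by apply: rint_ge0 => //; apply: aeW => s _; exact: sqr_ge0.
  have I30 : 0 <= I3 by apply: rint_ge0 => //; apply: aeW => s _; exact: sqr_ge0.
  have mq : 0 <= mesh N t ^+ (2 * q) by exact: exprn_ge0.
  suff [hS hI] : S <= D * mesh N t ^+ (2 * q) * (I2 + I3) /\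
      I1 <= c2 * mesh N t ^+ (2 * q) * (I2 + I3).
    have h1 := sqrt_bound D0 m0 hS; have h2 := sqrt_bound c20 m0 hI.
    apply: le_trans (lerD h1 h2) _; rewrite -!mulrDl -!mulrA.
    apply: ler_wpM2r; last by rewrite lerDl.
    by rewrite mulr_ge0 ?exprn_ge0 ?sqrtr_ge0.
  have [q0|q_gt0] := posnP q.
    rewrite q0 in wq wp *; rewrite muln0 expr0 !mulr1.
    have uw : {ae @lebesgue_measure R, forall s, `]0, T]%classic s -> u s = w s}.
      by have [h -> //] := weak_repr T0 gt.1 lu' lw' (weak_pair_mass wq).
    have duw : {ae @lebesgue_measure R, forall s, `]0, T]%classic s -> riesz (du s) = riesz (dw s)}.
      by have [h -> //] := weak_repr T0 (@id_blin_inj R V) (L2_riesz ldu') (L2_riesz ldw') wp.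
    have E2 : \int[lebesgue_measure]_(s in `]0, T]) (`|u s| ^+ 2) = I2.
      by apply: rint_ae; apply: aeS _ uw => s h /h ->.
    have E3 : \int[lebesgue_measure]_(s in `]0, T]) (`|du s| ^+ 2) = I3.
      apply: rint_ae; apply: aeS _ duw => s h /h e.
      by rewrite -riesz_norm e riesz_norm.
    split.
      rewrite /S (derivative_error0 pt psol dg q0) E3.
      apply: (@le_trans _ _ (1 * (I2 + I3))); first by rewrite mul1r lerDr.
      by apply: ler_wpM2r; [exact: addr_ge0|rewrite lerDl].
    apply: le_trans (constant_error M_gt0 alpha_gt0 EA pt psol dg cub pw ub0 q0 tr) _.
    rewrite (rintD _ lu'.2 ldu'.2)// E2 E3.
    by apply: ler_wpM2r; [exact: addr_ge0|rewrite lerDl].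
  have qk : q = q.-1.+1 by rewrite prednK.
  have hI : I1 <= c1 * mesh N t ^+ (2 * q) * I2.
    have kq : (q.-1 <= q)%N by exact: leq_pred.
    by have [_] := reg q.-1 w kq ltac:(by rewrite -qk) lw; rewrite -qk.
  have hI' : I1 <= c2 * mesh N t ^+ (2 * q) * (I2 + I3).
    apply: le_trans hI _; apply: ler_pM => //.
    - exact: mulr_ge0.
    - by apply: ler_wpM2r => //; rewrite lerDr; exact: mulr_ge0.
    - by rewrite lerDl.
  split => //.
  apply: le_trans (derivative_error T0 M_gt0 EA pt psol dg qk Cd0 deriv ldw' wp) _.
  rewrite -/I1 -/I3; move: (mesh N t ^+ (2 * q)) mq hI' => Q Q0 hI'.
  have M20 : 0 <= M ^+ 2 by exact: sqr_ge0.
  have h1 := ler_wpM2l M20 hI'.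
  have h2 : Q * I3 <= Q * (I2 + I3) by apply: ler_wpM2l => //; rewrite lerDr.
  have h3 : Cd * (Q * I3 + M ^+ 2 * I1) <= Cd * (Q * (I2 + I3) + M ^+ 2 * (c2 * Q * (I2 + I3))).
    by apply: ler_wpM2l => //; exact: lerD.
  apply: le_trans h3 _.
  have h4 : 0 <= Q * (I2 + I3) by rewrite mulr_ge0// addr_ge0.
  have -> : D * Q * (I2 + I3) =
    Q * (I2 + I3) + Cd * (Q * (I2 + I3) + M ^+ 2 * (c2 * Q * (I2 + I3))) by rewrite /D; ring.
  by rewrite lerDr.
- by move=> q1 w wd lw; exact: nodal.
- move=> q0 w dw wd wX; have [lw _ _] := wX.
  have := nodal 0%N w ltac:(by []) wd lw; rewrite expr1; move/le_trans; apply.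
  apply: ler_wpM2l.
    by rewrite mulr_ge0// addr_ge0// mulr_ge0// sqrtr_ge0.
  rewrite L2norm_oc Xnorm_oc; apply: ler_wsqrtr; rewrite lerDl.
  by apply: rint_ge0 => //; apply: aeW => s _; exact: sqr_ge0.
Qed.
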